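(* Let $\Delta$ be a connected poset with countable fundamental group $\Pi=\pi_1^a(\Delta)$ (with the discrete topology), $a\in\Delta$, let $\mathcal S=(S,r)^\Delta$ be a DR-presheaf bundle over $\Delta$ and $\varrho$ a section of $\mathcal S$, of dimension $d\in\mathbb N$. Then $\varrho$ defines: (i) a $C^*$-bundle $(\mathcal O_\varrho,r^\varrho_* )_\Delta$ of fixed-point algebras of the Cuntz algebra $\mathcal O_d$: its fibres are the Doplicher–Roberts algebras $O_{\varrho,o}$, $o\in\Delta$, and each of them is *-isomorphic to the fixed-point algebra of $\mathcal O_d$ under the action of the compact group $G_\bullet$; (ii) a bundle $C^*$-gerbe $\check{\mathcal F}_\varrho=(F_\varrho,\jmath)_\Delta$ with fibres isomorphic to $\mathcal O_d$, having the bundle in (i) as fixed-point bundle up to isomorphism; (iii) a twisted $C^*$-dynamical system $\mathcal O_*=(\mathcal O_d,\alpha^\varrho_a,\bar\jmath^{\,a},\gamma_* )$ over $G_\bullet,\Pi$, where $\bar\jmath^{\,a}:\Pi\to\mathrm{Aut}\,\mathcal O_d$ and $\gamma_*:\Pi\times\Pi\to G_\bullet$ are given by the twisted holonomy of $\check{\mathcal F}_\varrho$.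
   Context: **Posets.** Let $\Delta$ be a poset. $\Sigma_0(\Delta)=\Delta$; for $n\ge1$ an $n$-simplex $d\in\Sigma_n(\Delta)$ is a tuple $(\partial_0d,\dots,\partial_nd;|d|)$ with $\partial_kd\in\Sigma_{n-1}(\Delta)$, $|d|\in\Delta$, $|\partial_kd|\le|d|$ (with $|o|=o$ for $o\in\Delta$) and $\partial_{hk}d=\partial_{k\,h+1}d$ for $h\ge k$, $\partial_{hk}:=\partial_h\circ\partial_k$. A 1-simplex $b=(\partial_0b,\partial_1b;|b|)$ goes from $\partial_1b$ to $\partial_0b$; $\iota_a=(a,a;a)$. $N_1(\Delta)\subset\Sigma_1(\Delta)$ is the set of $b$ with $\partial_1b\le\partial_0b=|b|$ (i.e. pairs $o\le\omega$, $\partial_1b=o$, $\partial_0b=\omega$); $N_2(\Delta)\subset\Sigma_2(\Delta)$ consists of the simplices attached to chains $o\le\omega\le\xi$: $\partial_2c=(o\le\omega)$, $\partial_0c=(\omega\le\xi)$, $\partial_1c=(o\le\xi)$, $|c|=\xi$. A path $p=b_n*\dots*b_1:a\to o$ is a composable sequence of 1-simplices; homotopy of paths is the equivalence relation generated by replacing $\partial_1c$ with $\partial_0c*\partial_2c$, $c\in\Sigma_2(\Delta)$; $\pi_1^a(\Delta)$ is the group of homotopy classes of loops $a\to a$. $\Delta$ is connected if any two elements are joined by a path. **DR-presheaf bundles.** A DR-category is a symmetric (strict) tensor $C^*$-category with conjugates whose tensor identity $\iota$ satisfies $(\iota,\iota)\simeq\mathbb C$; $(\rho,\sigma)$ denotes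 the space of arrows from $\rho$ to $\sigma$. A DR-presheaf bundle $\mathcal S=(S,r)^\Delta$ is a family of DR-categories $S_o$ with tensor *-isomorphisms $r_{o\omega}:S_\omega\to S_o$ ($o\le\omega$) satisfying $r_{o\omega}\circ r_{\omega\xi}=r_{o\xi}$. A section is a family $\varrho=\{\varrho_o\in\mathrm{obj}\,S_o\}$ with $r_{o\omega}(\varrho_\omega)=\varrho_o$ for $o\le\omega$. For each $o$ an embedding functor $H_o:S_o\to\mathbf{Hilb}$ (faithful symmetric tensor *-functor into Hilbert spaces) exists by Doplicher–Roberts; the dimension of $\varrho$ is $d=\dim H_a(\varrho_a)$. $G_\bullet:=U_\otimes(H_a)$ is the compact group of unitary tensor natural transformations $g=\{g^\rho\in U(H_a(\rho))\}$ of $H_a$ (so $g^{\rho\sigma}=g^\rho\otimes g^\sigma$ and $g^\sigma H_a(t)=H_a(t)g^\rho$ for $t\in(\rho,\sigma)$). **Doplicher–Roberts algebras.** For an object $\rho$ of a DR-category, $O_\rho$ is the $C^*$-algebra generated by the spaces $(\rho^l,\rho^m)$, $l,m\in\mathbb N$, of arrows between tensor powers: for $k\in\mathbb Z$ let $O_\rho^k$ be the Banach inductive limit of $(\rho^l,\rho^{l+k})$ under $t\mapsto t\otimes1_\rho$; composition and adjoint make $\oplus_kO_\rho^k$ a $\mathbb Z$-graded *-algebra, and $O_\rho$ is its completion in the $C^*$-norm for which the grading is given by a continuous circle action. Set $O_{\varrho,o}:=O_{\varrho_o}$; the functors $r_{eo}$ induce *-isomorphisms $r^\varrho_{eo,*}:O_{\varrho,o}\to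 O_{\varrho,e}$ for $e\le o$, and $r^\varrho_{oe,*}:=(r^\varrho_{eo,*})^{-1}$. **Cuntz algebra.** $\mathcal O_d$ is the universal $C^*$-algebra generated by isometries $\psi_1,\dots,\psi_d$ with $\psi_h^*\psi_k=\delta_{hk}1$, $\sum_k\psi_k\psi_k^*=1$. $\mathbb U(d)$ acts on it by $\psi_h\mapsto\sum_kg_{hk}\psi_k$. $\alpha^\varrho_a:G_\bullet\to\mathrm{Aut}\,\mathcal O_d$ is the composition of $g\mapsto g^{\varrho_a}\in U(H_a(\varrho_a))\simeq\mathbb U(d)$ with this action. **$C^*$-bundles and gerbes.** A $C^*$-bundle $(A,\imath)_\Delta$ is a family of $C^*$-algebras $A_o$ with *-isomorphisms $\imath_{\omega o}:A_o\to A_\omega$ ($o\le\omega$), $\imath_{\xi\omega}\circ\imath_{\omega o}=\imath_{\xi o}$. A 2-group ${}^2G=(G\to N)$ is a pair of group morphisms $i:G\to N$, $g\mapsto\underline g$, and $N\to\mathrm{Aut}\,G$, $u\mapsto\widehat u$, with $i(\widehat u(g))=ui(g)u^{-1}$, $\widehat{i(g)}(h)=ghg^{-1}$. A non-abelian cocycle $q=(u,g)\in\check Z^2(\Delta,{}^2G)$ is a pair $u:\Sigma_1(\Delta)\to N$, $g:\Sigma_2(\Delta)\to G$ with $\underline{g_c}=u_{\partial_0c}u_{\partial_2c}u_{\partial_1c}^{-1}$ and $g_{\partial_0d}g_{\partial_2d}=\widehat u_{\partial_{01}d}(g_{\partial_3d})g_{\partial_1d}$. A bundle $C^*$-gerbe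 (more precisely $q$-gerbe) $(F,\jmath)_\Delta$ is a family of $C^*$-algebras $F_o$ with actions $\alpha_o:G\to\mathrm{Aut}\,F_o$ and *-isomorphisms $\jmath_b:F_{\partial_1b}\to F_{\partial_0b}$, $b\in N_1(\Delta)$, with $\alpha_{\partial_{01}c}(g_c)\circ\jmath_{\partial_1c}=\jmath_{\partial_0c}\circ\jmath_{\partial_2c}$ for $c\in N_2(\Delta)$ and $\jmath_b\circ\alpha_{\partial_1b}(g)=\alpha_{\partial_0b}(\widehat u_b(g))\circ\jmath_b$; here the group acting is the image $\alpha^\varrho_a(G_\bullet)\subseteq\mathrm{Aut}\,\mathcal O_d$ with its normalizer 2-group. One extends $\jmath$ to $\Sigma_1(\Delta)$ by $\jmath_b:=\jmath_{|b|\partial_0b}^{-1}\circ\jmath_{|b|\partial_1b}$ and sets $\jmath_p:=\jmath_{b_n}\circ\dots\circ\jmath_{b_1}$. The fixed-point bundle of the gerbe has fibres $F_o^G$ and structure the restrictions of the $\jmath_b$. **Twisted $C^*$-dynamical systems.** Given an action $\alpha:G\to\mathrm{Aut}\,A$, with $N_\alpha A$ the normalizer of $\alpha(G)$ in $\mathrm{Aut}\,A$, and a locally compact group $\Pi$, a twisted $C^*$-dynamical system over $G,\Pi$ is $(A,\alpha,\nu,\gamma)$ with Borel maps $\nu:\Pi\to N_\alpha A$, $\gamma:\Pi\times\Pi\to G$ such that $\nu_1=\mathrm{id}$ and $\nu_l\circ\nu_m=\alpha_{\gamma(l,m)}\circ\nu_{lm}$. The twisted holonomy of a bundle gerbe at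 $a$ is $\bar\jmath^{\,a}_l:=\jmath_{s(l)}$, where $s(l)$ is a chosen loop at $a$ of class $l$ with $s(1)=\iota_a$; $\gamma_*(l,m)$ is a chosen group element acting on $F_a$ as $\bar\jmath^{\,a}_l\circ\bar\jmath^{\,a}_m\circ(\bar\jmath^{\,a}_{lm})^{-1}$. *)

(* Defs.v *)
From HB Require Import structures.
From mathcomp Require Import all_boot all_order all_algebra.
From mathcomp Require Import all_classical all_reals all_analysis.
From mathcomp Require Import complex.

Set Implicit Arguments.
Unset Strict Implicit.
Unset Printing Implicit Defensive.

Import Order.TTheory GRing.Theory Num.Theory numFieldNormedType.Exports.

Local Open Scope quotient_scope.
Local Open Scope classical_set_scope.
Local Open Scope ring_scope.

(* The alias makes the topology and the normed-space structure that
   MathComp-Analysis puts on every numFieldType available on R[i]. *)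
Definition cplx (R : realType) : numClosedFieldType := R[i].

(* Only meant for bijective f; it is then a two-sided inverse. *)
Definition inv_fun (V : nmodType) (T : Type) (f : V -> T) (y : T) : V :=
  xget 0 [set x | f x = y].

Lemma inv_funK (V : nmodType) (T : Type) (f : V -> T) :
  bijective f -> cancel f (inv_fun f).
Proof.
move=> bf x; rewrite /inv_fun; case: xgetP => [y _ /= /(bij_inj bf)//|].
by move=> /(_ x) /=.
Qed.

Lemma inv_funVK (V : nmodType) (T : Type) (f : V -> T) :
  bijective f -> cancel (inv_fun f) f.
Proof. by move=> bf y; case: (bf) => g fK gK; rewrite -[y]gK inv_funK. Qed.

Definition lin_span (K : numDomainType) (V : lmodType K) (X : set V) : set V :=
  [set v | exists n (c : 'I_n -> K) (x : 'I_n -> V),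
     (forall i, X (x i)) /\ v = \sum_i c i *: x i].

Lemma initial_cvgP (S : choiceType) (T : topologicalType) (f : S -> T)
    (F : set_system S) (FF : Filter F) (s : initial_topology f) :
  f @ F --> f s -> F --> s.
Proof.
move=> cF A [B [[V oV <-] Vfs] /filterS]; apply.
by apply: cF; exact: open_nbhs_nbhs.
Qed.

Lemma prod_cvgP (I : Type) (K : I -> topologicalType)
    (F : set_system (prod_topology K)) (FF : Filter F) (f : prod_topology K) :
  (forall i, g i @[g --> F] --> f i) -> F --> f.
Proof.
move=> cF; apply/cvg_sup => i A [B [[V oV <-] Vfs] /filterS]; apply.
by apply: (cF i); exact: open_nbhs_nbhs.
Qed.

Lemma proj_cvg (I : Type) (K : I -> topologicalType)
    (F : set_system (prod_topology K)) (FF : Filter F) (f : prod_topology K) i :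
  F --> f -> g i @[g --> F] --> f i.
Proof.
move=> /cvg_sup /(_ i) cF A; rewrite nbhsE => -[V [oV Vfi] VA].
have : nbhs (f : initial_topology (@proj I K i)) (proj i @^-1` V).
  by apply: open_nbhs_nbhs; split => //; exists V.
by move/cF; apply: filterS => g /VA.
Qed.

HB.mixin Record isTopGroup G of Group G & Topological G := {
  mulg_continuous : continuous (fun x : G * G => (x.1 * x.2)%g);
  invg_continuous : continuous (fun x : G => (x^-1)%g)
}.

#[short(type="topGroupType")]
HB.structure Definition TopGroup :=
  {G of Group G & Topological G & isTopGroup G}.

Record subgroup (G : groupType) := Subgroup {
  sg_set :> set G;
  sg_closed : group_closed [pred x : G | x \in sg_set]
}.

Definition sg_type (G : groupType) (K : subgroup G) :=
  {x : G | [pred x : G | x \in sg_set K] x}.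

Section SubgroupType.
Variables (G : groupType) (K : subgroup G).

HB.instance Definition _ := [isSub of sg_type K for @sval _ _].
HB.instance Definition _ := [Choice of sg_type K by <:].
HB.instance Definition _ :=
  SubChoice_isSubGroup.Build G _ (sg_type K) (sg_closed K).

End SubgroupType.

Section ImageNormalizer.
Local Open Scope group_scope.

Lemma image_group_closed (G H : groupType) (f : {multiplicative G -> H}) :
  group_closed [pred x : H | x \in range f].
Proof.
have f1 : f 1 = 1.
  by apply: (@mulgI _ (f 1)); rewrite -gmulfM !mulg1.
have fV x : f x^-1 = (f x)^-1.
  by apply: (@mulgI _ (f x)); rewrite -gmulfM !mulgV.
split; first by rewrite inE; exists 1.
move=> x y; rewrite !inE => -[g _ <-] [h _ <-].
by exists (g * h^-1) => //; rewrite gmulfM fV.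
Qed.

Definition image_subgroup (G H : groupType) (f : {multiplicative G -> H}) :=
  Subgroup (image_group_closed f).

Definition normalizer_set (G : groupType) (K : set G) : set G :=
  [set u | forall x, K x <-> K (u * x * u^-1)].

Lemma normalizer_group_closed (G : groupType) (K : set G) :
  group_closed [pred x : G | x \in normalizer_set K].
Proof.
split; first by rewrite inE => x; rewrite mul1g invg1 mulg1.
move=> u v; rewrite !inE => Ku Kv x.
have -> : u / v * x * (u / v)^-1 = u * (v^-1 * x * v) * u^-1.
  by rewrite invgF !mulgA.
have := Kv (v^-1 * x * v); have := Ku (v^-1 * x * v).
have -> : v * (v^-1 * x * v) * v^-1 = x by rewrite !mulgA mulgV mul1g mulgK.
by move=> <- ->.
Qed.

Definition normalizer (G : groupType) (K : set G) :=
  Subgroup (normalizer_group_closed K).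

End ImageNormalizer.

Section TwoGroup.
Local Open Scope group_scope.

Record twoGroup := TwoGroup {
  tg_G : groupType;
  tg_N : groupType;
  tg_i : {multiplicative tg_G -> tg_N};
  tg_hat : tg_N -> tg_G -> tg_G;
  tg_hat_morph : forall u, {morph tg_hat u : g h / g * h};
  tg_hat1 : forall g, tg_hat 1 g = g;
  tg_hatM : forall u v g, tg_hat (u * v) g = tg_hat u (tg_hat v g);
  tg_i_hat : forall u g, tg_i (tg_hat u g) = u * tg_i g * u^-1;
  tg_hat_i : forall g h, tg_hat (tg_i g) h = g * h * g^-1
}.

Variables (G : groupType) (K : subgroup G).

Lemma normal_incl_subproof (x : sg_type K) :
  [pred y : G | y \in sg_set (normalizer K)] (\val x).
Proof.
case: x => /= x; rewrite !inE => Kx y; have [K1 Kd] := sg_closed K.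
have KM z t : sg_set K z -> sg_set K t -> sg_set K (z * t^-1).
  by move=> Kz Kt; have := Kd z t; rewrite !inE; exact.
have K1' : sg_set K 1 by rewrite inE in K1.
have KV z : sg_set K z -> sg_set K z^-1 by move=> Kz; rewrite -[z^-1]mul1g; exact: KM.
have Km z t : sg_set K z -> sg_set K t -> sg_set K (z * t).
  by move=> Kz Kt; rewrite -[t]invgK; apply: KM => //; exact: KV.
split=> [Ky|Kxy]; first by apply: KM => //; exact: Km.
have -> : y = x^-1 * (x * y * x^-1) * x by rewrite -!mulgA mulVg mulg1 mulKg.
by apply: (Km) => //; apply: (Km) => //; exact: KV.
Qed.

Definition normal_incl (x : sg_type K) : sg_type (normalizer K) :=
  Sub (\val x) (normal_incl_subproof x).

Lemma normal_inclM : {morph normal_incl : x y / x * y}.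
Proof. by move=> x y; apply: val_inj. Qed.

HB.instance Definition _ := isMultiplicative.Build _ _ normal_incl normal_inclM.

Lemma normal_conj_subproof (u : sg_type (normalizer K)) (x : sg_type K) :
  [pred y : G | y \in sg_set K] (\val u * \val x * (\val u)^-1).
Proof.
case: u => u /=; rewrite inE => Ku; case: x => x /=; rewrite !inE => Kx.
by have [Kux _] := Ku x; exact: Kux.
Qed.

Definition normal_conj (u : sg_type (normalizer K)) (x : sg_type K) :
  sg_type K := Sub (\val u * \val x * (\val u)^-1) (normal_conj_subproof u x).

Definition normalizer_twoGroup : twoGroup.
Proof.
apply: (@TwoGroup (sg_type K) (sg_type (normalizer K)) normal_incl normal_conj).
- by move=> u g h; apply: val_inj; rewrite /= !mulgA mulgVK.
- by move=> g; apply: val_inj; rewrite /= mul1g invg1 mulg1.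
- by move=> u v g; apply: val_inj; rewrite /= invgM !mulgA.
- by move=> u g; apply: val_inj.
- by move=> g h; apply: val_inj.
Defined.

End TwoGroup.

Section CStarAlgebras.
Variable R : realType.
Local Notation C := (cplx R).

(* C*-algebras are not assumed to be unital, nor nonzero. *)
Record cstarAlg := CStarAlg {
  cs_sort :> completeNormedModType C;
  cs_mul : cs_sort -> cs_sort -> cs_sort;
  cs_adj : cs_sort -> cs_sort;
  cs_mulA : associative cs_mul;
  cs_mul_linl : forall y, linear (cs_mul^~ y);
  cs_mul_linr : forall x, linear (cs_mul x);
  cs_adjK : involutive cs_adj;
  cs_adj_antilin : forall (c : C) x y,
    cs_adj (c *: x + y) = (Num.conj c) *: cs_adj x + cs_adj y;
  cs_adjM : forall x y, cs_adj (cs_mul x y) = cs_mul (cs_adj y) (cs_adj x);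
  cs_normM : forall x y, `|cs_mul x y| <= `|x| * `|y|;
  cs_norm_adj : forall x, `|cs_mul (cs_adj x) x| = `|x| ^+ 2
}.

Definition is_unit (A : cstarAlg) (e : A) : Prop :=
  forall x, cs_mul e x = x /\ cs_mul x e = x.

Definition star_hom (A B : cstarAlg) (f : A -> B) : Prop :=
  [/\ linear f, (forall x y, f (cs_mul x y) = cs_mul (f x) (f y))
    & forall x, f (cs_adj x) = cs_adj (f x)].

Definition star_iso (A B : cstarAlg) (f : A -> B) : Prop :=
  star_hom f /\ bijective f.

Inductive star_generated (A : cstarAlg) (X : set A) : A -> Prop :=
| SGen_in x of X x : star_generated X x
| SGen_0 : star_generated X 0
| SGen_lin c x y of star_generated X x & star_generated X y :
    star_generated X (c *: x + y)
| SGen_mul x y of star_generated X x & star_generated X y :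
    star_generated X (cs_mul x y)
| SGen_adj x of star_generated X x : star_generated X (cs_adj x).

Record cstar_aut (A : cstarAlg) := CStarAut {
  aut_fun :> A -> A;
  aut_iso : star_iso aut_fun
}.

Section AutGroup.
Variable A : cstarAlg.

Lemma aut_eq (f g : cstar_aut A) : f =1 g -> f = g.
Proof.
case: f g => [f fi] [g gi] /= /funext fg; subst g; congr CStarAut.
exact: Prop_irrelevance.
Qed.

Lemma aut1_subproof : star_iso (@idfun A).
Proof. by split; [split|exists idfun]. Qed.

Lemma autM_subproof (f g : cstar_aut A) : star_iso (f \o g).
Proof.
have [[fl fm fa] fb] := aut_iso f; have [[gl gm ga] gb] := aut_iso g.
split; last exact: bij_comp.
split=> [c x y|x y|x] /=; first by rewrite gl fl.
  by rewrite gm fm.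
by rewrite ga fa.
Qed.

Lemma autV_subproof (f : cstar_aut A) : star_iso (inv_fun f).
Proof.
have [[fl fm fa] fb] := aut_iso f.
have K := inv_funK fb; have VK := inv_funVK fb.
split; last by exists f.
split=> [c x y|x y|x]; apply: (bij_inj fb); rewrite ?fl ?fm ?fa !VK //.
Qed.

HB.instance Definition _ := gen_eqMixin (cstar_aut A).
HB.instance Definition _ := gen_choiceMixin (cstar_aut A).

Let mul (f g : cstar_aut A) := CStarAut (autM_subproof f g).
Let one := CStarAut aut1_subproof.
Let inv (f : cstar_aut A) := CStarAut (autV_subproof f).

Let mulA : associative mul. Proof. by move=> f g h; exact: aut_eq. Qed.
Let mul1 : left_id one mul. Proof. by move=> f; exact: aut_eq. Qed.
Let mul1r : right_id one mul. Proof. by move=> f; exact: aut_eq. Qed.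
Let mulV : left_inverse one inv mul.
Proof. by move=> f; apply: aut_eq => x /=; rewrite inv_funK //; case: (aut_iso f). Qed.
Let mulVr : right_inverse one inv mul.
Proof. by move=> f; apply: aut_eq => x /=; rewrite inv_funVK //; case: (aut_iso f). Qed.

HB.instance Definition _ :=
  isGroup.Build (cstar_aut A) mulA mul1 mul1r mulV mulVr.

(* Topology of pointwise norm convergence. *)
HB.instance Definition _ := Topological.copy (cstar_aut A)
  (initial_topology (@aut_fun A : cstar_aut A -> {ptws A -> A})).

End AutGroup.

Definition fixed_points (G : Type) (A : cstarAlg) (alpha : G -> cstar_aut A) :
  set A := [set x | forall g, alpha g x = x].

(* f identifies A with the sub-C*-algebra X of B. *)
Definition star_iso_onto (A B : cstarAlg) (f : A -> B) (X : set B) : Prop :=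
  [/\ star_hom f, injective f & range f = X].

Definition cuntz_family d (A : cstarAlg) (psi : 'I_d -> A) : Prop :=
  exists e : A, [/\ is_unit e,
    forall h k, cs_mul (cs_adj (psi h)) (psi k) = (if h == k then e else 0)
    & \sum_k cs_mul (psi k) (cs_adj (psi k)) = e].

(* A, with generators psi, is the universal C*-algebra O_d. *)
Definition is_cuntz d (A : cstarAlg) (psi : 'I_d -> A) : Prop :=
  [/\ cuntz_family psi,
      closure (star_generated (range psi)) = setT
    & forall (B : cstarAlg) (chi : 'I_d -> B), cuntz_family chi ->
        exists f : A -> B, star_hom f /\ forall k, f (psi k) = chi k].

End CStarAlgebras.

Declare Scope cat_scope.
Delimit Scope cat_scope with cat.

Section Categories.
Variable R : realType.
Local Notation C := (cplx R).

(* arr x y is the Banach space (x, y) of arrows from x to y; the last field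
   says that t^* t is a positive element of the C*-algebra (x, x). *)
Record cstarCat := CStarCat {
  obj :> Type;
  arr : obj -> obj -> completeNormedModType C;
  idc : forall x, arr x x;
  ccomp : forall x y z, arr y z -> arr x y -> arr x z;
  cadj : forall x y, arr x y -> arr y x;
  comp_linl : forall x y z (s : arr x y),
    linear (fun t : arr y z => ccomp t s);
  comp_linr : forall x y z (t : arr y z),
    linear (fun s : arr x y => ccomp t s);
  compA : forall w x y z (r : arr y z) (s : arr x y) (t : arr w x),
    ccomp r (ccomp s t) = ccomp (ccomp r s) t;
  comp1c : forall x y (t : arr x y), ccomp (idc y) t = t;
  compc1 : forall x y (t : arr x y), ccomp t (idc x) = t;
  adjK : forall x y (t : arr x y), cadj (cadj t) = t;
  adj_antilin : forall x y (c : C) (s t : arr x y),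
    cadj (c *: s + t) = (Num.conj c) *: cadj s + cadj t;
  adj_comp : forall x y z (s : arr y z) (t : arr x y),
    cadj (ccomp s t) = ccomp (cadj t) (cadj s);
  norm_comp : forall x y z (s : arr y z) (t : arr x y),
    `|ccomp s t| <= `|s| * `|t|;
  norm_adj : forall x y (t : arr x y), `|ccomp (cadj t) t| = `|t| ^+ 2;
  adj_pos : forall x y (t : arr x y),
    exists s : arr x x, ccomp (cadj t) t = ccomp (cadj s) s
}.

Arguments arr {_} x y.
Arguments idc {_} x.
Arguments ccomp {_ x y z} _ _.
Arguments cadj {_ x y} _.
Local Notation "g ∘ f" := (ccomp g f) (at level 40, left associativity).

(* The identity arrow between equal objects, needed to type the strict
   associativity and unit laws. *)
Definition coe (T : cstarCat) (x y : T) (e : x = y) : arr x y :=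
  match e in _ = z return arr x z with erefl => idc x end.

Record tensorCat := TensorCat {
  tc_cat :> cstarCat;
  unitO : tc_cat;
  tensO : tc_cat -> tc_cat -> tc_cat;
  tensH : forall x y x' y' : tc_cat,
    arr x y -> arr x' y' -> arr (tensO x x') (tensO y y');
  tens_linl : forall (x y x' y' : tc_cat) (s : arr x' y'),
    linear (fun t : arr x y => tensH t s);
  tens_linr : forall (x y x' y' : tc_cat) (t : arr x y),
    linear (fun s : arr x' y' => tensH t s);
  tens_id : forall x y, tensH (idc x) (idc y) = idc (tensO x y);
  tens_comp : forall (x y z x' y' z' : tc_cat)
      (s : arr y z) (t : arr x y) (s' : arr y' z') (t' : arr x' y'),
    tensH (s ∘ t) (s' ∘ t') = tensH s s' ∘ tensH t t';
  tens_adj : forall (x y x' y' : tc_cat) (t : arr x y) (s : arr x' y'),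
    cadj (tensH t s) = tensH (cadj t) (cadj s);
  tensOA : forall x y z, tensO x (tensO y z) = tensO (tensO x y) z;
  tensO1l : forall x, tensO unitO x = x;
  tensO1r : forall x, tensO x unitO = x;
  tensHA : forall (x y z x' y' z' : tc_cat)
      (r : arr x x') (s : arr y y') (t : arr z z'),
    coe (tensOA x' y' z') ∘ tensH r (tensH s t) =
    tensH (tensH r s) t ∘ coe (tensOA x y z);
  tensH1l : forall (x y : tc_cat) (t : arr x y),
    coe (tensO1l y) ∘ tensH (idc unitO) t = t ∘ coe (tensO1l x);
  tensH1r : forall (x y : tc_cat) (t : arr x y),
    coe (tensO1r y) ∘ tensH t (idc unitO) = t ∘ coe (tensO1r x)
}.

Arguments unitO {_}.
Arguments tensO {_} x y.
Arguments tensH {_ x y x' y'} _ _.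
Arguments tensOA {_} x y z.
Arguments tensO1l {_} x.
Arguments tensO1r {_} x.
Local Notation "x ⊠ y" := (tensO x y) (at level 38, left associativity).
Local Notation "s ⊗ t" := (tensH s t) (at level 38, left associativity).

Record symTensorCat := SymTensorCat {
  stc_cat :> tensorCat;
  sym : forall x y : stc_cat, arr (x ⊠ y) (y ⊠ x);
  sym_adj : forall x y, cadj (sym x y) = sym y x;
  symK : forall x y, sym y x ∘ sym x y = idc (x ⊠ y);
  sym_nat : forall (x y x' y' : stc_cat) (s : arr x x') (t : arr y y'),
    sym x' y' ∘ (s ⊗ t) = (t ⊗ s) ∘ sym x y;
  sym_hexagon : forall x y z,
    sym (x ⊠ y) z =
    coe (esym (tensOA z x y)) ∘ (sym x z ⊗ idc y) ∘ coe (tensOA x z y)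
      ∘ (idc x ⊗ sym y z) ∘ coe (esym (tensOA x y z))
}.

Arguments sym {_} x y.

(* y is conjugate to x: the conjugate equations hold for r : i -> y x and
   for sym y x o r : i -> x y, as in Doplicher and Roberts. *)
Definition is_conjugate (T : symTensorCat) (x y : T) : Prop :=
  exists r : arr unitO (y ⊠ x), let r' := sym y x ∘ r in
    (cadj r' ⊗ idc x) ∘ coe (tensOA x y x) ∘ (idc x ⊗ r)
      = coe (etrans (tensO1r x) (esym (tensO1l x)))
    /\ (cadj r ⊗ idc y) ∘ coe (tensOA y x y) ∘ (idc y ⊗ r')
      = coe (etrans (tensO1r y) (esym (tensO1l y))).

Record drCat := DRCat {
  dr_cat :> symTensorCat;
  dr_conj : forall x : dr_cat, exists y, is_conjugate x y;
  dr_unit_neq0 : idc (unitO : dr_cat) != 0;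
  dr_unit_scalar : forall t : arr (unitO : dr_cat) unitO,
    exists c : C, t = c *: idc unitO
}.

(* Functors are strict and, the categories being symmetric, preserve sym. *)
Record tensorFunctor (S T : drCat) := TensorFunctor {
  fobj :> S -> T;
  fhom : forall x y : S, arr x y -> arr (fobj x) (fobj y);
  fhom_lin : forall x y, linear (@fhom x y);
  fhom_id : forall x, fhom (idc x) = idc (fobj x);
  fhom_comp : forall (x y z : S) (s : arr y z) (t : arr x y),
    fhom (s ∘ t) = fhom s ∘ fhom t;
  fhom_adj : forall (x y : S) (t : arr x y), fhom (cadj t) = cadj (fhom t);
  fobj_unit : fobj unitO = unitO;
  fobj_tens : forall x y, fobj (x ⊠ y) = fobj x ⊠ fobj y;
  fhom_tens : forall (x y x' y' : S) (s : arr x y) (t : arr x' y'),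
    coe (fobj_tens y y') ∘ fhom (s ⊗ t) =
    (fhom s ⊗ fhom t) ∘ coe (fobj_tens x x');
  fhom_sym : forall x y : S,
    coe (fobj_tens y x) ∘ fhom (sym x y) =
    sym (fobj x) (fobj y) ∘ coe (fobj_tens x y)
}.

Definition tensor_iso (S T : drCat) (F : tensorFunctor S T) : Prop :=
  bijective F /\ forall x y, bijective (@fhom _ _ F x y).

Fixpoint tpow (T : tensorCat) (x : T) (n : nat) : T :=
  if n is m.+1 then tpow x m ⊠ x else unitO.

Lemma fobj_tpow (S T : drCat) (F : tensorFunctor S T) (x : S) (y : T) n :
  F x = y -> F (tpow x n) = tpow y n.
Proof.
by move=> <-; elim: n => [|n IHn] /=; rewrite ?fobj_unit // fobj_tens IHn.
Qed.

(* The action of F on (x^l, x^m), read in (y^l, y^m) when F x = y. *)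
Definition fhom_tpow (S T : drCat) (F : tensorFunctor S T) (x : S) (y : T)
    (e : F x = y) l m (t : arr (tpow x l) (tpow x m)) :
    arr (tpow y l) (tpow y m) :=
  coe (fobj_tpow m e) ∘ fhom F t ∘ coe (esym (fobj_tpow l e)).

Record hilbert := Hilbert {
  hs_sort :> completeNormedModType C;
  ip : hs_sort -> hs_sort -> C;
  ip_linr : forall x (c : C) y z, ip x (c *: y + z) = c * ip x y + ip x z;
  ip_conj : forall x y, ip y x = Num.conj (ip x y);
  ip_norm : forall x, ip x x = `|x| ^+ 2
}.

Arguments ip {_} x y.

Definition orthonormal_basis d (H : hilbert) (e : 'I_d -> H) : Prop :=
  (forall h k, ip (e h) (e k) = (h == k)%:R) /\ lin_span (range e) = setT.

(* A faithful symmetric tensor *-functor into Hilbert spaces. The bilinear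
   maps emb_tens, isometric with dense span, exhibit H (x y) as the Hilbert
   tensor product of H x and H y. *)
Record embedding (S : drCat) := Embedding {
  emb_obj :> S -> hilbert;
  emb_hom : forall x y : S, arr x y -> emb_obj x -> emb_obj y;
  emb_hom_linear : forall (x y : S) (t : arr x y), linear (emb_hom t);
  emb_hom_continuous : forall (x y : S) (t : arr x y), continuous (emb_hom t);
  emb_homP : forall (x y : S) (c : C) (s t : arr x y) v,
    emb_hom (c *: s + t) v = c *: emb_hom s v + emb_hom t v;
  emb_hom_id : forall (x : S) v, emb_hom (idc x) v = v;
  emb_hom_comp : forall (x y z : S) (s : arr y z) (t : arr x y) v,
    emb_hom (s ∘ t) v = emb_hom s (emb_hom t v);
  emb_hom_adj : forall (x y : S) (t : arr x y) v w,
    ip (emb_hom t v) w = ip v (emb_hom (cadj t) w);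
  emb_hom_faithful : forall (x y : S) (s t : arr x y),
    emb_hom s =1 emb_hom t -> s = t;
  emb_tens : forall x y : S, emb_obj x -> emb_obj y -> emb_obj (x ⊠ y);
  emb_tens_linl : forall (x y : S) w,
    linear (fun v => @emb_tens x y v w);
  emb_tens_linr : forall (x y : S) v,
    linear (fun w => @emb_tens x y v w);
  emb_tens_ip : forall (x y : S) (v v' : emb_obj x) (w w' : emb_obj y),
    ip (emb_tens v w) (emb_tens v' w') = ip v v' * ip w w';
  emb_tens_dense : forall x y : S,
    closure (lin_span [set u | exists v w, u = @emb_tens x y v w]) = setT;
  emb_unit : emb_obj unitO;
  emb_unit_norm : `|emb_unit| = 1;
  emb_unit_span : forall v : emb_obj unitO, exists c : C, v = c *: emb_unit;
  emb_tensH : forall (x y x' y' : S) (s : arr x y) (t : arr x' y') v w,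
    emb_hom (s ⊗ t) (emb_tens v w) = emb_tens (emb_hom s v) (emb_hom t w);
  emb_tensA : forall (x y z : S) (u : emb_obj x) (v : emb_obj y)
      (w : emb_obj z),
    emb_hom (coe (tensOA x y z)) (emb_tens u (emb_tens v w)) =
    emb_tens (emb_tens u v) w;
  emb_tens1l : forall (x : S) (v : emb_obj x),
    emb_hom (coe (tensO1l x)) (emb_tens emb_unit v) = v;
  emb_tens1r : forall (x : S) (v : emb_obj x),
    emb_hom (coe (tensO1r x)) (emb_tens v emb_unit) = v;
  emb_sym : forall (x y : S) (v : emb_obj x) (w : emb_obj y),
    emb_hom (sym x y) (emb_tens v w) = emb_tens w v
}.

Arguments emb_hom {_} _ {x y} t _.
Arguments emb_tens {_ _ x y} _ _.
Arguments emb_unit {_ _}.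

(* The group U_tens(H) of unitary tensor natural transformations of H. *)
Record tensorUnitary (S : drCat) (H : embedding S) := TensorUnitary {
  tu_fun :> forall x : S, H x -> H x;
  tu_linear : forall x, linear (@tu_fun x);
  tu_ip : forall x (v w : H x), ip (tu_fun v) (tu_fun w) = ip v w;
  tu_surj : forall x (w : H x), exists v, tu_fun v = w;
  tu_natural : forall (x y : S) (t : arr x y) v,
    tu_fun (emb_hom H t v) = emb_hom H t (tu_fun v);
  tu_tens : forall (x y : S) (v : H x) (w : H y),
    tu_fun (emb_tens v w) = emb_tens (tu_fun v) (tu_fun w)
}.

Section TensorUnitaryGroup.
Variables (S : drCat) (H : embedding S).
Local Notation U := (tensorUnitary H).

Lemma tu_eq (g h : U) : (forall x (v : H x), g x v = h x v) -> g = h.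
Proof.
case: g h => [g g1 g2 g3 g4 g5] [h h1 h2 h3 h4 h5] /= gh.
have E : g = h by apply: functional_extensionality_dep => x; apply/funext/gh.
by subst h; congr TensorUnitary; exact: Prop_irrelevance.
Qed.

Lemma tu_norm (g : U) x (v : H x) : `|g x v| = `|v|.
Proof.
by apply/eqP; rewrite -(@eqrXn2 _ 2) // -!ip_norm tu_ip.
Qed.

Lemma tu_bij (g : U) x : bijective (g x).
Proof.
have [f fK] := choice (@tu_surj _ _ g x).
exists f => // v; apply/eqP; rewrite -subr_eq0 -normr_eq0 -(tu_norm g).
rewrite (_ : g x (f (g x v) - v) = 0) ?normr0 //.
have gB : g x (f (g x v) - v) = g x (f (g x v)) - g x v.
  by rewrite addrC -scaleN1r tu_linear scaleN1r addrC.
by rewrite gB fK subrr.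
Qed.

Let one : U.
Proof. by apply: (@TensorUnitary _ _ (fun x v => v)) => // x w; exists w. Defined.

Let mul (g h : U) : U.
Proof.
apply: (@TensorUnitary _ _ (fun x v => g x (h x v))).
- by move=> x c v w; rewrite !tu_linear.
- by move=> x v w; rewrite !tu_ip.
- move=> x w; have [v <-] := tu_surj g w; have [u <-] := tu_surj h v.
  by exists u.
- by move=> x y t v; rewrite !tu_natural.
- by move=> x y v w; rewrite !tu_tens.
Defined.

Let inv (g : U) : U.
Proof.
apply: (@TensorUnitary _ _ (fun x => inv_fun (g x))).
- move=> x c v w; apply: (bij_inj (tu_bij g x)).
  by rewrite tu_linear !(inv_funVK (tu_bij g x)).
- by move=> x v w; rewrite -(tu_ip g) !(inv_funVK (tu_bij g x)).
- by move=> x w; exists (g x w); rewrite (inv_funK (tu_bij g x)).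
- move=> x y t v; apply: (bij_inj (tu_bij g y)).
  by rewrite tu_natural (inv_funVK (tu_bij g x)) (inv_funVK (tu_bij g y)).
- move=> x y v w; apply: (bij_inj (tu_bij g _)).
  by rewrite tu_tens !(inv_funVK (tu_bij g _)).
Defined.

HB.instance Definition _ := gen_eqMixin U.
HB.instance Definition _ := gen_choiceMixin U.

Let mulA : associative mul. Proof. by move=> f g h; exact: tu_eq. Qed.
Let mul1 : left_id one mul. Proof. by move=> f; exact: tu_eq. Qed.
Let mul1r : right_id one mul. Proof. by move=> f; exact: tu_eq. Qed.
Let mulV : left_inverse one inv mul.
Proof. by move=> f; apply: tu_eq => x v; exact: (inv_funK (tu_bij f x)). Qed.
Let mulVr : right_inverse one inv mul.
Proof. by move=> f; apply: tu_eq => x v; exact: (inv_funVK (tu_bij f x)). Qed.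

HB.instance Definition _ := isGroup.Build U mulA mul1 mul1r mulV mulVr.

Definition tu_eval (g : U) : prod_topology (fun p : {x : S & H x} =>
  H (projT1 p)) := fun p => g (projT1 p) (projT2 p).

(* Topology of pointwise norm convergence. *)
HB.instance Definition _ := Topological.copy U (initial_topology tu_eval).

Lemma tu_cvgP (F : set_system U) (FF : Filter F) (g : U) :
  F --> g <-> forall x (v : H x), f x v @[f --> F] --> g x v.
Proof.
split=> [cF x v|cF].
  have cE : tu_eval @ F --> tu_eval g.
    move=> A nA; exact: (cF _ (@initial_continuous U _ tu_eval g A nA)).
  exact: (@proj_cvg _ (fun p : {x : S & H x} => H (projT1 p)) (tu_eval @ F)
    _ _ (existT _ x v) cE).
apply: initial_cvgP; apply: prod_cvgP => -[x v]; exact: cF.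
Qed.

Lemma tuM_continuous : continuous (fun x : U * U => (x.1 * x.2)%g).
Proof.
move=> [g h]; apply/tu_cvgP => x v /=.
have cg : (fst @ (nbhs (g, h))) --> g by exact: cvg_fst.
have ch : (snd @ (nbhs (g, h))) --> h by exact: cvg_snd.
move/tu_cvgP : cg => /(_ x (h x v)) cg; move/tu_cvgP : ch => /(_ x v) ch.
apply/cvgrPdist_lt => /= e e0.
have e2 : 0 < e / 2 by rewrite divr_gt0.
move/cvgrPdist_lt : cg => /(_ _ e2) cg; move/cvgrPdist_lt : ch => /(_ _ e2) ch.
have cg' : nbhs (g, h) [set p : U * U |
  `|g x (h x v) - p.1 x (h x v)| < e / 2] by exact: cg.
have ch' : nbhs (g, h) [set p : U * U | `|h x v - p.2 x v| < e / 2].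
  by exact: ch.
apply: filterS2 cg' ch' => -[g' h'] /= h1 h2.
have -> : g x (h x v) - g' x (h' x v) =
   (g x (h x v) - g' x (h x v)) + g' x (h x v - h' x v).
  have -> : g' x (h x v - h' x v) = g' x (h x v) - g' x (h' x v).
    by rewrite addrC -scaleN1r tu_linear scaleN1r addrC.
  by rewrite addrA subrK.
rewrite (splitr e); apply: le_lt_trans (ler_normD _ _) _.
by rewrite ltrD // tu_norm.
Qed.

Lemma tuV_continuous : continuous (fun x : U => (x^-1)%g).
Proof.
move=> g.
have FF : Filter ((fun x : U => (x^-1)%g) @ nbhs g).
  by apply: fmap_filter; exact: nbhs_filter.
apply/(tu_cvgP FF) => x v /=; apply/cvgrPdist_lt => /= e e0.
have FG : Filter (nbhs g) by exact: nbhs_filter.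
have /(tu_cvgP FG)/(_ x ((g^-1)%g x v)) : nbhs g --> g by [].
move/cvgrPdist_lt => /(_ _ e0) cg.
have cg' : nbhs g [set f : U |
  `|g x ((g^-1)%g x v) - f x ((g^-1)%g x v)| < e] by exact: cg.
apply: filterS cg' => f /=.
have gV : g x ((g^-1)%g x v) = v.
  by have -> : g x ((g^-1)%g x v) = (g * g^-1)%g x v by []; rewrite mulgV.
rewrite gV -[in X in X -> _]normrN opprB -(tu_norm f (_ - (f^-1)%g x v)).
have -> : f x ((g^-1)%g x v - (f^-1)%g x v) = f x ((g^-1)%g x v) - v.
  rewrite addrC -scaleN1r tu_linear scaleN1r addrC; congr (_ - _).
  by have -> : f x ((f^-1)%g x v) = (f * f^-1)%g x v by []; rewrite mulgV.
by [].
Qed.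
HB.instance Definition _ := isTopGroup.Build U tuM_continuous tuV_continuous.

End TensorUnitaryGroup.

Record drPresheaf d (D : porderType d) := DRPresheaf {
  dp_fib :> D -> drCat;
  dp_res : forall o w : D, (o <= w)%O -> tensorFunctor (dp_fib w) (dp_fib o);
  dp_iso : forall o w (h : (o <= w)%O), tensor_iso (dp_res h);
  dp_res_obj : forall o w x (h1 : (o <= w)%O) (h2 : (w <= x)%O)
      (h3 : (o <= x)%O) r,
    dp_res h1 (dp_res h2 r) = dp_res h3 r;
  dp_res_hom : forall o w x (h1 : (o <= w)%O) (h2 : (w <= x)%O)
      (h3 : (o <= x)%O) r s (t : arr r s),
    coe (dp_res_obj h1 h2 h3 s) ∘ fhom (dp_res h1) (fhom (dp_res h2) t) =
    fhom (dp_res h3) t ∘ coe (dp_res_obj h1 h2 h3 r)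
}.

Record drSection d (D : porderType d) (S : drPresheaf D) := DRSection {
  ds_obj :> forall o : D, S o;
  ds_res : forall o w (h : (o <= w)%O), dp_res S h (ds_obj w) = ds_obj o
}.

Fixpoint tens_stab (T : tensorCat) (x : T) l m (t : arr (tpow x l) (tpow x m))
    (r : nat) : arr (tpow x (r + l)) (tpow x (r + m)) :=
  match r with
  | 0 => t
  | r'.+1 => tens_stab t r' ⊗ idc x
  end.

(* A is the algebra O_x and theta l m : (x^l, x^m) -> A the canonical map.
   The first fields say that the closure of the union of the ranges of
   theta l (l + k), l in nat, is the Banach inductive limit O_x^k, with the
   product and the adjoint coming from the category; the last two that A is
   the completion of the direct sum of the O_x^k in a C*-norm for which the
   grading is given by a continuous action of the circle. *)
Record is_dr_algebra (T : drCat) (x : T) (A : cstarAlg R)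
    (theta : forall l m, arr (tpow x l) (tpow x m) -> A) : Prop := {
  dra_linear : forall l m, linear (@theta l m);
  dra_stab : forall l m (t : arr (tpow x l) (tpow x m)),
    theta l.+1 m.+1 (t ⊗ idc x) = theta l m t;
  dra_norm : forall l m (t : arr (tpow x l) (tpow x m)),
    `|tens_stab t r| @[r --> \oo] --> (`|theta l m t| : C);
  dra_comp : forall l m n (s : arr (tpow x m) (tpow x n))
      (t : arr (tpow x l) (tpow x m)),
    theta l n (s ∘ t) = cs_mul (theta m n s) (theta l m t);
  dra_adj : forall l m (t : arr (tpow x l) (tpow x m)),
    theta m l (cadj t) = cs_adj (theta l m t);
  dra_dense :
    closure (lin_span [set a | exists l m t, a = theta l m t]) = setT;
  dra_gauge : exists beta : C -> A -> A,
    [/\ forall z, `|z| = 1 -> star_iso (beta z),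
        forall z w a, `|z| = 1 -> `|w| = 1 ->
          beta (z * w) a = beta z (beta w a),
        forall a, {within [set z | `|z| = 1], continuous (beta ^~ a)}
      & forall z l m (t : arr (tpow x l) (tpow x m)), `|z| = 1 ->
          beta z (theta l m t) = z ^ (m%:Z - l%:Z) *: theta l m t]
}.

End Categories.

(* alpha is the composition of g |-> g^x in U(H x) with the action of U(d) on
   O_d, where U(H x) is identified with U(d) by writing
   g (e h) = \sum_k g_hk e k: with this ordering of the indices
   psi h |-> \sum_k g_hk psi k is a homomorphism in g. *)
Definition is_cuntz_action (R : realType) (S : drCat R) (H : embedding S)
    (x : S) d (e : 'I_d -> H x) (A : cstarAlg R) (psi : 'I_d -> A)
    (alpha : tensorUnitary H -> cstar_aut A) : Prop :=
  forall g h, alpha g (psi h) = \sum_k ip (e k) (g x (e h)) *: psi k.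

Section Posets.
Variables (disp : Order.disp_t) (D : porderType disp).

(* An n-simplex is coded as the tuple of its faces together with its
   support; Sigma_n is the set of the codes satisfying is_simplex. *)
Fixpoint presimplex (n : nat) : Type :=
  if n is m.+1 then (m.+2.-tuple (presimplex m) * D)%type else D.

Definition face n (k : nat) (d : presimplex n.+1) : presimplex n :=
  nth (thead d.1) d.1 k.

Definition supp n : presimplex n -> D :=
  match n with 0 => id | m.+1 => fun d => d.2 end.

Definition face_identities n : presimplex n -> Prop :=
  match n with
  | m.+2 => fun d => forall h k, (k <= h <= m.+1)%N ->
      face h (face k d) = face k (face h.+1 d)
  | _ => fun _ => True
  end.

Fixpoint is_simplex n : presimplex n -> Prop :=
  match n with
  | 0 => fun _ => True
  | m.+1 => fun d =>
      (forall k, (k <= m.+1)%N ->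
         is_simplex (face k d) /\ (supp (face k d) <= supp d)%O)
      /\ face_identities (n := m.+1) d
  end.

Definition simplex1 (b0 b1 z : D) : presimplex 1 := ([tuple b0; b1], z).
Definition simplex2 (c0 c1 c2 : presimplex 1) (z : D) : presimplex 2 :=
  ([tuple c0; c1; c2], z).

Lemma is_simplex1 b0 b1 z :
  (b0 <= z)%O -> (b1 <= z)%O -> is_simplex (simplex1 b0 b1 z).
Proof. by move=> h0 h1; split=> // -[|[|k]]. Qed.

Lemma simplex1_le (b : presimplex 1) k : (k <= 1)%N -> is_simplex b ->
  (face k b <= supp b)%O.
Proof. by move=> k1 [/(_ k k1) []]. Qed.

(* The 1-simplex of N_1 attached to o <= w and the 2-simplex of N_2 attached
   to o <= w <= x. *)
Definition nerve1 (o w : D) : presimplex 1 := simplex1 w o w.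
Definition nerve2 (o w x : D) : presimplex 2 :=
  simplex2 (nerve1 w x) (nerve1 o x) (nerve1 o w) x.
Definition iota1 (a : D) : presimplex 1 := simplex1 a a a.

(* pcons p b is the path b * p. *)
Inductive ppath : D -> D -> Type :=
| pone (b : presimplex 1) of is_simplex b : ppath (face 1 b) (face 0 b)
| pcons (a : D) (b : presimplex 1) of is_simplex b & ppath a (face 1 b) :
    ppath a (face 0 b).

Definition poset_connected : Prop := forall x y, inhabited (ppath x y).

(* The 1-simplices b_1, ..., b_n of the path b_n * ... * b_1. *)
Fixpoint trace x y (p : ppath x y) : seq (presimplex 1) :=
  match p with
  | pone b _ => [:: b]
  | pcons _ b _ q => rcons (trace q) b
  end.

Inductive homotopic : seq (presimplex 1) -> seq (presimplex 1) -> Prop :=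
| htp_step s t c of is_simplex c :
    homotopic (s ++ face 1 c :: t) (s ++ face 2 c :: face 0 c :: t)
| htp_refl s : homotopic s s
| htp_sym s t of homotopic s t : homotopic t s
| htp_trans s t u of homotopic s t & homotopic t u : homotopic s u.

(* pcat p q is the path q * p. *)
Fixpoint pcat x y z (p : ppath x y) (q : ppath y z) : ppath x z :=
  match q in ppath y' z' return ppath x y' -> ppath x z' with
  | pone b h => fun p => pcons h p
  | pcons _ b h q' => fun p => pcons h (pcat p q')
  end p.

Definition prefl (a : D) : ppath a a :=
  pone (is_simplex1 (lexx a) (lexx a)).

Definition brev (b : presimplex 1) : presimplex 1 :=
  simplex1 (face 1 b) (face 0 b) (supp b).

Lemma brevP b : is_simplex b -> is_simplex (brev b).
Proof. by move=> h; apply: is_simplex1; exact: simplex1_le. Qed.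

Lemma brevK : involutive brev.
Proof.
by move=> [t z]; congr pair; apply: val_inj; case: t => -[|b0 [|b1 [|]]].
Qed.

Fixpoint path_inv x y (p : ppath x y) : ppath y x :=
  match p in ppath x' y' return ppath y' x' with
  | pone b h => pone (brevP h)
  | pcons _ b h q => pcat (pone (brevP h)) (path_inv q)
  end.

Lemma trace_cat x y z (p : ppath x y) (q : ppath y z) :
  trace (pcat p q) = trace p ++ trace q.
Proof.
elim: q x p => [b h|a b h q IH] x p /=; first by rewrite cats1.
by rewrite IH rcons_cat.
Qed.

Lemma trace_rev x y (p : ppath x y) : trace (path_inv p) = rev (map brev (trace p)).
Proof.
elim: p => [//|a b h q IH] /=.
by rewrite trace_cat /= IH map_rcons rev_rcons.
Qed.

Lemma htp_cat s s' t t' :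
  homotopic s s' -> homotopic t t' -> homotopic (s ++ t) (s' ++ t').
Proof.
move=> hs ht; apply: (@htp_trans _ (s' ++ t)).
  elim: hs => {s s'} [s u c h|s|s u _|s u v _ h1 _ h2].
  - by rewrite -!catA; exact: htp_step.
  - exact: htp_refl.
  - exact: htp_sym.
  - exact: htp_trans h1 h2.
elim: ht => {t t'} [t u c h|t|t u _|t u v _ h1 _ h2].
- by rewrite !catA; exact: htp_step.
- exact: htp_refl.
- exact: htp_sym.
- exact: htp_trans h1 h2.
Qed.

Lemma is_simplex2 (c0 c1 c2 : presimplex 1) z :
  is_simplex c0 -> is_simplex c1 -> is_simplex c2 ->
  (supp c0 <= z)%O -> (supp c1 <= z)%O -> (supp c2 <= z)%O ->
  face 0 c0 = face 0 c1 -> face 1 c0 = face 0 c2 -> face 1 c1 = face 1 c2 ->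
  is_simplex (simplex2 c0 c1 c2 z).
Proof.
move=> h0 h1 h2 l0 l1 l2 e0 e1 e2; split; first by case=> [|[|[|k]]].
by case=> [|[|h]] [|[|k]] //=; rewrite andbF.
Qed.

Lemma htp_unitl x y (p : ppath x y) : homotopic (iota1 x :: trace p) (trace p).
Proof.
have key (b : presimplex 1) : is_simplex b -> homotopic [:: iota1 (face 1 b); b] [:: b].
  move=> hb; have := @htp_step [::] [::] (simplex2 b b (iota1 (face 1 b)) (supp b)).
  move=> H; apply/htp_sym/H; apply: is_simplex2 => //.
  - by apply: is_simplex1.
  - exact: simplex1_le.
elim: p => [b h|a b h q IH] /=; first exact: key.
rewrite -cats1 -cat_cons; apply: htp_cat IH _; exact: htp_refl.
Qed.

Lemma htp_unitr x y (p : ppath x y) :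
  homotopic (rcons (trace p) (iota1 y)) (trace p).
Proof.
have key (b : presimplex 1) : is_simplex b -> homotopic [:: b; iota1 (face 0 b)] [:: b].
  move=> hb; have := @htp_step [::] [::] (simplex2 (iota1 (face 0 b)) b b (supp b)).
  move=> H; apply/htp_sym/H; apply: is_simplex2 => //.
  - by apply: is_simplex1.
  - exact: simplex1_le.
case: p => [b h|a b h q] /=; first exact: key.
rewrite -!cats1 -catA; apply: htp_cat (htp_refl _) _; exact: key.
Qed.

Lemma htp_rev s t : homotopic s t ->
  homotopic (rev (map brev s)) (rev (map brev t)).
Proof.
elim=> {s t} [s u c h|s|s u _|s u v _ h1 _ h2]; last first.
- exact: htp_trans h1 h2.
- exact: htp_sym.
- exact: htp_refl.
have -> : rev (map brev (s ++ face 1 c :: u)) =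
    rev (map brev u) ++ brev (face 1 c) :: rev (map brev s).
  by rewrite map_cat rev_cat /= rev_cons cat_rcons.
have -> : rev (map brev (s ++ face 2 c :: face 0 c :: u)) = rev (map brev u) ++
    brev (face 0 c) :: brev (face 2 c) :: rev (map brev s).
  by rewrite map_cat rev_cat /= !rev_cons !cat_rcons.
pose c' := simplex2 (brev (face 2 c)) (brev (face 1 c)) (brev (face 0 c)) (supp c).
apply: (@htp_step _ _ c').
have [hf hi] := h.
have [s0 l0] := hf 0%N isT; have [s1 l1] := hf 1%N isT.
have [s2 l2] := hf 2%N isT.
apply: is_simplex2 => //; try exact: brevP.
- by have := hi 1%N 1%N isT.
- by have := hi 1%N 0%N isT.
- by have := hi 0%N 0%N isT.
Qed.

Lemma htp_revl x y (p : ppath x y) :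
  homotopic (trace p ++ rev (map brev (trace p))) [:: iota1 x].
Proof.
have key (b : presimplex 1) : is_simplex b ->
    homotopic [:: b; brev b] [:: iota1 (face 1 b)].
  move=> hb; have := @htp_step [::] [::]
    (simplex2 (brev b) (iota1 (face 1 b)) b (supp b)).
  move=> H; apply/htp_sym/H; apply: is_simplex2 => //.
  - exact: brevP.
  - exact: is_simplex1.
  - exact: simplex1_le.
elim: p => [b h|a b h q IH] /=; first exact: key.
rewrite map_rcons rev_rcons -cats1 -catA /=.
apply: (htp_trans _ IH); apply: (@htp_trans _ (trace q ++ iota1 (face 1 b) :: rev (map brev (trace q)))).
  apply: htp_cat; first exact: htp_refl.
  by apply: (@htp_cat [:: b; brev b] [:: iota1 (face 1 b)]); [exact: key|exact: htp_refl].
apply: htp_cat; first exact: htp_refl.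
rewrite -trace_rev; exact: htp_unitl.
Qed.

Section FundamentalGroup.
Variable a : D.

Definition loop := ppath a a.

HB.instance Definition _ := gen_eqMixin loop.
HB.instance Definition _ := gen_choiceMixin loop.

Definition loop_rel : rel loop := fun p q => `[< homotopic (trace p) (trace q) >].

Lemma loop_rel_equiv : equiv_class_of loop_rel.
Proof.
split=> [p|p q|q p r].
- by apply/asboolP; exact: htp_refl.
- by apply/asboolP/asboolP => /htp_sym.
- by move=> /asboolP h1 /asboolP h2; apply/asboolP; exact: htp_trans h1 h2.
Qed.

Canonical loop_equiv := EquivRelPack loop_rel_equiv.

Definition pi1 := {eq_quot loop_rel}.

HB.instance Definition _ := Choice.on pi1.
HB.instance Definition _ := EqQuotient.on pi1.

Lemma pi1P (p q : loop) :
  homotopic (trace p) (trace q) -> \pi_pi1 p = \pi_pi1 q.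
Proof. by move=> h; apply/eqmodP/asboolP. Qed.

Lemma pi1_repr (p : loop) : homotopic (trace (repr (\pi_pi1 p))) (trace p).
Proof.
have : \pi_pi1 (repr (\pi_pi1 p)) = \pi_pi1 p by rewrite reprK.
by move/eqmodP/asboolP.
Qed.

(* The product is the class of the path (repr l) * (repr m). *)
Let mul (l m : pi1) : pi1 := \pi_pi1 (pcat (repr m) (repr l) : loop).
Let one : pi1 := \pi_pi1 (prefl a : loop).
Let inv (l : pi1) : pi1 := \pi_pi1 (path_inv (repr l) : loop).

Let mul_pi (p q : loop) : mul (\pi_pi1 p) (\pi_pi1 q) = \pi_pi1 (pcat q p : loop).
Proof. by apply: pi1P; rewrite !trace_cat; apply: htp_cat; exact: pi1_repr. Qed.

Let inv_pi (p : loop) : inv (\pi_pi1 p) = \pi_pi1 (path_inv p : loop).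
Proof.
by apply: pi1P; rewrite !trace_rev; apply: htp_rev; exact: pi1_repr.
Qed.

Let mulA : associative mul.
Proof.
elim/quotW=> p; elim/quotW=> q; elim/quotW=> r.
rewrite (mul_pi q r) (mul_pi p q) (mul_pi p (pcat r q)) (mul_pi (pcat q p) r).
by apply: pi1P; rewrite !trace_cat catA; exact: htp_refl.
Qed.

Let mul1 : left_id one mul.
Proof.
elim/quotW=> p; rewrite (mul_pi (prefl a) p); apply: pi1P.
by rewrite trace_cat cats1; exact: htp_unitr.
Qed.

Let mul1r : right_id one mul.
Proof.
by elim/quotW=> p; rewrite (mul_pi p (prefl a)); apply: pi1P; rewrite trace_cat; exact: htp_unitl.
Qed.

Let mulV : left_inverse one inv mul.
Proof.
elim/quotW=> p; rewrite (inv_pi p) (mul_pi (path_inv p) p); apply: pi1P.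
by rewrite trace_cat trace_rev; exact: htp_revl.
Qed.

Let mulVr : right_inverse one inv mul.
Proof.
elim/quotW=> p; rewrite (inv_pi p) (mul_pi p (path_inv p)); apply: pi1P.
rewrite trace_cat; have := htp_revl (path_inv p).
suff -> : rev (map brev (trace (path_inv p))) = trace p by [].
rewrite trace_rev map_rev revK -map_comp map_id_in // => b _ /=.
exact: brevK.
Qed.

HB.instance Definition _ := isGroup.Build pi1 mulA mul1 mul1r mulV mulVr.
HB.instance Definition _ := Topological.copy pi1 (discrete_topology pi1).

Lemma pi1M_continuous : continuous (fun x : pi1 * pi1 => (x.1 * x.2)%g).
Proof.
move=> [l m] A /principal_filterP Alm; exists ([set l], [set m]) => /=.
  by split; apply/principal_filterP.
by move=> [l' m'] /= [-> ->].
Qed.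
Lemma pi1V_continuous : continuous (fun x : pi1 => (x^-1)%g).
Proof. by move=> l A /principal_filterP Al; apply/principal_filterP. Qed.
HB.instance Definition _ := isTopGroup.Build pi1 pi1M_continuous pi1V_continuous.

End FundamentalGroup.
End Posets.

Section Gerbes.
Variables (R : realType) (disp : Order.disp_t) (D : porderType disp).

Record cstarBundle := CStarBundle {
  cb_fib :> D -> cstarAlg R;
  cb_map : forall o w : D, (o <= w)%O -> cb_fib o -> cb_fib w;
  cb_iso : forall o w (h : (o <= w)%O), star_iso (cb_map h);
  cb_comp : forall o w x (h1 : (o <= w)%O) (h2 : (w <= x)%O)
      (h3 : (o <= x)%O) v,
    cb_map h2 (cb_map h1 v) = cb_map h3 v
}.

Arguments cb_map c {o w} _ _ : rename.

Record cocycle (K : twoGroup) := Cocycle {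
  co_u : presimplex D 1 -> tg_N K;
  co_g : presimplex D 2 -> tg_G K;
  co_i : forall c : presimplex D 2, is_simplex c ->
    tg_i K (co_g c) =
    (co_u (face 0 c) * co_u (face 2 c) * (co_u (face 1 c))^-1)%g;
  co_coherence : forall d : presimplex D 3, is_simplex d ->
    (co_g (face 0 d) * co_g (face 2 d) =
     tg_hat (co_u (face 0 (face 1 d))) (co_g (face 3 d)) * co_g (face 1 d))%g
}.

Record cstarGerbe (K : twoGroup) (q : cocycle K) := CStarGerbe {
  ge_fib :> D -> cstarAlg R;
  ge_act : forall o, {multiplicative tg_G K -> cstar_aut (ge_fib o)};
  ge_map : forall o w : D, (o <= w)%O -> ge_fib o -> ge_fib w;
  ge_iso : forall o w (h : (o <= w)%O), star_iso (ge_map h);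
  ge_comp : forall o w x (h1 : (o <= w)%O) (h2 : (w <= x)%O)
      (h3 : (o <= x)%O) v,
    ge_act x (co_g q (nerve2 o w x)) (ge_map h3 v) = ge_map h2 (ge_map h1 v);
  ge_equivariant : forall o w (h : (o <= w)%O) g v,
    ge_map h (ge_act o g v) =
    ge_act w (tg_hat (co_u q (nerve1 o w)) g) (ge_map h v)
}.

Arguments ge_act {K q} c o : rename.
Arguments ge_map {K q} c {o w} _ _ : rename.

Section Holonomy.
Variables (K : twoGroup) (q : cocycle K) (F : cstarGerbe q).

Definition ge_map1 (b : presimplex D 1) (hb : is_simplex b) :
    F (face 1 b) -> F (face 0 b) :=
  inv_fun (ge_map F (simplex1_le (isT : 0 <= 1)%N hb))
    \o ge_map F (simplex1_le (isT : 1 <= 1)%N hb).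

Fixpoint ge_hol x y (p : ppath x y) : F x -> F y :=
  match p in ppath x' y' return F x' -> F y' with
  | pone b hb => ge_map1 hb
  | pcons _ b hb p' => ge_map1 hb \o ge_hol p'
  end.

(* phi is an isomorphism of A onto the fixed-point bundle of F. *)
Definition fixed_point_bundle_iso (A : cstarBundle)
    (phi : forall o, A o -> F o) : Prop :=
  (forall o, star_iso_onto (phi o) (fixed_points (ge_act F o))) /\
  (forall o w (h : (o <= w)%O) v, phi w (cb_map A h v) = ge_map F h (phi o v)).

End Holonomy.
End Gerbes.

Arguments cb_map {R disp D} c {o w} _ _ : rename.
Arguments ge_act {R disp D K q} c o : rename.
Arguments ge_map {R disp D K q} c {o w} _ _ : rename.

Definition borel_map (T U : topologicalType) (f : T -> U) : Prop :=
  forall V : set U, open V -> <<s open >> (f @^-1` V).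

(* The Borel structure of the normalizer of alpha G is induced by Aut A. *)
Record twisted_system (R : realType) (G Pi : topGroupType) (A : cstarAlg R)
    (alpha : {multiplicative G -> cstar_aut A}) (nu : Pi -> cstar_aut A)
    (gamma : Pi -> Pi -> G) : Prop := {
  ts_locally_compact : locally_compact [set: Pi];
  ts_normalizes : forall l, normalizer_set (range alpha) (nu l);
  ts_nu_borel : borel_map nu;
  ts_gamma_borel : borel_map (fun p : Pi * Pi => gamma p.1 p.2);
  ts_nu1 : nu 1%g = 1%g;
  ts_nuM : forall l m, (nu l * nu m = alpha (gamma l m) * nu (l * m))%g
}.

(* Main.v *)
(* No Haar measure is used. For embeddings H, H' of a DR-category the averages
   over the (still hypothetical) unitary tensor natural transformations
   W : H -> H' of the functions <w, W v> <w', W v'>^* can be written down from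
   the arrows alone. They form a point of a compact convex set of positive
   definite kernels; a kernel which minimizes a linear functional there and
   then maximizes a convex one is multiplicative, hence comes from an actual W,
   on which the functional is at most its average. This is Tannaka duality.

   Greedily chosen group elements therefore have means approaching the group
   average, so the fixed points of O_d are the closed span of the images of the
   arrows between tensor powers: they are the Doplicher-Roberts algebra.

   Carrying H_a along paths with the isomorphisms r and their inverses gives
   embeddings H_o for which U(H_o) has one and the same image K in Aut O_d.
   For o <= w a natural unitary from H_w to H_o r_ow is implemented by an
   automorphism n_ow^-1 of O_d; the n_ow normalize K and satisfy
   n_wx n_ow = n_ox modulo K. Hence u_b = n_(d_0 b, |b|)^-1 n_(d_1 b, |b|) and
   g_c = u_(d_0 c) u_(d_2 c) u_(d_1 c)^-1 form a cocycle, which defines the gerbe;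
   its holonomy is a product of elements u_b and is homotopy invariant modulo K. *)
From HB Require Import structures.
Require Import Defs.
From mathcomp Require Import all_boot all_order all_algebra.
From mathcomp Require Import all_classical all_reals all_analysis.
From mathcomp Require Import complex ring lra.

Set Implicit Arguments.
Unset Strict Implicit.
Unset Printing Implicit Defensive.

Import Order.TTheory GRing.Theory Num.Theory numFieldNormedType.Exports.

Local Open Scope quotient_scope.
Local Open Scope classical_set_scope.
Local Open Scope ring_scope.

Local Notation "g ∘ f" := (ccomp g f) (at level 40, left associativity).
Local Notation "x ⊠ y" := (tensO x y) (at level 38, left associativity).
Local Notation "s ⊗ t" := (tensH s t) (at level 38, left associativity).

Arguments emb_hom {R S} e {x y} t _.
Arguments emb_unit {R S e}.
Arguments unitO {R t0}.

(** * Sesquilinear forms and Hilbert spaces *)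

(** The group is given only as the natural transformations of [H], and nothing in the data exhibits
    an element other than 1; yet the fixed points must be no larger than the closed span of the
    arrows, and embeddings over comparable points must be unitarily equivalent. Both follow from one
    existence statement for two embeddings [H] and [H'], which is why kernels live on pairs of
    vectors, one in each. A kernel acts as a probability measure: reweighting it by the density 1 +
    Re u, with |u| at most 1/2, gives an admissible kernel again, and extremality forces the two to
    agree, which is multiplicativity. A second obstacle is that O_d is known only by its universal
    property. It vanishes for d = 0; for d > 0 a concrete Cuntz family on square-summable sequences
    shows that its unit is nonzero, and then the arrow spaces embed isometrically, as the norm limit
    in the definition of the Doplicher-Roberts algebra demands. Finite dimension of the Hilbert
    spaces is not part of an embedding either: it comes from conjugates, and all traces and bases
    rest on it. *)

Section LinearMaps.
Variables (K : numDomainType) (U V : lmodType K) (f : U -> V).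
Hypothesis lf : linear f.

Lemma linD x y : f (x + y) = f x + f y.
Proof. by rewrite -{1}[x]scale1r lf scale1r. Qed.

Lemma lin0 : f 0 = 0.
Proof. by apply: (addIr (f 0)); rewrite -linD !add0r. Qed.

Lemma linZ c x : f (c *: x) = c *: f x.
Proof. by rewrite -[c *: x]addr0 lf lin0 addr0. Qed.

Lemma linN x : f (- x) = - f x.
Proof. by rewrite -scaleN1r linZ scaleN1r. Qed.

Lemma linB x y : f (x - y) = f x - f y.
Proof. by rewrite linD linN. Qed.

Lemma lin_sum (I : Type) (r : seq I) (P : pred I) (F : I -> U) :
  f (\sum_(i <- r | P i) F i) = \sum_(i <- r | P i) f (F i).
Proof. by apply: (big_morph f linD lin0). Qed.

End LinearMaps.

Section SesquilinearForms.
Variables (C : numClosedFieldType) (V : lmodType C).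
Implicit Types (x y z : V) (f : V -> V -> C).

Definition sesqform f :=
  (forall x c y z, f x (c *: y + z) = c * f x y + f x z) /\
  (forall x y, f y x = (f x y)^*).

Variable f : V -> V -> C.
Hypothesis sf : sesqform f.

Lemma sq_conj x y : f y x = (f x y)^*. Proof. exact: sf.2. Qed.

Lemma sq_lin x : linear (f x : V -> C^o).
Proof. by move=> c y z; exact: sf.1. Qed.

Lemma sqDr x y z : f x (y + z) = f x y + f x z.
Proof. exact: (linD (sq_lin x)). Qed.
Lemma sq0r x : f x 0 = 0. Proof. exact: (lin0 (sq_lin x)). Qed.
Lemma sqZr x c y : f x (c *: y) = c * f x y.
Proof. exact: (linZ (sq_lin x)). Qed.
Lemma sqNr x y : f x (- y) = - f x y. Proof. exact: (linN (sq_lin x)). Qed.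
Lemma sqBr x y z : f x (y - z) = f x y - f x z.
Proof. exact: (linB (sq_lin x)). Qed.
Lemma sq_sumr x (I : Type) (r : seq I) (P : pred I) (F : I -> V) :
  f x (\sum_(i <- r | P i) F i) = \sum_(i <- r | P i) f x (F i).
Proof. exact: (lin_sum (sq_lin x)). Qed.

Lemma sqDl x y z : f (x + y) z = f x z + f y z.
Proof. by rewrite sq_conj sqDr rmorphD /= -!sq_conj. Qed.
Lemma sq0l y : f 0 y = 0. Proof. by rewrite sq_conj sq0r conjC0. Qed.
Lemma sqZl c x y : f (c *: x) y = c^* * f x y.
Proof. by rewrite sq_conj sqZr rmorphM /= -sq_conj. Qed.
Lemma sqNl x y : f (- x) y = - f x y.
Proof. by rewrite sq_conj sqNr rmorphN /= -sq_conj. Qed.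
Lemma sqBl x y z : f (x - y) z = f x z - f y z.
Proof. by rewrite sqDl sqNl. Qed.
Lemma sq_suml y (I : Type) (r : seq I) (P : pred I) (F : I -> V) :
  f (\sum_(i <- r | P i) F i) y = \sum_(i <- r | P i) f (F i) y.
Proof.
by rewrite sq_conj sq_sumr rmorph_sum /=; apply: eq_bigr => i _; rewrite -sq_conj.
Qed.

(** Subspaces are carried as predicates: [V] may be infinite-dimensional, and the expansion is
    claimed only inside [W]. *)
Definition sq_onb (W : V -> Prop) n (b : 'I_n -> V) :=
  [/\ forall i, W (b i), forall i j, f (b i) (b j) = (i == j)%:R
    & forall w, W w -> w = \sum_i f (b i) w *: b i].

Variable W : V -> Prop.
Hypothesis W0 : W 0.
Hypothesis Wlin : forall c x y, W x -> W y -> W (c *: x + y).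

Lemma sub_sum (I : Type) (r : seq I) (c : I -> C) (F : I -> V) :
  (forall i, W (F i)) -> W (\sum_(i <- r) c i *: F i).
Proof.
move=> WF; elim: r => [|i r IH]; first by rewrite big_nil.
by rewrite big_cons; apply: Wlin.
Qed.

Hypothesis f_def : forall w, W w -> w <> 0 -> 0 < f w w.
Variables (I : finType) (phi chi : I -> V -> C).
Hypothesis f_fin : forall v w, W v -> W w ->
  f v w = \sum_i phi i v * chi i w.

(* The hypothesis [f_fin] bounds the length of an orthonormal family in W;
   a family of maximal length is a basis. *)
Lemma sq_onb_exists : exists n (b : 'I_n -> V), sq_onb W b.
Proof.
pose ON n := exists b : 'I_n -> V,
  (forall i, W (b i)) /\ (forall i j, f (b i) (b j) = (i == j)%:R).
have ON0 : exists n, `[< ON n >].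
  by exists 0%N; apply/asboolP; exists (fun=> 0); split=> [|[]].
have ONb n : `[< ON n >] -> (n <= #|I|)%N.
  move=> /asboolP [b [Wb ob]].
  apply: (@mulmx1_min C n #|I| (\matrix_(i, k) phi (enum_val k) (b i))
                               (\matrix_(k, j) chi (enum_val k) (b j))).
  apply/matrixP => i j; rewrite !mxE -ob f_fin //.
  rewrite (reindex (@enum_val I I)) /=; last exact/onW_bij/enum_val_bij.
  by apply: eq_bigr => k _; rewrite !mxE.
have [n /asboolP [b [Wb ob]] nmax] := ex_maxnP ON0 ONb.
exists n, b; split=> // w Ww.
apply/eqP; rewrite -subr_eq0; apply/eqP; apply: contrapT => r0.
set r := w - _ in r0.
have Wr : W r.
  rewrite /r addrC -scaleN1r; apply: Wlin => //; exact: sub_sum.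
have br i : f (b i) r = 0.
  rewrite /r sqBr sq_sumr (bigD1 i) //= sqZr ob eqxx mulr1 big1 ?addr0 ?subrr//.
  by move=> j ji; rewrite sqZr ob eq_sym (negPf ji) mulr0.
have rr := f_def Wr r0.
pose s := (sqrtC (f r r))^-1.
have s0 : 0 < s by rewrite invr_gt0 sqrtC_gt0.
suff : ON n.+1 by move/asboolP/nmax; rewrite ltnn.
exists (fun i => if unlift ord0 i is Some j then b j else s *: r); split.
  move=> i; case: unliftP => [j|] _ //; rewrite -[s *: r]addr0; exact: Wlin.
have sconj : s^* = s by rewrite geC0_conj // ltW.
have ss : s * (s * f r r) = 1.
  by rewrite mulrA -expr2 /s exprVn sqrtCK mulVf // gt_eqF.
move=> i j; case: (unliftP ord0 i) => [i'|] ->; case: (unliftP ord0 j) => [j'|] ->.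
- by rewrite ob (inj_eq lift_inj).
- by rewrite sqZr br mulr0 -(inj_eq val_inj).
- by rewrite sqZl sq_conj br conjC0 mulr0 -(inj_eq val_inj).
- by rewrite sqZl sqZr sconj ss eqxx.
Qed.

End SesquilinearForms.

Section OrthonormalBases.
Variables (C : numClosedFieldType) (V : lmodType C) (f : V -> V -> C).
Hypothesis sf : sesqform f.
Variables (W : V -> Prop) (n : nat) (b : 'I_n -> V).
Hypothesis ob : sq_onb f W b.

Lemma parseval x y : W y -> f x y = \sum_i f x (b i) * f (b i) y.
Proof.
move=> Wy; have [_ _ bE] := ob; rewrite {1}[y]bE //.
by rewrite (sq_sumr sf); apply: eq_bigr => i _; rewrite (sqZr sf) mulrC.
Qed.

Lemma sq_ext x y : W x -> W y -> (forall w, W w -> f w x = f w y) -> x = y.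
Proof.
move=> Wx Wy E; have [Wb _ bE] := ob; rewrite [x]bE // [y]bE //.
by apply: eq_bigr => i _; rewrite E.
Qed.

End OrthonormalBases.

Lemma sq_cauchy (C : numClosedFieldType) (V : lmodType C) (f : V -> V -> C) :
  sesqform f -> (forall x, 0 <= f x x) -> (forall x, f x x = 0 -> x = 0) ->
  forall x y, `|f x y| ^+ 2 <= f x x * f y y.
Proof.
move=> sf f0 fd x y; have [->|/eqP y0] := eqVneq y 0.
  by rewrite (sq0r sf) normr0 expr0n /= mulr_ge0.
have y1 : 0 < f y y.
  by rewrite lt_neqAle f0 andbT eq_sym; apply/eqP => /fd.
have yy := gt_eqF y1.
have h := f0 (x - (f y x / f y y) *: y).
rewrite (sqBl sf) !(sqBr sf) !(sqZl sf) !(sqZr sf) in h.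
rewrite -ler_pdivrMr // normCK.
suff E : f x y * (f x y)^* / f y y =
    f x x - (f x x - f y x / f y y * f x y -
      ((f y x / f y y)^* * f y x -
       (f y x / f y y)^* * (f y x / f y y * f y y))).
  by rewrite E lerBlDr lerDl.
rewrite -(sq_conj sf x y) rmorphM /= fmorphV /= -!(sq_conj sf).
by field; rewrite yy.
Qed.

Section HilbertForms.
Variables (R : realType) (H : hilbert R).

Lemma ip_sesqform : sesqform (@ip R H).
Proof. by split; [exact: ip_linr|exact: ip_conj]. Qed.

Lemma ip_ge0 (x : H) : 0 <= ip x x.
Proof. by rewrite ip_norm exprn_ge0. Qed.

Lemma ip_eq0 (x : H) : ip x x = 0 -> x = 0.
Proof. by rewrite ip_norm => /eqP; rewrite expf_eq0 /= normr_eq0 => /eqP. Qed.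

Lemma ip_gt0 (x : H) : x <> 0 -> 0 < ip x x.
Proof.
move=> x0; rewrite lt_neqAle ip_ge0 andbT eq_sym.
by apply/eqP => /ip_eq0.
Qed.

Lemma ip_ext (x y : H) : (forall w, ip w x = ip w y) -> x = y.
Proof.
move=> E; apply/eqP; rewrite -subr_eq0; apply/eqP/ip_eq0.
by rewrite (sqBr ip_sesqform) E subrr.
Qed.

Lemma ipDr (x y z : H) : ip x (y + z) = ip x y + ip x z.
Proof. exact: sqDr ip_sesqform _ _ _. Qed.
Lemma ip0r (x : H) : ip x 0 = 0. Proof. exact: sq0r ip_sesqform _. Qed.
Lemma ip0l (x : H) : ip 0 x = 0. Proof. exact: sq0l ip_sesqform _. Qed.
Lemma ipZr (x : H) c y : ip x (c *: y) = c * ip x y.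
Proof. exact: sqZr ip_sesqform _ _ _. Qed.
Lemma ipBr (x y z : H) : ip x (y - z) = ip x y - ip x z.
Proof. exact: sqBr ip_sesqform _ _ _. Qed.
Lemma ip_sumr (x : H) (I : Type) (r : seq I) (P : pred I) (F : I -> H) :
  ip x (\sum_(i <- r | P i) F i) = \sum_(i <- r | P i) ip x (F i).
Proof. exact: sq_sumr ip_sesqform _ _ _ _ _. Qed.
Lemma ipDl (x y z : H) : ip (x + y) z = ip x z + ip y z.
Proof. exact: sqDl ip_sesqform _ _ _. Qed.
Lemma ipZl (x : H) c y : ip (c *: x) y = c^* * ip x y.
Proof. exact: sqZl ip_sesqform _ _ _. Qed.
Lemma ipBl (x y z : H) : ip (x - y) z = ip x z - ip y z.
Proof. exact: sqBl ip_sesqform _ _ _. Qed.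
Lemma ip_suml (y : H) (I : Type) (r : seq I) (P : pred I) (F : I -> H) :
  ip (\sum_(i <- r | P i) F i) y = \sum_(i <- r | P i) ip (F i) y.
Proof. exact: sq_suml ip_sesqform _ _ _ _ _. Qed.

Definition onb n (b : 'I_n -> H) := sq_onb (@ip R H) (fun=> True) b.

Lemma onb_ip n (b : 'I_n -> H) : onb b -> forall i j, ip (b i) (b j) = (i == j)%:R.
Proof. by case. Qed.

Lemma onbE n (b : 'I_n -> H) : onb b -> forall w, w = \sum_i ip (b i) w *: b i.
Proof. by case=> _ _ h w; exact: h. Qed.

Lemma ip_parseval n (b : 'I_n -> H) : onb b ->
  forall x y, ip x y = \sum_i ip x (b i) * ip (b i) y.
Proof. by move=> ob x y; exact: (parseval ip_sesqform ob). Qed.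

Lemma ip_cauchy (x y : H) : `|ip x y| <= `|x| * `|y|.
Proof.
rewrite -(@ler_pXn2r _ 2) ?nnegrE ?mulr_ge0 // exprMn -!ip_norm.
by apply: (sq_cauchy ip_sesqform); [exact: ip_ge0|exact: ip_eq0].
Qed.

End HilbertForms.

(** * Embeddings of DR-categories *)

Section Coherence.
Variables (R : realType).

(** Equality proofs are irrelevant, so every diagram made of identity arrows along equalities
    commutes; all strictness bookkeeping reduces to this. *)
Lemma coe_id (T : cstarCat R) (x : T) (e : x = x) : coe e = idc x.
Proof. by rewrite (Prop_irrelevance e erefl). Qed.

Lemma coe_irr (T : cstarCat R) (x y : T) (e e' : x = y) : coe e = coe e'.
Proof. by rewrite (Prop_irrelevance e e'). Qed.

Lemma coe_comp (T : cstarCat R) (x y z : T) (e : x = y) (e' : y = z) :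
  coe e' ∘ coe e = coe (etrans e e').
Proof. by subst z; rewrite comp1c; apply: coe_irr. Qed.

Lemma coeK (T : cstarCat R) (x y : T) (e : x = y) (e' : y = x) :
  coe e' ∘ coe e = idc x.
Proof. by rewrite coe_comp coe_id. Qed.

Lemma coe_adj (T : cstarCat R) (x y : T) (e : x = y) :
  cadj (coe e) = coe (esym e).
Proof.
subst y; rewrite /= -[cadj _]compc1 -{2}[idc x]adjK -adj_comp compc1.
by rewrite adjK.
Qed.

Lemma coe_tens (T : tensorCat R) (x y x' y' : T) (e : x = y) (e' : x' = y')
    (E : x ⊠ x' = y ⊠ y') : coe e ⊗ coe e' = coe E.
Proof. by destruct e, e'; rewrite !coe_id tens_id. Qed.

End Coherence.

Section Embeddings.
Variables (R : realType) (T : drCat R) (H : embedding T).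
Local Notation C := (cplx R).

Lemma emb_lin (x y : T) (t : arr x y) : linear (emb_hom H t).
Proof. exact: emb_hom_linear. Qed.

Lemma emb_arr_lin (x y : T) v :
  linear (fun t : arr x y => emb_hom H t v).
Proof. by move=> c s t; exact: emb_homP. Qed.

Lemma emb_adjr (x y : T) (t : arr x y) v w :
  ip w (emb_hom H t v) = ip (emb_hom H (cadj t) w) v.
Proof. by rewrite emb_hom_adj adjK. Qed.

Lemma emb_coeK (x y : T) (e : x = y) (e' : y = x) v :
  emb_hom H (coe e') (emb_hom H (coe e) v) = v.
Proof. by rewrite -emb_hom_comp coeK emb_hom_id. Qed.

Lemma emb_coe_ip (x y : T) (e : x = y) v w :
  ip (emb_hom H (coe e) v) (emb_hom H (coe e) w) = ip v w.
Proof. by rewrite emb_hom_adj coe_adj emb_coeK. Qed.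

Lemma emb_unit_ip : ip (emb_unit : H unitO) emb_unit = 1.
Proof. by rewrite ip_norm emb_unit_norm expr1n. Qed.

Lemma emb_unitE (v : H unitO) : v = ip emb_unit v *: emb_unit.
Proof.
have [c ->] := emb_unit_span v.
by rewrite ipZr emb_unit_ip mulr1.
Qed.

Lemma emb_unitl (x : T) (v : H x) :
  emb_hom H (coe (esym (tensO1l x))) v = emb_tens emb_unit v.
Proof. by rewrite -{1}[v]emb_tens1l emb_coeK. Qed.

Lemma emb_unitr (x : T) (v : H x) :
  emb_hom H (coe (esym (tensO1r x))) v = emb_tens v emb_unit.
Proof. by rewrite -{1}[v]emb_tens1r emb_coeK. Qed.

Lemma emb_assoc' (x y z : T) (u : H x) (v : H y) (w : H z) :
  emb_hom H (coe (esym (tensOA x y z))) (emb_tens (emb_tens u v) w) =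
  emb_tens u (emb_tens v w).
Proof. by rewrite -emb_tensA emb_coeK. Qed.

Lemma emb_tens_norm (x y : T) (v : H x) (w : H y) :
  `|emb_tens v w| = `|v| * `|w|.
Proof.
apply/eqP; rewrite -(@eqrXn2 _ 2) ?mulr_ge0 // exprMn -!ip_norm.
by rewrite emb_tens_ip.
Qed.

(** For z nonzero, some finite sum s of elementary tensors lies within |z| of z. If these are
    orthogonal to z, then |z|^2 = <z - s, z>, and Cauchy-Schwarz gives |z| <= |z - s| < |z|. *)
Lemma emb_tens_orth (x y : T) (z : H (x ⊠ y)) :
  (forall v w, ip (emb_tens v w) z = 0) -> z = 0.
Proof.
move=> oz; apply: contrapT => z0.
have nz : 0 < `|z| by rewrite normr_gt0; apply/eqP.
have : closure (lin_span [set u | exists v w, u = @emb_tens _ _ H x y v w]) z.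
  by rewrite emb_tens_dense.
move/(_ (ball z `|z|) (nbhsx_ballx _ _ nz)) => [s [[n [c [f [hf ->]]]]]].
rewrite -ball_normE /=; set s' := \sum_i _ => hz.
suff : `|z| <= `|z - s'| by move=> /le_lt_trans /(_ hz); rewrite ltxx.
have os : ip s' z = 0.
  rewrite /s' ip_suml big1 // => i _; have [v [w ->]] := hf i.
  by rewrite ipZl oz mulr0.
rewrite -(@ler_pM2l _ `|z|) // -expr2 -ip_norm.
have -> : ip z z = `|ip (z - s') z| by rewrite ipBl os subr0 ger0_norm ?ip_ge0.
by rewrite mulrC; exact: ip_cauchy.
Qed.

Lemma emb_tens_ext (x y : T) (z z' : H (x ⊠ y)) :
  (forall v w, ip (emb_tens v w) z = ip (emb_tens v w) z') -> z = z'.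
Proof.
move=> E; apply/eqP; rewrite -subr_eq0; apply/eqP/emb_tens_orth => v w.
by rewrite ipBr E subrr.
Qed.

Lemma emb_tens_onb (x y : T) m n (b : 'I_m -> H x) (c : 'I_n -> H y) :
  onb b -> onb c -> forall z : H (x ⊠ y),
  z = \sum_i \sum_j ip (emb_tens (b i) (c j)) z *: emb_tens (b i) (c j).
Proof.
move=> ob oc z; apply: emb_tens_ext => v w.
rewrite ip_sumr {1}(onbE ob v) {1}(onbE oc w).
rewrite (lin_sum (emb_tens_linl _)) ip_suml; apply: eq_bigr => i _.
rewrite (linZ (emb_tens_linl _)) (lin_sum (emb_tens_linr _)) ipZl.
rewrite ip_suml ip_sumr mulr_sumr; apply: eq_bigr => j _.
rewrite (linZ (emb_tens_linr _)) ipZl ipZr emb_tens_ip.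
by rewrite -!(ip_conj (b i)) -!(ip_conj (c j)) mulrA mulrC.
Qed.

(** The first conjugate equation on vectors: contracting v with the first leg of the duality vector
    [emb_hom H r emb_unit] returns v. *)
Lemma conj_vec (x y : T) (r : arr unitO (y ⊠ x)) :
  (cadj (sym y x ∘ r) ⊗ idc x) ∘ coe (tensOA x y x) ∘ (idc x ⊗ r)
    = coe (etrans (tensO1r x) (esym (tensO1l x))) ->
  forall v : H x,
  emb_hom H ((cadj (sym y x ∘ r) ⊗ idc x) ∘ coe (tensOA x y x))
    (emb_tens v (emb_hom H r emb_unit)) = emb_tens emb_unit v.
Proof.
move=> E v; rewrite -{1}[v](emb_hom_id (e := H)) -emb_tensH -emb_hom_comp E.
by rewrite -coe_comp emb_hom_comp emb_tens1r emb_unitl.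
Qed.

Lemma conj_tens (x y : T) (r' : arr unitO (x ⊠ y)) (v : H x) (f : H y) (e : H x) :
  emb_hom H ((cadj r' ⊗ idc x) ∘ coe (tensOA x y x))
    (emb_tens v (emb_tens f e)) =
  ip (emb_hom H r' emb_unit) (emb_tens v f) *: emb_tens emb_unit e.
Proof.
rewrite emb_hom_comp emb_tensA emb_tensH emb_hom_id.
rewrite {1}[emb_hom H _ _]emb_unitE (linZ (emb_tens_linl _)).
by rewrite emb_adjr adjK.
Qed.

(** The duality vector is approximated by a finite combination of tensors g_i (x) h_i, up to a
    radius below which the contraction [t0] has values of norm less than 1/2. Contraction then puts
    every unit vector orthogonal to the span of the h_i within 1/2 of that span, so there is
    none. *)
Lemma fin_dim (x : T) : exists n (b : 'I_n -> H x), onb b.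
Proof.
have [y [r [E _]]] := dr_conj x.
set t0 := (cadj (sym y x ∘ r) ⊗ idc x) ∘ coe (tensOA x y x).
have cv := conj_vec E; rewrite -/t0 in cv.
have : emb_hom H t0 z @[z --> (0 : H _)] --> emb_hom H t0 0.
  exact: emb_hom_continuous.
rewrite (lin0 (emb_lin t0)) => /cvgrPdist_lt /(_ (2^-1)) h2.
have /nbhs_ballP [e /= e0 he] := h2 ltac:(by rewrite invr_gt0).
have : closure (lin_span [set u | exists v w, u = @emb_tens _ _ H y x v w])
    (emb_hom H r emb_unit) by rewrite emb_tens_dense.
move=> /(_ (ball (emb_hom H r emb_unit) e) (nbhsx_ballx _ _ e0)) [s [[n [c [f [hf ->]]]]]].
rewrite -ball_normE /= => hR.
have [g gE] := choice hf; have [h hE] := choice gE.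
pose W (w : H x) := exists a : 'I_n -> C, w = \sum_i a i *: h i.
have W0 : W 0.
  by exists (fun=> 0); rewrite big1 // => i _; rewrite scale0r.
have Wlin c' v w : W v -> W w -> W (c' *: v + w).
  move=> [a ->] [b ->]; exists (fun i => c' * a i + b i).
  rewrite scaler_sumr -big_split /=; apply: eq_bigr => i _.
  by rewrite scalerDl scalerA.
have /choice [co coP] (w : H x) : exists a : 'I_n -> C, W w -> w = \sum_i a i *: h i.
  by have [[a aE]|nW] := pselect (W w); [exists a|exists (fun=> 0)].
have [||m [b ob]] := @sq_onb_exists _ _ _ (ip_sesqform (H x)) W W0 Wlin _ 'I_n
   (fun i v => ip v (h i)) (fun i w => co w i).
- by move=> w _; exact: ip_gt0.
- move=> v w _ /coP {1}->; rewrite ip_sumr; apply: eq_bigr => i _.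
  by rewrite ipZr mulrC.
exists m, b; have [_ ob' _] := ob; split=> //.
move=> v _; apply/eqP; rewrite -subr_eq0; apply/eqP; apply: contrapT.
set v' := v - _ => v0.
have nv : 0 < `|v'| by rewrite normr_gt0; apply/eqP.
have ov i : ip (b i) v' = 0.
  rewrite ipBr ip_sumr (bigD1 i) //= ipZr ob' eqxx mulr1.
  rewrite big1 ?addr0 ?subrr // => j ji.
  by rewrite ipZr ob' eq_sym (negPf ji) mulr0.
have oW w : W w -> ip w v' = 0.
  move=> Ww; have [_ _ bE] := ob; rewrite (bE w Ww) ip_suml big1 // => i _.
  by rewrite ipZl ov mulr0.
pose v1 := `|v'|^-1 *: v'.
have nv1 : `|v1| = 1 by rewrite normrZ normrV ?unitfE ?gt_eqF // normr_id mulVf ?gt_eqF.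
pose w := \sum_i (c i * ip (emb_hom H (sym y x ∘ r) emb_unit)
  (emb_tens v1 (g i))) *: h i.
have ow : ip w v1 = 0 by rewrite ipZr oW ?mulr0 //; eexists.
have := he (emb_tens v1 (emb_hom H r emb_unit - \sum_i c i *: f i)).
rewrite -ball_normE /= sub0r normrN emb_tens_norm nv1 mul1r => /(_ hR).
rewrite sub0r normrN (linB (emb_tens_linr _)) (linB (emb_lin t0)) cv.
rewrite (lin_sum (emb_tens_linr _)) (lin_sum (emb_lin t0)).
have -> : \sum_i emb_hom H t0 (emb_tens v1 (c i *: f i)) = emb_tens emb_unit w.
  rewrite (lin_sum (emb_tens_linr _)); apply: eq_bigr => i _.
  rewrite (linZ (emb_tens_linr _)) (linZ (emb_lin t0)) hE conj_tens.
  by rewrite scalerA (linZ (emb_tens_linr _)).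
rewrite -(linB (emb_tens_linr _)) emb_tens_norm emb_unit_norm mul1r.
suff : 1 <= `|v1 - w| by move=> h1 /(le_lt_trans h1); rewrite invf_gt1 ?ltr0n // (ltr_nat _ 2 1).
rewrite -(@ler_pXn2r _ 2) ?nnegrE // expr1n -ip_norm ipBl !ipBr ow.
rewrite (ip_conj w v1) ow conjC0 subr0 sub0r opprK ip_norm nv1 expr1n.
by rewrite lerDl ip_ge0.
Qed.

End Embeddings.

Arguments emb_lin {R T H x y} t.

(** * Partial traces, Hilbert-Schmidt products and averages of rank one operators *)

Section Traces.
Variables (R : realType) (T : drCat R).
Local Notation C := (cplx R).

(** Expanding the duality vector along [b] defines f. Contracting it with b_i and reading the
    coefficient of b_j gives a scalar product of two of the f's, which the conjugate equation sets
    to the Kronecker symbol. *)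
Lemma conj_basis (x y : T) (r : arr unitO (y ⊠ x)) :
  (cadj (sym y x ∘ r) ⊗ idc x) ∘ coe (tensOA x y x) ∘ (idc x ⊗ r)
    = coe (etrans (tensO1r x) (esym (tensO1l x))) ->
  forall (H : embedding T) n (b : 'I_n -> H x), onb b ->
  exists f : 'I_n -> H y, (forall i j, ip (f i) (f j) = (i == j)%:R) /\
    emb_hom H (sym y x ∘ r) emb_unit = \sum_k emb_tens (b k) (f k).
Proof.
move=> E H n b ob; have [m [c oc]] := fin_dim H y.
set R0 := emb_hom H r emb_unit.
pose f k := \sum_j ip (emb_tens (c j) (b k)) R0 *: c j.
have RE : R0 = \sum_k emb_tens (f k) (b k).
  rewrite {1}(emb_tens_onb oc ob R0) exchange_big /=; apply: eq_bigr => k _.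
  rewrite (lin_sum (emb_tens_linl _)); apply: eq_bigr => j _.
  by rewrite (linZ (emb_tens_linl _)).
have RE' : emb_hom H (sym y x ∘ r) emb_unit = \sum_k emb_tens (b k) (f k).
  rewrite emb_hom_comp -/R0 RE (lin_sum (emb_lin _)).
  by apply: eq_bigr => k _; rewrite emb_sym.
exists f; split=> // i j.
have := conj_vec E (b i); rewrite -/R0 RE (lin_sum (emb_tens_linr _)).
rewrite (lin_sum (emb_lin _)) => /(congr1 (ip (emb_tens emb_unit (b j)))).
rewrite emb_tens_ip emb_unit_ip mul1r (onb_ip ob) ip_sumr eq_sym => <-.
rewrite (bigD1 j) //= big1 ?addr0; last first.
  move=> k kj; rewrite conj_tens ipZr emb_tens_ip (onb_ip ob) eq_sym.
  by rewrite (negPf kj) !mulr0.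
rewrite conj_tens ipZr emb_tens_ip emb_unit_ip (onb_ip ob) eqxx !mulr1.
rewrite RE' ip_suml (bigD1 i) //= emb_tens_ip (onb_ip ob) eqxx mul1r.
rewrite big1 ?addr0 // => k ki.
by rewrite emb_tens_ip (onb_ip ob) (negPf ki) mul0r.
Qed.

(** The last leg is closed up with a conjugate of z. The arrow is chosen before the embedding, so a
    trace identity proved in [H] can be read in any [H']; this carries information from one
    embedding to the other. *)
Lemma partial_trace (x y z : T) (t : arr (y ⊠ z) (x ⊠ z)) :
  exists s : arr y x, forall (H : embedding T) n (b : 'I_n -> H z), onb b ->
    forall v w, ip w (emb_hom H s v) =
      \sum_k ip (emb_tens w (b k)) (emb_hom H t (emb_tens v (b k))).
Proof.
have [zc [r [E _]]] := dr_conj z.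
have [P PE] : exists P : forall w : T, arr w ((w ⊠ z) ⊠ zc),
    forall (H : embedding T) n (b : 'I_n -> H z), onb b ->
    exists f : 'I_n -> H zc, (forall i j, ip (f i) (f j) = (i == j)%:R) /\
      forall w (v : H w), emb_hom H (P w) v =
        \sum_k emb_tens (emb_tens v (b k)) (f k).
  exists (fun w => coe (tensOA w z zc) ∘ (idc w ⊗ (sym zc z ∘ r)) ∘
    coe (esym (tensO1r w))) => H n b ob.
  have [f [ff fE]] := conj_basis E ob; exists f; split=> // w v.
  rewrite 2!emb_hom_comp emb_unitr emb_tensH emb_hom_id fE.
  rewrite (lin_sum (emb_tens_linr _)) (lin_sum (emb_lin _)).
  by apply: eq_bigr => k _; rewrite emb_tensA.
exists (cadj (P x) ∘ (t ⊗ idc zc) ∘ P y) => H n b ob v w.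
have [f [ff fE]] := PE H n b ob.
rewrite !emb_hom_comp emb_adjr adjK !fE (lin_sum (emb_lin _)).
rewrite ip_suml; apply: eq_bigr => j _.
rewrite ip_sumr (bigD1 j) //= emb_tensH emb_hom_id emb_tens_ip ff eqxx mulr1.
rewrite big1 ?addr0 // => k kj.
by rewrite emb_tensH emb_hom_id emb_tens_ip ff eq_sym (negPf kj) mulr0.
Qed.

Variable H : embedding T.

Definition hbasis (x : T) : {n & {b : 'I_n -> H x | onb b}}.
Proof. by have [n /cid nb] := cid (fin_dim H x); exists n. Qed.

Definition hdim x := projT1 (hbasis x).
Definition hb x : 'I_(hdim x) -> H x := sval (projT2 (hbasis x)).
Lemma hbP x : onb (@hb x). Proof. exact: (svalP (projT2 (hbasis x))). Qed.

Definition trh (x : T) (t : arr x x) : C := \sum_k ip (hb k) (emb_hom H t (hb k)).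

Lemma trh_mulC (x y : T) (s : arr y x) (t : arr x y) :
  trh (s ∘ t) = trh (t ∘ s).
Proof.
have E (a b : T) (p : arr b a) (q : arr a b) : trh (p ∘ q) =
    \sum_k \sum_l ip (hb k) (emb_hom H p (hb l)) * ip (hb l) (emb_hom H q (hb k)).
  apply: eq_bigr => k _; rewrite emb_hom_comp emb_adjr.
  by rewrite (ip_parseval (@hbP b)); apply: eq_bigr => l _; rewrite -emb_adjr.
rewrite !E exchange_big; apply: eq_bigr => k _; apply: eq_bigr => l _.
by rewrite mulrC.
Qed.

Definition hs (x y : T) (s t : arr x y) : C := trh (cadj s ∘ t).

Lemma hsE x y (s t : arr x y) :
  hs s t = \sum_k ip (emb_hom H s (hb k)) (emb_hom H t (hb k)).
Proof. by apply: eq_bigr => k _; rewrite emb_hom_comp emb_adjr adjK. Qed.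

Lemma hs_sesqform x y : sesqform (@hs x y).
Proof.
split=> [s c t t'|s t]; rewrite !hsE.
  rewrite mulr_sumr -big_split; apply: eq_bigr => k _ /=.
  by rewrite emb_homP ipDr ipZr.
by rewrite rmorph_sum /=; apply: eq_bigr => k _; rewrite -ip_conj.
Qed.

Lemma hs_def x y (s : arr x y) : s <> 0 -> 0 < hs s s.
Proof.
move=> s0; rewrite lt_neqAle hsE sumr_ge0 ?andbT; last by move=> k _; exact: ip_ge0.
apply/eqP => /esym /eqP; rewrite psumr_eq0; last by move=> k _; exact: ip_ge0.
move=> /allP h; apply: s0; apply: (@emb_hom_faithful _ _ H) => v.
have Z : emb_hom H (0 : arr x y) v = 0 := lin0 (emb_arr_lin v).
rewrite Z (onbE (@hbP x) v) (lin_sum (emb_lin _)) big1 // => k _.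
rewrite (linZ (emb_lin _)).
have -> : emb_hom H s (hb k) = 0.
  by apply: ip_eq0; apply/eqP; apply: (h k); rewrite mem_index_enum.
by rewrite scaler0.
Qed.

Lemma arr_onb (x y : T) : exists n (b : 'I_n -> arr x y), sq_onb (@hs x y) (fun=> True) b.
Proof.
pose I := ('I_(hdim x) * 'I_(hdim y))%type.
apply: (@sq_onb_exists _ _ _ (hs_sesqform x y) (fun=> True) _ _ _
  I (fun i s => ip (emb_hom H s (hb i.1)) (hb i.2))
  (fun i s => ip (hb i.2) (emb_hom H s (hb i.1)))) => //.
- by move=> w _; exact: hs_def.
- move=> s t _ _; rewrite hsE.
  rewrite -(pair_bigA _ (fun i j => ip (emb_hom H s (hb i)) (hb j) *
    ip (hb j) (emb_hom H t (hb i)))) /=.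
  by apply: eq_bigr => k _; rewrite (ip_parseval (@hbP y)).
Qed.

Lemma hs_ext x y (s t : arr x y) : (forall u, hs u s = hs u t) -> s = t.
Proof.
have [n [b ob]] := arr_onb x y.
by move=> E; apply: (sq_ext ob) => // w _; exact: E.
Qed.

(* [hrep v w] stands for the average over the unitary natural transformations
   g of g v (g w)^*, i.e. for the Hilbert-Schmidt projection of the rank one
   operator v w^* onto the arrows. *)
Lemma hrep_exists (x y : T) (v : H x) (w : H y) :
  exists E : arr y x, forall s, hs s E = ip (emb_hom H s w) v.
Proof.
have [n [b ob]] := arr_onb y x.
exists (\sum_i ip (emb_hom H (b i) w) v *: b i) => s.
have [_ _ /(_ s Logic.I) {2}->] := ob.
rewrite (lin_sum (emb_arr_lin w)) ip_suml (sq_sumr (hs_sesqform _ _)).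
apply: eq_bigr => i _.
rewrite (linZ (emb_arr_lin w)) ipZl (sqZr (hs_sesqform _ _)) mulrC.
by rewrite -(sq_conj (hs_sesqform _ _)).
Qed.

Definition hrep (x y : T) (v : H x) (w : H y) : arr y x :=
  sval (cid (hrep_exists v w)).

Lemma hrepP (x y : T) (v : H x) (w : H y) s :
  hs s (hrep v w) = ip (emb_hom H s w) v.
Proof. exact: (svalP (cid (hrep_exists v w))). Qed.

Lemma hrep_linl (x y : T) (w : H y) : linear (fun v : H x => hrep v w).
Proof.
move=> c v v'; apply: hs_ext => s.
by rewrite (hs_sesqform _ _).1 !hrepP ipDr ipZr.
Qed.

Lemma hs_adj x y (s t : arr x y) : hs (cadj s) (cadj t) = hs t s.
Proof. by rewrite /hs adjK trh_mulC. Qed.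

Lemma hrep_adj (x y : T) (v : H x) (w : H y) : cadj (hrep v w) = hrep w v.
Proof.
apply: hs_ext => s; rewrite -{1}[s]adjK hs_adj hrepP.
by rewrite (sq_conj (hs_sesqform _ _)) !hrepP -ip_conj emb_hom_adj.
Qed.

Lemma hrep_nat (x x' y : T) (t : arr x x') (v : H x) (w : H y) :
  hrep (emb_hom H t v) w = t ∘ hrep v w.
Proof.
apply: hs_ext => s; rewrite hrepP emb_adjr -emb_hom_comp -hrepP.
by rewrite /hs adj_comp adjK Defs.compA.
Qed.

(** The trace does not depend on the basis. Asking only for the Parseval identity admits product
    bases of tensor products and the basis of words. *)
Lemma hs_parseval (x y : T) (s t : arr x y) (I : finType) (b : I -> H x) :
  (forall v w, ip v w = \sum_i ip v (b i) * ip (b i) w) ->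
  hs s t = \sum_i ip (emb_hom H s (b i)) (emb_hom H t (b i)).
Proof.
move=> Pb; rewrite hsE.
transitivity (\sum_k \sum_i ip (hb k) (b i) *
    ip (b i) (emb_hom H (cadj s ∘ t) (hb k))).
  by apply: eq_bigr => k _; rewrite -Pb emb_hom_comp [RHS]emb_adjr adjK.
rewrite exchange_big /=; apply: eq_bigr => i _.
rewrite -[in RHS](adjK s) -emb_adjr -emb_hom_comp emb_adjr.
rewrite (ip_parseval (@hbP _)); apply: eq_bigr => k _.
by rewrite mulrC -emb_adjr.
Qed.

Lemma hrep_unit : hrep (emb_unit : H unitO) (emb_unit : H unitO) = idc unitO.
Proof.
apply: hs_ext => s; rewrite hrepP (@hs_parseval _ _ _ _ 'I_1 (fun=> emb_unit)).
  by rewrite big_ord1 emb_hom_id.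
by move=> v w; rewrite big_ord1 {1}[w]emb_unitE ipZr mulrC.
Qed.

Lemma tens_parseval (x y : T) m n (b : 'I_m -> H x) (c : 'I_n -> H y) :
  onb b -> onb c -> forall v w : H (x ⊠ y), ip v w =
  \sum_(p : 'I_m * 'I_n) ip v (emb_tens (b p.1) (c p.2)) *
                         ip (emb_tens (b p.1) (c p.2)) w.
Proof.
move=> ob oc v w; rewrite -(pair_bigA _ (fun i j => ip v (emb_tens (b i) (c j))
  * ip (emb_tens (b i) (c j)) w)) /= {1}(emb_tens_onb ob oc w) ip_sumr.
apply: eq_bigr => i _; rewrite ip_sumr; apply: eq_bigr => j _.
by rewrite ipZr mulrC.
Qed.

(** Integrated form of g g^* = 1 on H z. Testing against an arrow s turns the sum over k into a
    partial trace of s. *)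
Lemma hrep_tens (x y z : T) (v : H x) (w : H y) n (c : 'I_n -> H z) : onb c ->
  \sum_k hrep (emb_tens v (c k)) (emb_tens w (c k)) = hrep v w ⊗ idc z.
Proof.
move=> oc; apply: hs_ext => s; have [p pE] := partial_trace s.
rewrite [RHS](hs_parseval _ _ (tens_parseval (@hbP y) oc)).
rewrite -(pair_bigA _ (fun i j => ip (emb_hom H s (emb_tens (hb i) (c j)))
  (emb_hom H (hrep v w ⊗ idc z) (emb_tens (hb i) (c j))))) /=.
transitivity (hs p (hrep v w)); last first.
  rewrite hsE; apply: eq_bigr => i _; rewrite ip_conj (pE _ _ c oc).
  rewrite rmorph_sum /=; apply: eq_bigr => k _.
  by rewrite emb_tensH emb_hom_id -ip_conj.
rewrite (sq_sumr (hs_sesqform _ _)) hrepP ip_conj (pE _ _ c oc) rmorph_sum /=.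
by apply: eq_bigr => k _; rewrite hrepP ip_conj.
Qed.

(** Integrated form of the isometry of g on the leg z: tracing out the legs g w1 and g w2 leaves
    <w2, w1>. The partial-trace arrow is identified by its products inside [H] and then evaluated in
    [H']. *)
Lemma hrep_ptr (x y z : T) (v : H x) (w : H y) (w1 w2 : H z)
    (H' : embedding T) n (c : 'I_n -> H' z) v' w' : onb c ->
  \sum_k ip (emb_tens v' (c k))
     (emb_hom H' (hrep (emb_tens v w1) (emb_tens w w2)) (emb_tens w' (c k))) =
  ip w2 w1 * ip v' (emb_hom H' (hrep v w) w').
Proof.
move=> oc; have [p pE] := partial_trace (hrep (emb_tens v w1) (emb_tens w w2)).
rewrite -pE // -ipZr -(linZ (emb_arr_lin _)); congr (ip _ (emb_hom _ _ _)).
apply: hs_ext => s; rewrite (sqZr (hs_sesqform _ _)) hrepP.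
rewrite -[ip w2 w1]/(ip w2 w1) mulrC -emb_tens_ip.
rewrite -[w2](emb_hom_id (e := H)) -emb_tensH -hrepP.
rewrite [RHS](hs_parseval _ _ (tens_parseval (@hbP y) (@hbP z))).
rewrite -(pair_bigA _ (fun i j => ip (emb_hom H (s ⊗ idc z) (emb_tens (hb i) (hb j)))
  (emb_hom H (hrep (emb_tens v w1) (emb_tens w w2)) (emb_tens (hb i) (hb j))))) /=.
rewrite hsE; apply: eq_bigr => i _; rewrite (pE _ _ _ (@hbP z)).
by apply: eq_bigr => k _; rewrite emb_tensH emb_hom_id.
Qed.

End Traces.

(** * Positivity of the averaged kernel *)

Section Positivity.
Variables (R : realType) (T : drCat R) (H H' : embedding T).
Local Notation C := (cplx R).
Variables (n : nat) (x : 'I_n -> T) (v : forall i, H (x i)) (v' : forall i, H' (x i)).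

(** Naturality is imposed only along arrows between the n given objects, so that these families form
    a finite-dimensional space. *)
Definition natural_on (Z : forall i, H (x i) -> H' (x i)) :=
  (forall i, linear (Z i)) /\
  forall i j (t : arr (x j) (x i)) w, Z i (emb_hom H t w) = emb_hom H' t (Z j w).

Let A := {i : 'I_n & ('I_(hdim H (x i)) * 'I_(hdim H' (x i)))%type}.
Let V := {ffun A -> C^o}.
Let f (S S' : V) : C := \sum_a (S a)^* * S' a.

Let f_sesqform : sesqform f.
Proof.
split=> [S c S1 S2|S S']; rewrite /f.
  rewrite mulr_sumr -big_split; apply: eq_bigr => a _ /=.
  by rewrite !ffunE mulrDr mulrCA.
rewrite rmorph_sum; apply: eq_bigr => a _ /=.
by rewrite rmorphM /= conjCK mulrC.
Qed.

Let sum_A (F : forall i, 'I_(hdim H (x i)) -> 'I_(hdim H' (x i)) -> C) :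
  \sum_(a : A) F (tag a) (tagged a).1 (tagged a).2 = \sum_i \sum_a \sum_b F i a b.
Proof.
rewrite -(@sig_big_dep _ _ _ _ (fun i => ('I_(hdim H (x i)) * 'I_(hdim H' (x i)))%type)
  xpredT (fun _ => xpredT) (fun i p => F i p.1 p.2)) /=.
by apply: eq_bigr => i _; rewrite -(pair_bigA _ (fun a b => F i a b)).
Qed.

Let cf (Z : forall i, H (x i) -> H' (x i)) : V :=
  [ffun a : A => ip (hb (tagged a).2) (Z (tag a) (hb (tagged a).1))].

Let W (S : V) := exists Z, natural_on Z /\ S = cf Z.

Let f_cf Z Z' : f (cf Z) (cf Z') = \sum_i \sum_a ip (Z i (hb a)) (Z' i (hb a)).
Proof.
rewrite /f.
under eq_bigr do rewrite !ffunE -ip_conj.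
rewrite (sum_A (fun i a b => ip (Z i (hb a)) (hb b) * ip (hb b) (Z' i (hb a)))).
apply: eq_bigr => i _.
by apply: eq_bigr => a _; rewrite -(ip_parseval (@hbP _ _ H' (x i))).
Qed.

Lemma natural_projection : exists2 Z, natural_on Z &
  forall Z', natural_on Z' ->
    \sum_i ip (Z' i (v i)) (v' i) = \sum_i \sum_a ip (Z' i (hb a)) (Z i (hb a)).
Proof.
have [m [B oB]] : exists m (B : 'I_m -> V), sq_onb f W B.
  apply: (@sq_onb_exists _ _ _ f_sesqform W _ _ _ A (fun a S => (S a)^*)
    (fun a S => S a)) => //.
  - exists (fun i w => 0); split; last first.
      by apply/ffunP => a; rewrite !ffunE ip0r.
    split=> [i c w w'|i j t w]; first by rewrite scaler0 addr0.
    by rewrite (lin0 (emb_lin t)).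
  - move=> c _ _ [Z [[lZ nZ] ->]] [Z' [[lZ' nZ'] ->]].
    exists (fun i w => c *: Z i w + Z' i w); split; last first.
      by apply/ffunP => a; rewrite !ffunE ipDr ipZr.
    split=> [i d w w'|i j t w].
      rewrite lZ lZ' !scalerDr !scalerA (mulrC c) -!addrA; congr (_ + _).
      by rewrite addrCA.
    by rewrite nZ nZ' (emb_lin t).
  - move=> S _ S0; rewrite lt_neqAle; apply/andP; split.
      apply/eqP => /esym /eqP; rewrite psumr_eq0; last first.
        by move=> a _; rewrite mulrC -normCK exprn_ge0.
      move=> /allP h; apply: S0; apply/ffunP => a; rewrite ffunE.
      have := h a; rewrite mem_index_enum /= => /(_ isT).
      by rewrite mulrC -normCK expf_eq0 /= normr_eq0 => /eqP.
    by apply: sumr_ge0 => a _; rewrite mulrC -normCK exprn_ge0.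
(* Matrix coefficients of the rank one operators w -> <v_i, w> v'_i, to be projected onto the
   natural families. *)
pose S : V := [ffun a : A => ip (v (tag a)) (hb (tagged a).1) *
                             ip (hb (tagged a).2) (v' (tag a))].
have [WB _ BE] := oB.
have W0 : W 0.
  exists (fun i w => 0); split; last first.
    by apply/ffunP => a; rewrite !ffunE ip0r.
  split=> [i c w w'|i j t w]; first by rewrite scaler0 addr0.
  by rewrite (lin0 (emb_lin t)).
pose PS := \sum_k f (B k) S *: B k.
have [Z [nZ ZE]] : W PS.
  rewrite /PS; apply: sub_sum => //.
  move=> c _ _ [Z [[lZ nZ] ->]] [Z' [[lZ' nZ'] ->]].
  exists (fun i w => c *: Z i w + Z' i w); split; last first.
    by apply/ffunP => a; rewrite !ffunE ipDr ipZr.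
  split=> [i d w w'|i j t w].
    rewrite lZ lZ' !scalerDr !scalerA (mulrC c) -!addrA; congr (_ + _).
    by rewrite addrCA.
  by rewrite nZ nZ' (emb_lin t).
exists Z => // Z' nZ'; rewrite -f_cf -ZE.
have WZ' : W (cf Z') by exists Z'.
have -> : f (cf Z') PS = f (cf Z') S.
  rewrite (sq_conj f_sesqform) (sq_conj f_sesqform S); congr (_^*).
  rewrite (parseval f_sesqform oB S WZ') /PS (sq_suml f_sesqform).
  apply: eq_bigr => k _; rewrite (sqZl f_sesqform).
  by rewrite -(sq_conj f_sesqform).
rewrite /f.
under [RHS]eq_bigr do rewrite !ffunE -ip_conj.
rewrite (sum_A (fun i a b => ip (Z' i (hb a)) (hb b) *
   (ip (v i) (hb a) * ip (hb b) (v' i)))).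
apply: eq_bigr => i _.
rewrite {1}(onbE (@hbP _ _ H (x i)) (v i)) (lin_sum (nZ'.1 i)) ip_suml.
apply: eq_bigr => a _; rewrite (linZ (nZ'.1 i)) ipZl -ip_conj.
rewrite (ip_parseval (@hbP _ _ H' (x i))) mulr_sumr.
by apply: eq_bigr => b _; rewrite mulrCA.
Qed.

Lemma hrep_exp (y z : T) (w : H y) (u : H z) m (b : 'I_m -> arr z y) :
  sq_onb (@hs _ _ H z y) (fun=> True) b ->
  hrep w u = \sum_a ip (emb_hom H (b a) u) w *: b a.
Proof.
case=> _ _ bE; rewrite {1}(bE (hrep w u)) //.
by apply: eq_bigr => a _; rewrite hrepP.
Qed.

(** Without an integral, positivity in [H'] has to be algebraic. The sum sees the rank one operators
    <v_i, .> v'_i only through pairings with natural families, so they may be replaced, twice, by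
    their projection Z. For natural Z an orthonormal basis of arrows turns the sum into one of
    squared norms. *)
Lemma hrep_psd :
  0 <= \sum_i \sum_j ip (v' i) (emb_hom H' (hrep (v i) (v j)) (v' j)).
Proof.
have [Z [lZ nZ] ZE] := natural_projection.
pose Phi i (w : H (x i)) := \sum_j emb_hom H' (hrep w (v j)) (v' j).
have nPhi : natural_on Phi.
  split=> [i c w w'|i j t w].
    rewrite /Phi scaler_sumr -big_split; apply: eq_bigr => k _ /=.
    by rewrite hrep_linl emb_homP.
  rewrite /Phi (lin_sum (emb_lin t)); apply: eq_bigr => k _.
  by rewrite hrep_nat emb_hom_comp.
pose Y i (w : H (x i)) := \sum_j \sum_a emb_hom H' (hrep w (@hb _ _ H (x j) a)) (Z j (hb a)).
have nY : natural_on Y.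
  split=> [i c w w'|i j t w].
    rewrite /Y scaler_sumr -big_split; apply: eq_bigr => k _ /=.
    rewrite scaler_sumr -big_split; apply: eq_bigr => a _ /=.
    by rewrite hrep_linl emb_homP.
  rewrite /Y (lin_sum (emb_lin t)); apply: eq_bigr => k _.
  rewrite (lin_sum (emb_lin t)); apply: eq_bigr => a _.
  by rewrite hrep_nat emb_hom_comp.
set Q := \sum_i _.
have QE : Q = \sum_i ip (v' i) (Phi i (v i)).
  by apply: eq_bigr => i _; rewrite ip_sumr.
have Q1 : Q = (\sum_i \sum_a ip (Phi i (hb a)) (Z i (hb a)))^*.
  rewrite QE -(ZE _ nPhi) rmorph_sum; apply: eq_bigr => i _ /=.
  by rewrite -ip_conj.
have Q2 : \sum_i \sum_a ip (Phi i (hb a)) (Z i (hb a)) =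
    \sum_j ip (v' j) (Y j (v j)).
  transitivity (\sum_i \sum_a \sum_j
      ip (v' j) (emb_hom H' (hrep (v j) (@hb _ _ H (x i) a)) (Z i (hb a)))).
    apply: eq_bigr => i _; apply: eq_bigr => a _; rewrite ip_suml.
    by apply: eq_bigr => j _; rewrite emb_hom_adj hrep_adj.
  under eq_bigr do rewrite exchange_big.
  rewrite exchange_big; apply: eq_bigr => j _ /=.
  rewrite ip_sumr; apply: eq_bigr => i _ /=.
  by rewrite ip_sumr.
have Q3 : Q = \sum_i \sum_a ip (Y i (hb a)) (Z i (hb a)).
  rewrite Q1 Q2 rmorph_sum -(ZE _ nY); apply: eq_bigr => i _ /=.
  by rewrite -ip_conj.
suff Q4 : 0 <= \sum_i \sum_a ip (Z i (hb a)) (Y i (hb a)).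
  rewrite Q3; suff -> : \sum_i \sum_a ip (Y i (hb a)) (Z i (hb a)) =
    (\sum_i \sum_a ip (Z i (hb a)) (Y i (hb a)))^* by rewrite conjC_ge0.
  rewrite rmorph_sum; apply: eq_bigr => i _ /=.
  by rewrite rmorph_sum; apply: eq_bigr => a _ /=; rewrite -ip_conj.
apply: sumr_ge0 => i _.
under eq_bigr do rewrite ip_sumr.
rewrite exchange_big; apply: sumr_ge0 => j _ /=.
have [m [b ob]] := arr_onb H (x j) (x i).
have -> : \sum_a ip (Z i (hb a)) (\sum_c emb_hom H' (hrep (hb a) (hb c)) (Z j (hb c)))
  = \sum_c \sum_k ip (emb_hom H' (b k) (Z j (hb c))) (emb_hom H' (b k) (Z j (hb c))).
  under eq_bigr do rewrite ip_sumr.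
  rewrite exchange_big; apply: eq_bigr => c _ /=.
  transitivity (\sum_a \sum_k ip (emb_hom H (b k) (hb c)) (hb a) *
      ip (Z i (hb a)) (emb_hom H' (b k) (Z j (hb c)))).
    apply: eq_bigr => a _; rewrite (hrep_exp _ _ ob) (lin_sum (emb_arr_lin _)).
    rewrite ip_sumr; apply: eq_bigr => k _.
    by rewrite (linZ (emb_arr_lin _)) ipZr.
  rewrite exchange_big; apply: eq_bigr => k _ /=.
  rewrite -nZ; move: (emb_hom H _ _) => w; move: {1 3}(Z i w) => u.
  rewrite [in RHS](onbE (@hbP _ _ H (x i)) w) (lin_sum (lZ i)) ip_suml.
  by apply: eq_bigr => a _; rewrite (linZ (lZ i)) ipZl -ip_conj.
by apply: sumr_ge0 => c _; apply: sumr_ge0 => k _; exact: ip_ge0.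
Qed.
End Positivity.

Section Isometries.
Variables (R : realType) (T : drCat R).

Lemma idc_adj (x : T) : cadj (idc x) = idc x.
Proof. exact: (coe_adj erefl). Qed.

Definition isom_arr (x y : T) (t : arr x y) := cadj t ∘ t = idc x.

Lemma isom_coe (x y : T) (e : x = y) : isom_arr (coe e).
Proof. by rewrite /isom_arr coe_adj coeK. Qed.

Lemma isom_sym (x y : T) : isom_arr (sym x y).
Proof. by rewrite /isom_arr sym_adj symK. Qed.

Lemma isom_id (x : T) : isom_arr (idc x).
Proof. exact: (isom_coe erefl). Qed.

Lemma isom_comp (x y z : T) (s : arr y z) (t : arr x y) :
  isom_arr s -> isom_arr t -> isom_arr (s ∘ t).
Proof.
by rewrite /isom_arr => hs ht; rewrite adj_comp -Defs.compA (Defs.compA _ s) hs comp1c.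
Qed.

Lemma isom_tens (x y x' y' : T) (s : arr x y) (t : arr x' y') :
  isom_arr s -> isom_arr t -> isom_arr (s ⊗ t).
Proof.
by rewrite /isom_arr => hs ht; rewrite tens_adj -tens_comp hs ht tens_id.
Qed.

End Isometries.

(** * Tannaka duality *)

Section Kernels.
Variables (R : realType) (T : drCat R) (H H' : embedding T).
Local Notation C := (cplx R).

(* The point (x, v, v') stands for the function W |-> ip v' (W v) on the
   natural unitaries W : H -> H', and a kernel for the sesquilinear form
   (p, q) |-> \int p(W) q(W)^* dW of a probability measure dW on them. *)
Record pt := Pt { pt_o : T; pt_v : H pt_o; pt_w : H' pt_o }.

Definition pmul (p q : pt) :=
  Pt (emb_tens (pt_v p) (pt_v q)) (emb_tens (pt_w p) (pt_w q)).
Definition pone := Pt (emb_unit : H unitO) (emb_unit : H' unitO).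
Definition pscale c (p : pt) := Pt (c *: pt_v p) (pt_w p).

Local Notation "p ** q" := (pmul p q) (at level 39, left associativity).

(** Positivity is tested without coefficients; these can be absorbed into the points by [pscale]. *)
Definition ksum (k : pt -> pt -> C) (s : seq pt) := \sum_(p <- s) \sum_(q <- s) k p q.

(** The fields are properties of the measure read on coefficients: [k_nat] is naturality of W,
    [k_one] is total mass 1, [k_unitaryr] and [k_unitaryl] are W W^* = 1 and W^* W = 1. The
    spectator factors p and q make the last two hold as identities of functions and not only in
    mean. *)
Record pdkernel (k : pt -> pt -> C) : Prop := PDKernel {
  k_lin : forall x c (v w : H x) (v' : H' x) q,
    k (Pt (c *: v + w) v') q = c * k (Pt v v') q + k (Pt w v') q;
  k_antilin : forall x c (v : H x) (v' w' : H' x) q,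
    k (Pt v (c *: v' + w')) q = c^* * k (Pt v v') q + k (Pt v w') q;
  k_herm : forall p q, k q p = (k p q)^*;
  k_nat : forall (x y : T) (t : arr x y) v v' q,
    k (Pt (emb_hom H t v) v') q = k (Pt v (emb_hom H' (cadj t) v')) q;
  k_psd : forall s, 0 <= ksum k s;
  k_one : k pone pone = 1;
  k_unitaryr : forall p q z (w' w'' : H' z),
    \sum_a k (p ** Pt (hb a) w') (q ** Pt (hb a) w'') = ip w' w'' * k p q;
  k_unitaryl : forall p q z (w1 w2 : H z),
    \sum_a k (p ** Pt w1 (hb a)) (q ** Pt w2 (hb a)) = ip w2 w1 * k p q
}.

(** The arrow [hrep] averages g v (g w)^* in [H]; its image under [H'] stands for the average of W v
    (W w)^* over the natural unitaries W. *)
Definition haar (p q : pt) : C :=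
  ip (pt_w p) (emb_hom H' (hrep (pt_v p) (pt_v q)) (pt_w q)).

Lemma haar_kernel : pdkernel haar.
Proof.
split.
- by move=> x c v w v' q; rewrite /haar /= hrep_linl emb_homP ipDr ipZr.
- by move=> x c v v' w' q; rewrite /haar /= ipDl ipZl.
- by move=> p q; rewrite /haar -hrep_adj emb_adjr adjK ip_conj.
- by move=> x y t v v' q; rewrite /haar /= hrep_nat emb_hom_comp emb_adjr.
- move=> s; rewrite /ksum big_tnth; under eq_bigr do rewrite big_tnth.
  exact: (@hrep_psd _ _ _ _ _ (fun i => pt_o (tnth (in_tuple s) i))
    (fun i => pt_v (tnth (in_tuple s) i)) (fun i => pt_w (tnth (in_tuple s) i))).
- by rewrite /haar /= hrep_unit emb_hom_id emb_unit_ip.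
- move=> p q z w' w''; rewrite /haar /= -ip_sumr -(lin_sum (emb_arr_lin _)).
  by rewrite hrep_tens ?emb_tensH ?emb_hom_id ?emb_tens_ip 1?mulrC //; exact: hbP.
- by move=> p q z w1 w2; rewrite /haar /= hrep_ptr //; exact: hbP.
Qed.

Section KernelTheory.
Variables (k : pt -> pt -> C) (kk : pdkernel k).

Lemma k_linear x (v' : H' x) q : linear (fun v : H x => k (Pt v v') q : C^o).
Proof. by move=> c v w; rewrite k_lin. Qed.

Lemma k_conj_linear x (v : H x) q : linear (fun v' : H' x => (k (Pt v v') q)^* : C^o).
Proof. by move=> c v' w'; rewrite k_antilin // rmorphD rmorphM /= conjCK. Qed.

Lemma k_scale c p q : k (pscale c p) q = c * k p q.
Proof. by case: p => x v v'; rewrite /pscale /= (linZ (k_linear v' q)). Qed.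

Lemma k_scaler c p q : k p (pscale c q) = c^* * k p q.
Proof. by rewrite k_herm // k_scale rmorphM /= -k_herm. Qed.

Lemma k_iso (x y : T) (t : arr x y) v v' q : isom_arr t ->
  k (Pt (emb_hom H t v) (emb_hom H' t v')) q = k (Pt v v') q.
Proof. by move=> it; rewrite k_nat // -emb_hom_comp it emb_hom_id. Qed.

(** Coefficient functions commute, by naturality with respect to the symmetry. This moves a tilting
    factor past a basis factor. *)
Lemma k_swap p s u q : k (p ** s ** u) q = k (p ** u ** s) q.
Proof.
case: p s u => x v v' [y w w'] [z r r'].
pose t := coe (tensOA x z y) ∘ (idc x ⊗ sym y z) ∘ coe (esym (tensOA x y z)).
rewrite -(@k_iso _ _ t) /=.
  rewrite !emb_hom_comp !emb_assoc' !emb_tensH !emb_hom_id !emb_sym.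
  by rewrite !emb_tensA.
apply: isom_comp; last exact: isom_coe.
apply: isom_comp; first exact: isom_coe.
by apply: isom_tens; [exact: isom_id|exact: isom_sym].
Qed.

Lemma k_mul1 p q : k (pone ** p) q = k p q.
Proof.
case: p => x v v'; rewrite -(@k_iso _ _ (coe (tensO1l x))) /= ?emb_tens1l //.
exact: isom_coe.
Qed.

Lemma k_herm2 p q p' q' : k q p = k q' p' -> k p q = k p' q'.
Proof. by move=> E; rewrite k_herm // E -k_herm. Qed.

Lemma ksum_ge0 s (F G : pt -> pt) :
  0 <= \sum_(p <- s) \sum_(q <- s)
    (k (F p) (F q) + k (F p) (G q) + k (G p) (F q) + k (G p) (G q)).
Proof.
have := k_psd kk ([seq F p | p <- s] ++ [seq G p | p <- s]).
rewrite /ksum big_cat /= !big_map; congr (0 <= _).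
rewrite -big_split; apply: eq_bigr => p _ /=.
rewrite !big_cat !big_map /= -!big_split /=; apply: eq_bigr => q _ /=.
by rewrite !addrA.
Qed.

Lemma k_diag_ge0 p : 0 <= k p p.
Proof. by have := k_psd kk [:: p]; rewrite /ksum !big_seq1. Qed.

(** The functions |<w', W e_a>|^2 over a basis e_a add up to |w'|^2, at most 1; each is therefore at
    most 1 as a multiplier. *)
Lemma k_basis_le s z (i : 'I_(hdim H z)) (w' : H' z) : `|w'| <= 1 ->
  \sum_(p <- s) \sum_(q <- s) k (p ** Pt (hb i) w') (q ** Pt (hb i) w')
  <= ksum k s.
Proof.
move=> w1.
have h : \sum_a \sum_(p <- s) \sum_(q <- s) k (p ** Pt (hb a) w') (q ** Pt (hb a) w')
   = `|w'| ^+ 2 * ksum k s.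
  rewrite exchange_big mulr_sumr; apply: eq_bigr => p _ /=.
  rewrite exchange_big mulr_sumr; apply: eq_bigr => q _ /=.
  by rewrite k_unitaryr // ip_norm.
apply: (@le_trans _ _ (`|w'| ^+ 2 * ksum k s)); last first.
  by rewrite ler_piMl ?k_psd // exprn_ile1.
rewrite -h (bigD1 i) //= lerDl; apply: sumr_ge0 => a _.
have := k_psd kk [seq p ** Pt (hb a) w' | p <- s].
by rewrite /ksum big_map; under eq_bigr do rewrite big_map.
Qed.

Lemma k_basis_diag z (i : 'I_(hdim H z)) (w' : H' z) :
  k (Pt (hb i) w') (Pt (hb i) w') <= `|w'| ^+ 2.
Proof.
have h := k_unitaryr kk pone pone w' w'.
rewrite ip_norm k_one // mulr1 in h; rewrite -h (bigD1 i) //= k_mul1.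
rewrite (k_herm2 (k_mul1 _ _)) lerDl; apply: sumr_ge0 => a _; exact: k_diag_ge0.
Qed.

Lemma k_cauchy p q : `|k p q| <= k p p + k q q.
Proof.
have [->|n0] := eqVneq (k p q) 0; first by rewrite normr0 addr_ge0 ?k_diag_ge0.
(* The phase that makes both cross terms equal to -|k p q|. *)
pose c := - (`|k p q| / k p q).
have c1 : c^* * c = 1.
  by rewrite mulrC -normCK normrN normrM normfV normr_id divff ?expr1n // normr_eq0.
have := k_psd kk [:: pscale c p; q].
rewrite /ksum !big_cons !big_nil !addr0 !k_scale !k_scaler (k_herm kk p q).
rewrite [c * (_ * _)]mulrA [c * c^*]mulrC c1 mul1r.
have -> : c * k p q = - `|k p q| by rewrite mulNr divfK.
have -> : c^* * (k p q)^* = - `|k p q|.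
  by rewrite -rmorphM /= mulNr divfK // rmorphN /= geC0_conj.
move=> h; apply: (@le_trans _ _ (`|k p q| + `|k p q|)); first by rewrite lerDl.
by rewrite -subr_ge0; move: h; congr (0 <= _); ring.
Qed.

(** A bound that does not involve the kernel: it places all kernels in one product of compact
    squares. Only the first components are expanded in a basis, since [k_basis_diag] controls
    arbitrary second components. *)
Definition kbound (p q : pt) : C :=
  \sum_a \sum_b `|ip (hb a) (pt_v p)| * `|ip (hb b) (pt_v q)| *
     (`|pt_w p| ^+ 2 + `|pt_w q| ^+ 2).

Lemma k_bounded p q : `|k p q| <= kbound p q.
Proof.
case: p q => x v v' [y w w'].
have -> : k (Pt v v') (Pt w w') = \sum_a \sum_b ip (hb a) v * ((ip (hb b) w)^* *
    k (Pt (hb a) v') (Pt (hb b) w')).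
  rewrite {1}(onbE (@hbP _ _ H x) v) (lin_sum (k_linear _ _)).
  apply: eq_bigr => a _; rewrite (linZ (k_linear _ _)) -mulr_sumr; congr (_ * _).
  rewrite k_herm // {1}(onbE (@hbP _ _ H y) w) (lin_sum (k_linear _ _)) rmorph_sum.
  apply: eq_bigr => b _ /=.
  by rewrite (linZ (k_linear _ _)) rmorphM /= -k_herm.
apply: (le_trans (ler_norm_sum _ _ _)); apply: ler_sum => a _.
apply: (le_trans (ler_norm_sum _ _ _)); apply: ler_sum => b _ /=.
rewrite !normrM norm_conjC mulrA ler_wpM2l ?mulr_ge0 //.
apply: (le_trans (k_cauchy _ _)); apply: lerD; exact: k_basis_diag.
Qed.

End KernelTheory.

(** Says that |u|^2 is at most 1/4 as a multiplier, for every kernel. Any constant above 1 would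
    make 1 + Re u a nonnegative density of positive mass; 4 is what halved basis vectors give. *)
Definition small (u : pt) := forall k, pdkernel k -> forall s,
  4 * (\sum_(p <- s) \sum_(q <- s) k (p ** u) (q ** u)) <= ksum k s.

Lemma small_basis z (i : 'I_(hdim H z)) (w' : H' z) (c : C) :
  `|c| <= 2^-1 -> `|w'| <= 1 -> small (Pt (c *: hb i) w').
Proof.
move=> hc hw k kk s.
have E p q : k (p ** Pt (c *: hb i) w') (q ** Pt (c *: hb i) w') =
    `|c| ^+ 2 * k (p ** Pt (hb i) w') (q ** Pt (hb i) w').
  rewrite normCK -mulrA -(k_scaler kk) -(k_scale kk) /pscale /=.
  by rewrite -!(linZ (emb_tens_linr _)).
under eq_bigr do under eq_bigr do rewrite E.
under eq_bigr do rewrite -mulr_sumr.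
rewrite -mulr_sumr mulrA; apply: le_trans (k_basis_le kk s i hw).
have := k_psd kk [seq p ** Pt (hb i) w' | p <- s].
rewrite /ksum big_map; under eq_bigr do rewrite big_map.
move=> h; apply: ler_piMl => //.
apply: (@le_trans _ _ (4 * 2^-1 ^+ 2)).
  by rewrite ler_pM2l ?ltr0n // lerXn2r ?nnegrE // invr_ge0.
have -> : (4 : C) = 2 ^+ 2 by rewrite -natrX.
by rewrite -exprMn divff ?expr1n // pnatr_eq0.
Qed.

(** The kernel of the measure reweighted by 1 + Re u, before normalization. *)
Definition tilt (k : pt -> pt -> C) u p q :=
  k p q + (k (p ** u) q + k p (q ** u)) / 2.

Section Tilts.
Variables (k : pt -> pt -> C) (kk : pdkernel k) (u : pt) (su : small u).

Lemma k_two s (c : C) : c^* = c ->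
  0 <= \sum_(p <- s) \sum_(q <- s) (k p q + c * (k (p ** u) q + k p (q ** u))
    + c * c * k (p ** u) (q ** u)).
Proof.
move=> rc; have := ksum_ge0 kk s id (fun p => pscale c (p ** u)).
congr (0 <= _); apply: eq_bigr => p _; apply: eq_bigr => q _.
rewrite /= !(k_scale kk) !(k_scaler kk) ?(k_scale kk) rc.
ring.
Qed.

(** 1 + Re u = (|1 + u|^2 + (1 - |u|^2)) / 2, and both terms are nonnegative multipliers. *)
Lemma tilt_psd s : 0 <= ksum (tilt k u) s.
Proof.
have h2 : (2 : C) != 0 by rewrite pnatr_eq0.
pose t := \sum_(p <- s) \sum_(q <- s) k (p ** u) (q ** u).
have -> : ksum (tilt k u) s = 2^-1 * (\sum_(p <- s) \sum_(q <- s)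
    (k p q + 1 * (k (p ** u) q + k p (q ** u)) + 1 * 1 * k (p ** u) (q ** u)))
    + 2^-1 * (ksum k s - t).
  rewrite -mulrDr /t /ksum -sumrB -big_split mulr_sumr /=; apply: eq_bigr => p _.
  rewrite -sumrB -big_split mulr_sumr /=; apply: eq_bigr => q _; rewrite /tilt.
  by field.
have t0 : 0 <= t.
  have := k_psd kk [seq p ** u | p <- s].
  by rewrite /ksum big_map; under eq_bigr do rewrite big_map.
have h21 : 0 <= (2 : C)^-1 by rewrite invr_ge0.
apply: addr_ge0; apply: mulr_ge0 => //; first by apply: k_two; rewrite conjC1.
rewrite subr_ge0; apply: le_trans (su kk s); rewrite -/t.
by rewrite ler_peMl // ler1n.
Qed.

Lemma tilt_gt0 : 0 < tilt k u pone pone.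
Proof.
have t0 := k_diag_ge0 kk (pone ** u).
have := k_two [:: pone] (conjC1 _); rewrite !big_seq1 !mul1r => h.
have := su kk [:: pone]; rewrite /ksum !big_seq1 k_one // => h4.
rewrite k_one // in h.
have h2 : (2 : C) != 0 by rewrite pnatr_eq0.
have -> : tilt k u pone pone = 2^-1 * (1 + (k (pone ** u) pone + k pone (pone ** u)) +
     k (pone ** u) (pone ** u)) + 2^-1 * (1 - k (pone ** u) (pone ** u)).
  by rewrite /tilt k_one //; field.
apply: ltr_wpDl; first by rewrite mulr_ge0 // invr_ge0.
rewrite mulr_gt0 ?invr_gt0 // subr_gt0.
rewrite -(@ltr_pM2l _ 4) ?ltr0n // mulr1; apply: (le_lt_trans h4).
by rewrite ltr1n.
Qed.

Lemma tilt_kernel : pdkernel (fun p q => tilt k u p q / tilt k u pone pone).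
Proof.
have l0 := tilt_gt0; have ln := lt0r_neq0 l0.
have lr : (tilt k u pone pone)^* = tilt k u pone pone by rewrite geC0_conj // ltW.
have tp := tilt_psd.
case: u su l0 ln lr tp => z w w'; set u0 := Pt w w' => su' l0 ln lr tp.
split.
- move=> x c v1 v2 v' q; rewrite /tilt /pmul /= (linD (emb_tens_linl w)).
  by rewrite (linZ (emb_tens_linl w)) !k_lin //; ring.
- move=> x c v v1 v2 q; rewrite /tilt /pmul /= (linD (emb_tens_linl w')).
  by rewrite (linZ (emb_tens_linl w')) !k_antilin //; ring.
- move=> p q; rewrite rmorphM fmorphV /= lr; congr (_ / _).
  rewrite /tilt rmorphD rmorphM rmorphD fmorphV /= -!k_herm // conjC_nat.
  by rewrite [in X in _ + X]addrC.
- move=> x y t v v' q; congr (_ / _); rewrite /tilt k_nat //; congr (_ + (_ + _) / _).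
    rewrite /pmul /= -{1}[w](emb_hom_id (e := H)) -emb_tensH k_nat // tens_adj.
    by rewrite emb_tensH idc_adj emb_hom_id.
  by rewrite k_nat.
- move=> s; have := tp s; rewrite /ksum => h.
  under eq_bigr do rewrite -mulr_suml.
  by rewrite -mulr_suml mulr_ge0 // invr_ge0 ltW.
- by rewrite divff.
- move=> p q x v' v''; rewrite -mulr_suml mulrA; congr (_ / _).
  rewrite /tilt big_split /= -mulr_suml big_split /= mulrDr; congr (_ + _).
    exact: k_unitaryr.
  rewrite mulrA; congr (_ / _); rewrite mulrDr; congr (_ + _).
    under eq_bigr do rewrite k_swap //; exact: k_unitaryr.
  under eq_bigr => a _ do rewrite (k_herm2 kk (k_swap kk _ _ _ _)); exact: k_unitaryr.
- move=> p q x v1 v2; rewrite -mulr_suml mulrA; congr (_ / _).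
  rewrite /tilt big_split /= -mulr_suml big_split /= mulrDr; congr (_ + _).
    exact: k_unitaryl.
  rewrite mulrA; congr (_ / _); rewrite mulrDr; congr (_ + _).
    under eq_bigr do rewrite k_swap //; exact: k_unitaryl.
  under eq_bigr => a _ do rewrite (k_herm2 kk (k_swap kk _ _ _ _)); exact: k_unitaryl.
Qed.

End Tilts.

End Kernels.

(** * Extremal kernels are multiplicative *)

Section Extremal.
Variables (R : realType) (T : drCat R) (H H' : embedding T).
Local Notation C := (cplx R).
Local Notation pt := (pt H H').
Local Notation pone := (pone H H').
Local Notation "p ** q" := (pmul p q) (at level 39, left associativity).

Lemma pmul_scale c (p u : pt) : p ** pscale c u = pscale c (p ** u).
Proof. by rewrite /pmul /pscale /= (linZ (emb_tens_linr _)). Qed.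

Definition twice_re (z : C) : C := z + z^*.

Lemma twice_re_lin (l : C) z : l^* = l -> twice_re (l * z) = l * twice_re z.
Proof. by move=> rl; rewrite /twice_re rmorphM /= rl mulrDr. Qed.

(** [linval] is the functional to be minimized. [sqval], strictly convex in the values on F, is then
    maximized to single out extreme points among the minimizers. *)
Definition linval (ps : seq (pt * pt)) (k : pt -> pt -> C) :=
  \sum_(p <- ps) twice_re (k p.1 p.2).
Definition sqval (F : seq pt) (k : pt -> pt -> C) := \sum_(j <- F) `|k j pone| ^+ 2.

Variables (k : pt -> pt -> C) (kk : pdkernel k) (ps : seq (pt * pt)) (F : seq pt).
Hypothesis k_min : forall k', pdkernel k' -> linval ps k <= linval ps k'.
Hypothesis k_max : forall k', pdkernel k' -> linval ps k' = linval ps k ->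
  sqval F k' <= sqval F k.

Let two0 : (2 : C) != 0. Proof. by rewrite pnatr_eq0. Qed.

Lemma convex_zero (l m a b c : C) : 0 < l -> 0 < m -> l + m = 2 ->
  l * b + m * c = 2 * a -> a <= b -> a <= c -> b = a /\ c = a.
Proof.
move=> l0 m0 lm E ab ac.
have : l * (b - a) + m * (c - a) = 0.
  by rewrite !mulrBr addrACA -opprD -mulrDl lm E subrr.
move/eqP; rewrite paddr_eq0 ?mulr_ge0 ?subr_ge0 ?(ltW l0) ?(ltW m0) // !mulf_eq0.
by rewrite (gt_eqF l0) (gt_eqF m0) !subr_eq0 => /andP[/eqP -> /eqP ->].
Qed.

(* The two tilts of k by u and -u have k as a convex combination, so that by
   strict convexity of [sqval] both agree with k on F. *)
Lemma extremal_tilt (u : pt) : small u -> small (pscale (-1) u) ->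
  forall j, j \in [pred x | has (fun y => `[< x = y >]) F] ->
    tilt k u j pone = tilt k u pone pone * k j pone.
Proof.
move=> su su'; set u' := pscale _ u in su'.
have l0 := tilt_gt0 kk su; have m0 := tilt_gt0 kk su'.
set l := tilt k u pone pone in l0 *; set m := tilt k u' pone pone in m0.
have cl : l^* = l by rewrite geC0_conj // ltW.
have cm : m^* = m by rewrite geC0_conj // ltW.
have kp := tilt_kernel kk su; have km := tilt_kernel kk su'.
rewrite -/l -/m in kp km.
set kl := (fun p q => _) in kp; set kr := (fun p q => _) in km.
have tE p q : tilt k u p q + tilt k u' p q = 2 * k p q.
  rewrite /tilt /u' !pmul_scale (k_scale kk) (k_scaler kk) rmorphN /= conjC1.
  by field.
have lm : l + m = 2 by rewrite tE (k_one kk) mulr1.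
have kE p q : l * kl p q + m * kr p q = 2 * k p q.
  by rewrite /kl /kr ![_ * (_ / _)]mulrC !divfK ?gt_eqF // tE.
have [Ll Lr] : linval ps kl = linval ps k /\ linval ps kr = linval ps k.
  apply: (convex_zero l0 m0 lm) => //; try exact: k_min.
  rewrite /linval !mulr_sumr -big_split; apply: eq_bigr => p _ /=.
  by rewrite -!twice_re_lin ?conjC_nat // -kE /twice_re !rmorphD /= addrACA.
have h : \sum_(j <- F) (l * `|kl j pone - k j pone| ^+ 2 +
    m * `|kr j pone - k j pone| ^+ 2) <= 0.
  (* Since l b + m c = 2 a and l + m = 2, the weighted squared distances to the mean a equal the
     weighted differences of squares. *)
  have -> : \sum_(j <- F) (l * `|kl j pone - k j pone| ^+ 2 +
      m * `|kr j pone - k j pone| ^+ 2) =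
      l * (sqval F kl - sqval F k) + m * (sqval F kr - sqval F k).
    rewrite /sqval -!sumrB !mulr_sumr -big_split; apply: eq_bigr => j _ /=.
    have e1 := kE j pone.
    have e2 : l * (kl j pone)^* + m * (kr j pone)^* = 2 * (k j pone)^*.
      by rewrite -[in LHS]cl -[in LHS]cm -!rmorphM -rmorphD /= e1 rmorphM /= conjC_nat.
    rewrite !normCK !rmorphB /=; move: e1 e2 lm.
    move: (kl j pone) (kr j pone) (k j pone) => b c a.
    move: (b^*) (c^*) (a^*) => b' c' a' e1 e2 e3.
    have e4 : a * (l * b' + m * c') = a * (2 * a') by rewrite e2.
    have e5 : a' * (l * b + m * c) = a' * (2 * a) by rewrite e1.
    have e6 : a * a' * (l + m) = a * a' * 2 by rewrite e3.
    transitivity (l * (b * b' - a * a') + m * (c * c' - a * a') +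
      (2 * (a * a' * (l + m)) - a' * (l * b + m * c) - a * (l * b' + m * c'))).
      by ring.
    by rewrite e4 e5 e6; ring.
  by rewrite -[0]addr0; apply: lerD; rewrite pmulr_rle0 // subr_le0; exact: k_max.
have p0 j : 0 <= l * `|kl j pone - k j pone| ^+ 2 + m * `|kr j pone - k j pone| ^+ 2.
  by rewrite addr_ge0 // mulr_ge0 ?exprn_ge0 // ltW.
have E0 : \sum_(j <- F) (l * `|kl j pone - k j pone| ^+ 2 +
    m * `|kr j pone - k j pone| ^+ 2) == 0.
  by rewrite eq_le h sumr_ge0.
move=> j; rewrite inE => jF.
suff : kl j pone = k j pone.
  by rewrite /kl => /(congr1 ( *%R^~ l)) /=; rewrite divfK ?gt_eqF // mulrC.
apply/eqP; rewrite -subr_eq0 -normr_eq0 -sqrf_eq0.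
have : l * `|kl j pone - k j pone| ^+ 2 + m * `|kr j pone - k j pone| ^+ 2 == 0.
  elim: F jF E0 => //= x s IH; rewrite big_cons paddr_eq0 ?sumr_ge0 //.
  by case/orP => [/asboolP -> /andP[]//|/IH h' /andP[_ /h']].
rewrite paddr_eq0 ?mulr_ge0 ?exprn_ge0 ?(ltW l0) ?(ltW m0) //.
by rewrite mulf_eq0 (gt_eqF l0) => /andP[].
Qed.

(** The identity for the tilt by c u has the form c A + c^* B = 0; the phases c = 1 and c = i
    separate A from B. *)
Lemma extremal_mul (u : pt) : (forall c, `|c| = 1 -> small (pscale c u)) ->
  forall j, j \in [pred x | has (fun y => `[< x = y >]) F] ->
    k (j ** u) pone = k j pone * k u pone /\ k j u = k j pone * (k u pone)^*.
Proof.
move=> su j jF.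
have key (c : C) : `|c| = 1 ->
    c * k (j ** u) pone + c^* * k j u = k j pone * (c * k u pone + c^* * (k u pone)^*).
  move=> c1; have su' : small (pscale (-1) (pscale c u)).
    have -> : pscale (-1) (pscale c u) = pscale (- c) u.
      by rewrite /pscale /= scalerA mulN1r.
    by apply: su; rewrite normrN.
  have := extremal_tilt (su c c1) su' jF.
  rewrite /tilt !pmul_scale !(k_scale kk) !(k_scaler kk) (k_one kk).
  rewrite !(k_herm2 kk (k_mul1 kk _ _)) (k_mul1 kk) (k_herm kk u pone).
  rewrite [RHS]mulrDl mul1r => /addrI /(congr1 ( *%R^~ 2)).
  by rewrite divfK // => ->; field.
have e1 := key 1 (normr1 _); have e2 := key 'i (normCi _).
rewrite conjC1 !mul1r in e1; rewrite conjCi !mulNr -!mulrBr in e2.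
have i0 : ('i : C) != 0 by rewrite neq0Ci.
have e3 : k (j ** u) pone - k j u = k j pone * (k u pone - (k u pone)^*).
  by apply: (mulfI i0); rewrite e2 mulrCA.
split; apply: (mulfI two0).
  have -> : 2 * k (j ** u) pone = (k (j ** u) pone + k j u) + (k (j ** u) pone - k j u) by ring.
  by rewrite e1 e3; ring.
have -> : 2 * k j u = (k (j ** u) pone + k j u) - (k (j ** u) pone - k j u) by ring.
by rewrite e1 e3; ring.
Qed.

End Extremal.

(** * Topology of the complex numbers and passage to the limit *)

Section ComplexTopology.
Variable R : realType.
Local Notation C := (cplx R).
Local Notation Re := (@complex.Re R).
Local Notation Im := (@complex.Im R).

Definition mkc (a b : R) : C := Complex a b.

Lemma real_cplx (e : C) : 0 < e -> e = (real_complex R (Re e) : C) /\ 0 < Re e.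
Proof. by case: e => a b; rewrite ltcE /= => /andP[/eqP -> h]. Qed.

Lemma norm_mkc (a b : R) : `|mkc a b| <= (real_complex R (`|a| + `|b|) : C).
Proof.
rewrite /mkc normc_def lecR /=.
rewrite -[leRHS]ger0_norm ?addr_ge0 // -sqrtr_sqr ler_wsqrtr // sqrrD.
rewrite !real_normK ?num_real // lerD2r lerDl.
by rewrite mulrn_wge0 // mulr_ge0.
Qed.

Lemma norm_Re (z : C) : `|Re z| <= Re `|z|.
Proof. by have := normc_ge_Re z; rewrite normc_def lecR. Qed.

Lemma norm_Im (z : C) : `|Im z| <= Re `|z|.
Proof.
rewrite normc_def /= -sqrtr_sqr ler_wsqrtr // lerDr.
by rewrite sqr_ge0.
Qed.

Lemma mkc_continuous : continuous (fun p : R * R => mkc p.1 p.2).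
Proof.
move=> [a b]; apply/cvgrPdist_lt => /= e /real_cplx [-> e0].
have e2 : 0 < Re e / 2 by rewrite divr_gt0.
have ca : p.1 @[p --> (a, b)] --> a by exact: cvg_fst.
have cb : p.2 @[p --> (a, b)] --> b by exact: cvg_snd.
move/cvgrPdist_lt : ca => /(_ _ e2) ca; move/cvgrPdist_lt : cb => /(_ _ e2) cb.
have ca' : nbhs (a, b) [set p : R * R | `|a - p.1| < Re e / 2] by exact: ca.
have cb' : nbhs (a, b) [set p : R * R | `|b - p.2| < Re e / 2] by exact: cb.
apply: filterS2 ca' cb' => -[a' b'] /= h1 h2.
have -> : mkc a b - mkc a' b' = mkc (a - a') (b - b') by [].
apply: (le_lt_trans (norm_mkc _ _)).
by rewrite ltcR (splitr (Re e)) ltrD.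
Qed.

Lemma cReB (z w : C) : Re z - Re w = Re (z - w).
Proof. by case: z w => [a b] [c d]. Qed.

Lemma cImB (z w : C) : Im z - Im w = Im (z - w).
Proof. by case: z w => [a b] [c d]. Qed.

Lemma Re_continuous : continuous (Re : C -> R).
Proof.
move=> z; have FF : Filter (nbhs (z : C)) by exact: nbhs_filter.
apply/(@cvgrPdist_lt _ _ _ (nbhs (z : C)) FF) => /= e e0.
have e0' : 0 < (real_complex R e : C) by rewrite ltcR.
apply/nbhs_ballP; exists (real_complex R e) => // w /= h.
rewrite cReB; apply: (le_lt_trans (norm_Re (z - w))).
by move: h; rewrite normc_def ltcR.
Qed.

Definition cbox (m : R) : set C :=
  (fun p : R * R => mkc p.1 p.2) @` (`[- m, m] `*` `[- m, m]).

Lemma cbox_compact m : compact (cbox m).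
Proof.
apply: continuous_compact; last by apply: compact_setX; exact: segment_compact.
exact/continuous_subspaceT/mkc_continuous.
Qed.

Lemma cboxP (m : R) (z : C) : `|z| <= (real_complex R m : C) -> cbox m z.
Proof.
move=> h; have h' : Re `|z| <= m by move: h; rewrite normc_def lecR.
exists (Re z, Im z); last by case: z {h h'}.
by split; rewrite /= in_itv /= -ler_norml; apply: le_trans h';
  [exact: norm_Re|exact: norm_Im].
Qed.

Section Limits.
Context (T : Type) (F : set_system T) {FF : ProperFilter F}.
Implicit Types (f g : T -> C).

Lemma cvg_eq_lim (A : set T) f g (a b : C) : F A ->
  f @ F --> a -> g @ F --> b -> (forall x, A x -> f x = g x) -> a = b.
Proof.
move=> FA /cvgrPdist_lt cf /cvgrPdist_lt cg E.
apply/eqP; rewrite -subr_eq0 -normr_eq0; apply: contraT => ab.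
have e0 : 0 < `|a - b| / 2 by rewrite divr_gt0 // lt_neqAle eq_sym ab /=.
have [x [[h1 h2] h3]] := filter_ex (filterI (filterI (cf _ e0) (cg _ e0)) FA).
have : `|a - b| < `|a - b|.
  rewrite {1}(_ : a - b = (a - f x) - (b - g x)); last by rewrite E //; ring.
  by apply: (le_lt_trans (ler_normB _ _)); rewrite [ltRHS]splitr ltrD.
by rewrite ltxx.
Qed.

Lemma cvg_ge0_lim (A : set T) f (a : C) : F A ->
  f @ F --> a -> (forall x, A x -> 0 <= f x) -> 0 <= a.
Proof.
move=> FA cf ge0; suff -> : a = `|a| by [].
apply: (cvg_eq_lim FA cf (g := fun x => `|f x|)) => [|x /ge0 h].
  exact: cvg_norm cf.
by rewrite ger0_norm.
Qed.

Lemma cvg_conjC f (a : C) : f @ F --> a -> (f x)^* @[x --> F] --> a^*.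
Proof.
move=> /cvgrPdist_lt cf; apply/cvgrPdist_lt => e e0.
apply: filterS (cf e e0) => x /=.
by rewrite -rmorphB norm_conjC.
Qed.

Lemma cvg_Re f (a : C) : f @ F --> a -> Re (f x) @[x --> F] --> Re a.
Proof.
move=> cf; apply: (@cvg_comp T C R f Re F (nbhs (a : C)) (nbhs (Re a)) cf).
exact: Re_continuous.
Qed.

Lemma cvg_bigsum (I : Type) (r : seq I) (f : I -> T -> C) (a : I -> C) :
  (forall i, f i @ F --> a i) ->
  (\sum_(i <- r) f i x) @[x --> F] --> \sum_(i <- r) a i.
Proof.
move=> cf; elim: r => [|i r IH].
  rewrite big_nil; under eq_fun do rewrite big_nil.
  exact: cvg_cst.
rewrite big_cons; under eq_fun do rewrite big_cons.
exact: (cvgD (cf i) IH).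
Qed.

End Limits.
End ComplexTopology.

HB.instance Definition _ (R : realType) (T : drCat R) (H H' : embedding T) :=
  gen_eqMixin (pt H H').
HB.instance Definition _ (R : realType) (T : drCat R) (H H' : embedding T) :=
  gen_choiceMixin (pt H H').

(** * Compactness of the set of kernels *)

Section KernelSpace.
Variables (R : realType) (T : drCat R) (H H' : embedding T).
Local Notation C := (cplx R).
Local Notation pt := (pt H H').
Local Notation pone := (pone H H').
Local Notation "p ** q" := (pmul p q) (at level 39, left associativity).

Definition kspace := prod_topology (fun _ : pt * pt => C : topologicalType).

HB.instance Definition _ := Topological.on kspace.
HB.instance Definition _ := isPointed.Build kspace (fun _ => 0).

Definition cur (g : kspace) : pt -> pt -> C := fun p q => g (p, q).
Definition uncur (k : pt -> pt -> C) : kspace := fun i => k i.1 i.2.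

Definition kset : set kspace := [set g | pdkernel (cur g)].

Section Limits.
Context (F : set_system kspace) {FF : ProperFilter F} (g : kspace).
Hypothesis Fg : F --> g.

Lemma cur_cvg p q : cur h p q @[h --> F] --> cur g p q.
Proof. exact: (@proj_cvg _ (fun=> C : topologicalType) F _ g (p, q) Fg). Qed.

Lemma linval_cvg ps : linval ps (cur h) @[h --> F] --> linval ps (cur g).
Proof.
apply: cvg_bigsum => p; rewrite /twice_re.
exact: (cvgD (@cur_cvg _ _) (cvg_conjC (@cur_cvg _ _))).
Qed.

Lemma sqval_cvg js : sqval js (cur h) @[h --> F] --> sqval js (cur g).
Proof.
apply: cvg_bigsum => j; rewrite expr2; under eq_fun do rewrite expr2.
exact: (cvgM (cvg_norm (@cur_cvg _ _)) (cvg_norm (@cur_cvg _ _))).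
Qed.

Lemma kset_lim : F kset -> kset g.
Proof.
move=> FK; split.
- move=> x c v w v' q; apply: (cvg_eq_lim FK (@cur_cvg _ _) (g := fun h =>
    c * cur h (Pt v v') q + cur h (Pt w v') q)).
    exact: (cvgD (cvgM (cvg_cst _) (@cur_cvg _ _)) (@cur_cvg _ _)).
  by move=> h [].
- move=> x c v v' w' q; apply: (cvg_eq_lim FK (@cur_cvg _ _) (g := fun h =>
    c^* * cur h (Pt v v') q + cur h (Pt v w') q)).
    exact: (cvgD (cvgM (cvg_cst _) (@cur_cvg _ _)) (@cur_cvg _ _)).
  by move=> h [].
- move=> p q; apply: (cvg_eq_lim FK (@cur_cvg _ _) (cvg_conjC (@cur_cvg _ _))).
  by move=> h [].
- move=> x y t v v' q; apply: (cvg_eq_lim FK (@cur_cvg _ _) (@cur_cvg _ _)).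
  by move=> h [].
- move=> s; apply: (cvg_ge0_lim FK (f := fun h => ksum (cur h) s)).
    by apply: cvg_bigsum => p; apply: cvg_bigsum => q; exact: cur_cvg.
  by move=> h [].
- apply: (cvg_eq_lim FK (@cur_cvg _ _) (cvg_cst _)).
  by move=> h [].
- move=> p q z w' w''; apply: (cvg_eq_lim FK (f := fun h => \sum_a cur h (p ** Pt (hb a) w') (q ** Pt (hb a) w''))
   (g := fun h => ip w' w'' * cur h p q)).
  + by apply: cvg_bigsum => a; exact: cur_cvg.
  + exact: (cvgM (cvg_cst _) (@cur_cvg _ _)).
  + by move=> h [].
- move=> p q z w1 w2; apply: (cvg_eq_lim FK (f := fun h => \sum_a cur h (p ** Pt w1 (hb a)) (q ** Pt w2 (hb a)))
   (g := fun h => ip w2 w1 * cur h p q)).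
  + by apply: cvg_bigsum => a; exact: cur_cvg.
  + exact: (cvgM (cvg_cst _) (@cur_cvg _ _)).
  + by move=> h [].
Qed.

End Limits.

Lemma closed_lim (A : set kspace) : (forall (F : set_system kspace) g,
  ProperFilter F -> F --> g -> F A -> A g) -> closed A.
Proof.
move=> h g; rewrite closureEcvg => -[F PF [Fg AF]]; apply: (h F) => //.
by apply: AF => x.
Qed.

Lemma kset_closed : closed kset.
Proof. by apply: closed_lim => F g PF Fg; exact: kset_lim. Qed.

Lemma kset_compact : compact kset.
Proof.
apply: (subclosed_compact kset_closed (@tychonoff (pt * pt)%type
  (fun=> C : topologicalType) (fun i => cbox (complex.Re (kbound i.1 i.2))) _)).
  by move=> i; exact: cbox_compact.
move=> g kg [p q]; apply: cboxP.
have b := k_bounded kg p q.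
by rewrite RRe_real // ger0_real //; apply: le_trans b.
Qed.

Lemma linval_real (ps : seq (pt * pt)) (k : pt -> pt -> C) : linval ps k = (real_complex R (complex.Re (linval ps k)) : C).
Proof.
rewrite RRe_real //; apply: rpred_sum => p _.
by rewrite CrealE /twice_re rmorphD /= conjCK addrC.
Qed.

Lemma sqval_real js (k : pt -> pt -> C) :
  sqval js k = (real_complex R (complex.Re (sqval js k)) : C).
Proof. by rewrite RRe_real //; apply: rpred_sum => p _; rewrite rpredX // normr_real. Qed.

(** The factor 1/2 and the bound on w' make these points small, also after multiplication by a
    phase; by linearity they determine all points. *)
Definition unit_pt (u : pt) := exists z (i : 'I_(hdim H z)) (w' : H' z),
  `|w'| <= 1 /\ u = Pt (2^-1 *: hb i) w'.

Definition mult_at (j : pt) : set kspace := [set g | forall u, unit_pt u ->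
  cur g (j ** u) pone = cur g j pone * cur g u pone /\
  cur g j u = cur g j pone * (cur g u pone)^*].

Lemma mult_at_closed j : closed (mult_at j).
Proof.
apply: closed_lim => F g PF Fg FM u uu; split.
  apply: (cvg_eq_lim FM (@cur_cvg F PF g Fg _ _) (cvgM (@cur_cvg F PF g Fg _ _) (@cur_cvg F PF g Fg _ _))).
  by move=> h /(_ u uu) [].
apply: (cvg_eq_lim FM (@cur_cvg F PF g Fg _ _) (cvgM (@cur_cvg F PF g Fg _ _) (cvg_conjC (@cur_cvg F PF g Fg _ _)))).
by move=> h /(_ u uu) [].
Qed.

Lemma unit_pt_small u c : unit_pt u -> `|c| = 1 -> small (pscale c u).
Proof.
move=> [z [i [w' [w1 ->]]]] c1; rewrite /pscale /= scalerA.
by apply: small_basis => //; rewrite normrM c1 mul1r ger0_norm ?invr_ge0.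
Qed.

(** Minimizing [linval] selects a compact face. On it [sqval] is maximized for finitely many points
    at a time, which gives multiplicativity at those points; the finite intersection property gives
    it at all of them. *)
Lemma mult_kernel_exists ps : exists k, [/\ pdkernel k,
  linval ps k <= linval ps (@haar R T H H')
  & forall j u, unit_pt u -> k (j ** u) pone = k j pone * k u pone /\
      k j u = k j pone * (k u pone)^*].
Proof.
have cl : continuous (fun g : kspace => complex.Re (linval ps (cur g))).
  move=> g; have FF : ProperFilter (nbhs g) by exact: nbhs_pfilter.
  have h := @linval_cvg (nbhs g) FF g (@cvg_id _ _) ps.
  exact (cvg_Re h).
have [||g0 g0K g0min] := @compact_EVT_min kspace R
    (fun g => complex.Re (linval ps (cur g))) kset _ kset_compact.
- by exists (uncur (@haar R T H H')); exact: haar_kernel.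
- exact: continuous_subspaceT.
rewrite inE in g0K.
pose K' := kset `&` [set g | linval ps (cur g) = linval ps (cur g0)].
have K'closed : closed K'.
  apply: closedI; first exact: kset_closed.
  apply: closed_lim => F g PF Fg FM.
  apply: (cvg_eq_lim FM (@linval_cvg F PF g Fg ps) (cvg_cst _)) => h.
  by [].
have K'compact : compact K'.
  by apply: subclosed_compact K'closed kset_compact _ => g [].
have minP k' : pdkernel k' -> linval ps (cur g0) <= linval ps k'.
  move=> kk'; rewrite linval_real [leRHS]linval_real lecR.
  by apply: (g0min (uncur k')); rewrite inE.
have [g gI] : \bigcap_(j in setT) (K' `&` mult_at j) !=set0.
  have := K'compact; rewrite compact_In0 => /(_ pt setT (fun j => K' `&` mult_at j)).
  apply; first by exists mult_at => // j _; exact: mult_at_closed.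
  move=> js _.
  have cs : continuous (fun g : kspace => complex.Re (sqval (finmap.enum_fset js) (cur g))).
    move=> g; have FF : ProperFilter (nbhs g) by exact: nbhs_pfilter.
    have h := @sqval_cvg (nbhs g) FF g (@cvg_id _ _) (finmap.enum_fset js).
    exact (cvg_Re h).
  have [||g1 g1K g1max] := @compact_EVT_max kspace R
      (fun g => complex.Re (sqval (finmap.enum_fset js) (cur g))) K' _ K'compact.
  - by exists g0.
  - exact: continuous_subspaceT.
  rewrite inE in g1K; exists g1 => j jjs; split=> // u uu.
  apply: (@extremal_mul _ _ _ _ _ g1K.1 ps (finmap.enum_fset js)).
  - by move=> k' kk'; rewrite g1K.2; exact: minP.
  - move=> k' kk' E; rewrite sqval_real [leRHS]sqval_real lecR.
    apply: (g1max (uncur k')); rewrite inE; split=> //.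
    by rewrite -g1K.2.
  - by move=> c c1; exact: unit_pt_small.
  - by rewrite inE; apply/hasP; exists j => //; apply/asboolP.
exists (cur g); have [[kg lg] _] := gI pone Logic.I; split=> //.
  by rewrite lg; apply: minP; exact: haar_kernel.
by move=> j u uu; have [_ /(_ u uu)] := gI j Logic.I.
Qed.

End KernelSpace.

(** * From multiplicative kernels to natural unitaries *)

Record natUnitary (R : realType) (T : drCat R) (H H' : embedding T) := NatUnitary {
  nu_fun :> forall x : T, H x -> H' x;
  nu_linear : forall x, linear (@nu_fun x);
  nu_ip : forall x (v w : H x), ip (nu_fun v) (nu_fun w) = ip v w;
  nu_surj : forall x (w : H' x), exists v, nu_fun v = w;
  nu_natural : forall (x y : T) (t : arr x y) v,
    nu_fun (emb_hom H t v) = emb_hom H' t (nu_fun v);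
  nu_tens : forall (x y : T) (v : H x) (w : H y),
    nu_fun (emb_tens v w) = emb_tens (nu_fun v) (nu_fun w)
}.

Section NaturalUnitaryExists.
Variables (R : realType) (T : drCat R) (H H' : embedding T).
Local Notation C := (cplx R).
Local Notation pt := (pt H H').
Local Notation pone := (pone H H').
Local Notation "p ** q" := (pmul p q) (at level 39, left associativity).

Definition coef (W : natUnitary H H') (p : pt) : C := ip (pt_w p) (W _ (pt_v p)).

Section FromKernel.
Variables (k : pt -> pt -> C) (kk : pdkernel k).
Local Notation chi := (k^~ pone).

Lemma k_scale_w c x (v : H x) (v' : H' x) q :
  k (Pt v (c *: v')) q = c^* * k (Pt v v') q.
Proof. by apply: (can_inj (@conjCK C)); rewrite (linZ (k_conj_linear kk v q)) rmorphM /= conjCK. Qed.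

Let mult (u : pt) := forall j, k (j ** u) pone = chi j * chi u /\
  k j u = chi j * (chi u)^*.

Hypothesis mult_unit : forall u, unit_pt u -> mult u.

(** Both identities depend linearly or antilinearly on v and on v', and once v' is scaled to norm at
    most 1 the point is a combination of unit points. *)
Let mult_all u : mult u.
Proof.
case: u => z v v'.
have mw c (x : T) (w : H x) w' : mult (Pt w w') -> mult (Pt w (c *: w')).
  move=> m j; have [m1 m2] := m j.
  rewrite /pmul /= (linZ (emb_tens_linr _)) !k_scale_w m1 mulrCA; split=> //.
  rewrite (k_herm kk _ j) k_scale_w !rmorphM /= -(k_herm kk) m2.
  by rewrite mulrCA.
have nv : 0 < `|v'| + 1 by rewrite ltr_wpDl.
have -> : v' = (`|v'| + 1) *: ((`|v'| + 1)^-1 *: v').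
  by rewrite scalerA divff ?scale1r // gt_eqF.
apply: (mw); set w' := _ *: v'.
have w1 : `|w'| <= 1.
  rewrite normrZ normfV (gtr0_norm nv) mulrC ler_pdivrMr // mul1r.
  by rewrite lerDl.
have -> : v = \sum_i (2 * ip (hb i) v) *: (2^-1 *: hb i).
  rewrite {1}(onbE (@hbP _ _ H z) v); apply: eq_bigr => i _.
  by rewrite scalerA mulrAC divff ?mul1r // pnatr_eq0.
move=> j; have mb i : mult (Pt (2^-1 *: @hb _ _ H z i) w').
  by apply: mult_unit; exists z, i, w'.
split.
  rewrite /pmul /= (lin_sum (emb_tens_linr _)) !(lin_sum (k_linear kk _ _)) mulr_sumr.
  apply: eq_bigr => i _; rewrite (linZ (emb_tens_linr _)) [in LHS](linZ (k_linear kk _ _)).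
  rewrite [in RHS](linZ (k_linear kk _ _)).
  have [m1 _] := mb i j; rewrite /pmul /= in m1; rewrite m1; exact: mulrCA.
rewrite (k_herm kk _ j) !(lin_sum (k_linear kk _ _)) !rmorph_sum mulr_sumr /=.
apply: eq_bigr => i _; rewrite [in LHS](linZ (k_linear kk _ _)) [in RHS](linZ (k_linear kk _ _)).
rewrite !rmorphM /= -(k_herm kk).
by have [_ ->] := mb i j; rewrite mulrCA.
Qed.

(** The vector with <v', W v> = [chi (Pt v v')] for all v', written in a basis. *)
Let W x (v : H x) : H' x := \sum_a chi (Pt v (hb a)) *: hb a.

Let W_ip x (v : H x) v' : ip v' (W v) = chi (Pt v v').
Proof.
rewrite ip_sumr; apply: (can_inj (@conjCK C)).
rewrite [in RHS](onbE (@hbP _ _ H' x) v') (lin_sum (k_conj_linear kk v pone)).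
rewrite rmorph_sum /=; apply: eq_bigr => a _.
by rewrite ipZr (linZ (k_conj_linear kk v pone)) rmorphM /= -ip_conj mulrC.
Qed.

(** Through multiplicativity, [k_unitaryl] and [k_unitaryr] at [pone] become isometry and
    surjectivity of W; compatibility with tensor products is multiplicativity itself. *)
Lemma kernel_unitary : exists W : natUnitary H H',
  forall p q, k p q = coef W p * (coef W q)^*.
Proof.
have Wip x (v w : H x) : ip (W v) (W w) = ip v w.
  have := k_unitaryl kk pone pone w v; rewrite k_one // mulr1 => <-.
  rewrite (ip_parseval (@hbP _ _ H' x)); apply: eq_bigr => a _.
  rewrite ip_conj !W_ip (k_mul1 kk) (k_herm2 kk (k_mul1 kk _ _)).
  by have [_ ->] := mult_all (Pt v (hb a)) (Pt w (hb a)); rewrite mulrC.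
have Wlin x : linear (@W x).
  by move=> c v w; apply: ip_ext => u; rewrite W_ip k_lin // ipDr ipZr !W_ip.
have Wsurj x (w : H' x) : exists v, W v = w.
  exists (\sum_a ip (W (hb a)) w *: hb a); rewrite (lin_sum (Wlin x)).
  apply: ip_ext => u; have := k_unitaryr kk pone pone u w.
  rewrite k_one // mulr1 => <-; rewrite ip_sumr; apply: eq_bigr => a _.
  rewrite (linZ (Wlin x)) ipZr ip_conj !W_ip (k_mul1 kk) (k_herm2 kk (k_mul1 kk _ _)).
  by have [_ ->] := mult_all (Pt (hb a) w) (Pt (hb a) u); rewrite mulrC.
have Wnat (x y : T) (t : arr x y) v : W (emb_hom H t v) = emb_hom H' t (W v).
  by apply: ip_ext => u; rewrite W_ip k_nat // emb_adjr W_ip.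
have Wtens (x y : T) (v : H x) (w : H y) : W (emb_tens v w) = emb_tens (W v) (W w).
  apply: emb_tens_ext => v' w'; rewrite W_ip emb_tens_ip !W_ip.
  by have [<- _] := mult_all (Pt w w') (Pt v v').
exists (NatUnitary Wlin Wip Wsurj Wnat Wtens) => -[x v v'] [y w w'].
by rewrite /coef /= !W_ip; have [_ ->] := mult_all (Pt w w') (Pt v v').
Qed.

End FromKernel.

(* Tannaka duality: the kernel [haar], built from the arrows alone, is in the
   closed convex hull of the kernels of the natural unitaries; by separation
   this says that a linear functional is somewhere below its mean. *)
Theorem natural_unitary_exists (ps : seq (pt * pt)) : exists W : natUnitary H H',
  \sum_(p <- ps) twice_re (coef W p.1 * (coef W p.2)^*) <= linval ps (@haar R T H H').
Proof.
have [k [kk kle mult]] := mult_kernel_exists ps.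
have [|W WE] := @kernel_unitary k kk.
  by move=> u uu j; exact: mult.
exists W; apply: le_trans kle; rewrite le_eqVlt; apply/orP; left; apply/eqP.
by apply: eq_bigr => p _; rewrite WE.
Qed.

End NaturalUnitaryExists.

(** * C*-algebras *)

Section CStarBasics.
Variables (R : realType) (A : cstarAlg R).
Local Notation C := (cplx R).
Implicit Types (x y z : A).

Lemma mul_linl y : linear (fun x => cs_mul x y). Proof. exact: cs_mul_linl. Qed.
Lemma mul_linr x : linear (fun y => cs_mul x y). Proof. exact: cs_mul_linr. Qed.

Lemma csDl x y z : cs_mul (x + y) z = cs_mul x z + cs_mul y z.
Proof. exact: (linD (mul_linl z)). Qed.
Lemma csDr x y z : cs_mul x (y + z) = cs_mul x y + cs_mul x z.
Proof. exact: (linD (mul_linr x)). Qed.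
Lemma csBl x y z : cs_mul (x - y) z = cs_mul x z - cs_mul y z.
Proof. exact: (linB (mul_linl z)). Qed.
Lemma csBr x y z : cs_mul x (y - z) = cs_mul x y - cs_mul x z.
Proof. exact: (linB (mul_linr x)). Qed.
Lemma csZl c x z : cs_mul (c *: x) z = c *: cs_mul x z.
Proof. exact: (linZ (mul_linl z)). Qed.
Lemma csZr c x z : cs_mul x (c *: z) = c *: cs_mul x z.
Proof. exact: (linZ (mul_linr x)). Qed.
Lemma cs0l z : cs_mul 0 z = 0. Proof. exact: (lin0 (mul_linl z)). Qed.
Lemma cs0r x : cs_mul x 0 = 0. Proof. exact: (lin0 (mul_linr x)). Qed.
Lemma cs_suml z (I : Type) (r : seq I) (P : pred I) (F : I -> A) :
  cs_mul (\sum_(i <- r | P i) F i) z = \sum_(i <- r | P i) cs_mul (F i) z.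
Proof. exact: (lin_sum (mul_linl z)). Qed.
Lemma cs_sumr x (I : Type) (r : seq I) (P : pred I) (F : I -> A) :
  cs_mul x (\sum_(i <- r | P i) F i) = \sum_(i <- r | P i) cs_mul x (F i).
Proof. exact: (lin_sum (mul_linr x)). Qed.

Lemma cs_adjD x y : cs_adj (x + y) = cs_adj x + cs_adj y.
Proof. by rewrite -{1}[x]scale1r cs_adj_antilin conjC1 scale1r. Qed.
Lemma cs_adj0 : cs_adj (0 : A) = 0.
Proof. by apply: (addIr (cs_adj 0)); rewrite -cs_adjD !add0r. Qed.
Lemma cs_adjZ c x : cs_adj (c *: x) = c^* *: cs_adj x.
Proof. by rewrite -[c *: x]addr0 cs_adj_antilin cs_adj0 addr0. Qed.
Lemma cs_adjN x : cs_adj (- x) = - cs_adj x.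
Proof. by rewrite -scaleN1r cs_adjZ rmorphN /= conjC1 scaleN1r. Qed.
Lemma cs_adjB x y : cs_adj (x - y) = cs_adj x - cs_adj y.
Proof. by rewrite cs_adjD cs_adjN. Qed.
Lemma cs_adj_sum (I : Type) (r : seq I) (P : pred I) (F : I -> A) :
  cs_adj (\sum_(i <- r | P i) F i) = \sum_(i <- r | P i) cs_adj (F i).
Proof. by apply: (big_morph _ cs_adjD cs_adj0). Qed.

Lemma cs_adj_norm x : `|cs_adj x| = `|x|.
Proof.
have h y : `|y| <= `|cs_adj y|.
  have [->|y0] := eqVneq `|y| 0; first by [].
  rewrite -(@ler_pM2r _ `|y|) ?lt_neqAle 1?eq_sym ?y0 ?normr_ge0 // -expr2.
  by rewrite -cs_norm_adj; exact: cs_normM.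
by apply/eqP; rewrite eq_le h andbT; have := h (cs_adj x); rewrite cs_adjK.
Qed.

Lemma sq_idem_le1 (t : C) : 0 <= t -> t ^+ 2 <= t -> t <= 1.
Proof.
move=> t0; have [->|tn] := eqVneq t 0; first by rewrite ler01.
by rewrite expr2 -{3}[t]mulr1 ler_pM2l // lt_neqAle eq_sym tn.
Qed.

Lemma proj_norm x : cs_adj x = x -> cs_mul x x = x -> `|x| <= 1.
Proof.
move=> sx ix; apply: sq_idem_le1 => //.
by rewrite -cs_norm_adj sx ix.
Qed.

Section Unit.
Variables (e : A) (ue : is_unit e).

Lemma cs1l x : cs_mul e x = x. Proof. by case: (ue x). Qed.
Lemma cs1r x : cs_mul x e = x. Proof. by case: (ue x). Qed.

Lemma unit_adj : cs_adj e = e.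
Proof. by rewrite -[cs_adj e]cs1r -{2}[e]cs_adjK -cs_adjM cs1r cs_adjK. Qed.

Lemma unit_uniq e' : is_unit e' -> e' = e.
Proof. by move=> /(_ e) [<- _]; rewrite cs1r. Qed.

End Unit.

Lemma sa_norm x : cs_adj x = x -> `|cs_mul x x| = `|x| ^+ 2.
Proof. by move=> sx; rewrite -{1}sx cs_norm_adj. Qed.

(** The powers x^(2^n), along which the norm of a self-adjoint element is exactly multiplicative;
    they stand in for the spectral radius. *)
Definition sqpow n x := iter n (fun z => cs_mul z z) x.

Lemma sqpow_adj n x : cs_adj x = x -> cs_adj (sqpow n x) = sqpow n x.
Proof. by move=> sx; elim: n => //= n IH; rewrite cs_adjM IH. Qed.

Lemma sqpow_norm n x : cs_adj x = x -> `|sqpow n x| = `|x| ^+ (2 ^ n).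
Proof.
move=> sx; elim: n => [|n IH]; first by rewrite expr1.
by rewrite /= sa_norm ?sqpow_adj // IH -exprM -expnSr.
Qed.

End CStarBasics.

Section Powers.
Variable R : realType.
Local Notation C := (cplx R).

Lemma exists_pow2_gt (t K : R) : 1 < t -> exists n, K < t ^+ (2 ^ n).
Proof.
move=> t1; have s0 : 0 < t - 1 by rewrite subr_gt0.
pose m := Num.bound (`|K| / (t - 1)).
have mK : `|K| / (t - 1) < m%:R by rewrite archi_boundP // divr_ge0 // ltW.
exists m.
have bern n : 1 + n%:R * (t - 1) <= t ^+ n.
  elim: n => [|n IH]; first by rewrite mul0r addr0 expr0.
  rewrite exprS; apply: (@le_trans _ _ (t * (1 + n%:R * (t - 1)))); last first.
    by rewrite ler_pM2l // (lt_trans ltr01).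
  have h : 0 <= n%:R * ((t - 1) * (t - 1)) by rewrite mulr_ge0 ?mulr_ge0 // ltW.
  rewrite -subr_ge0; move: h; congr (0 <= _); rewrite -addn1 natrD; ring.
apply: lt_le_trans (bern _); apply: (le_lt_trans (ler_norm K)).
apply: (@lt_trans _ _ (m%:R * (t - 1))); first by rewrite -ltr_pdivrMr.
apply: (@le_lt_trans _ _ ((2 ^ m)%:R * (t - 1))); last by rewrite ltrDr.
by rewrite ler_pM2r // ler_nat ltnW // ltn_expl.
Qed.

Lemma pow2_bounded (t K : C) : 0 <= t -> (forall n, t ^+ (2 ^ n) <= K) -> t <= 1.
Proof.
move=> t0 h; have tr : t = (real_complex R (complex.Re t) : C).
  by rewrite RRe_real // ger0_real.
rewrite tr -[1](rmorph1 (real_complex R)) lecR leNgt; apply/negP => t1.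
have [n] := exists_pow2_gt (complex.Re K) t1; apply/negP; rewrite -leNgt.
by have := h n; rewrite tr -rmorphXn lecE /= => /andP[].
Qed.

Lemma exists_pow2_lt (e : C) : 0 < e -> exists n, (2^-1 : C) ^+ n < e.
Proof.
move=> /real_cplx [-> e0].
have [n hn] := exists_pow2_gt ((complex.Re e)^-1) (ltr1n R 2).
exists (2 ^ n)%N.
have -> : (2^-1 : C) = real_complex R (2^-1) by rewrite fmorphV rmorph_nat.
rewrite -rmorphXn ltcR.
by rewrite exprVn invf_plt ?posrE ?exprn_gt0.
Qed.

Lemma eps_le (x : C) (k : C) : 0 <= k -> 0 <= x ->
  (forall e, 0 < e -> x <= k * e) -> x = 0.
Proof.
move=> k0 x0 h; apply/eqP; apply: contraT => xn.
have xp : 0 < x by rewrite lt_neqAle eq_sym xn.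
have kp : 0 < 2 * (k + 1) by rewrite mulr_gt0 // ltr_wpDl.
have := h (x / (2 * (k + 1))) (divr_gt0 xp kp).
have -> : k * (x / (2 * (k + 1))) = x * (k / (2 * (k + 1))) by ring.
rewrite -{1}[x]mulr1 ler_pM2l // ler_pdivlMr // mul1r => /le_gtF.
by rewrite mulrDr mulr1 ltr_pwDr // mulr_natl mulr2n lerDl.
Qed.

End Powers.

(** * Sequences with geometrically decreasing steps *)

Section GeometricSequences.
Variables (K : numFieldType) (small2 : forall e : K, 0 < e -> exists n, 2^-1 ^+ n < e).
Variables (V : completeNormedModType K) (y : nat -> V).
Hypothesis hy : forall n, `|y n.+1 - y n| <= 2^-1 ^+ n.

Lemma geometric_bound n m : `|y (n + m)%N - y n| <= 2 * (2^-1 ^+ n) - 2 * 2^-1 ^+ (n + m).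
Proof.
elim: m => [|m IH]; first by rewrite addn0 !subrr normr0.
rewrite addnS (_ : y _ - y n = (y (n + m).+1 - y (n + m)%N) + (y (n + m)%N - y n)).
  apply: (le_trans (ler_normD _ _)); apply: (le_trans (lerD (hy _) IH)).
  rewrite le_eqVlt; apply/orP; left; apply/eqP; rewrite exprS.
  by field.
by rewrite addrA subrK.
Qed.

Lemma geometric_dist n m : (n <= m)%N -> `|y m - y n| <= 2 * (2^-1 ^+ n).
Proof.
move=> nm; rewrite -(subnKC nm); apply: (le_trans (geometric_bound _ _)).
by rewrite gerBl mulr_ge0 // exprn_ge0 // invr_ge0.
Qed.

(** The scalar field is abstract, with [small2] as hypothesis, because the lemma is applied over the
    complex numbers and over the reals. *)
Lemma geometric_cvg0 : exists l : V, y @ \oo --> l.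
Proof.
suff : cvg (y @ \oo) by move=> /cvg_ex.
apply: cauchy_cvg; apply: cauchy_exP => e e0.
have e20 : 0 < e / 2 by rewrite divr_gt0.
have [n hn] := small2 e20; exists (y n).
exists n => // m /= nm; rewrite -ball_normE /= -normrN opprB.
apply: (le_lt_trans (geometric_dist nm)).
by move: hn; rewrite ltr_pdivlMr // mulrC.
Qed.

End GeometricSequences.

Section GeometricLimits.
Variable R : realType.
Local Notation C := (cplx R).
Variable V : completeNormedModType C.

Lemma geometric_cvg (y : nat -> V) :
  (forall n, `|y n.+1 - y n| <= 2^-1 ^+ n) -> exists l : V, y @ \oo --> l.
Proof. by move=> hy; exact (@geometric_cvg0 C (@exists_pow2_lt R) V y hy). Qed.

Lemma cvg_norm_lt (y : nat -> V) (l : V) : y @ \oo --> l ->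
  forall e, 0 < e -> exists n, forall m, (n <= m)%N -> `|l - y m| < e.
Proof. by move=> /cvgrPdist_lt h e e0; have [n _ hn] := h e e0; exists n => m /hn. Qed.

Lemma geometric_lim (y : nat -> V) (c : C) :
  (forall n, `|y n.+1 - y n| <= 2^-1 ^+ n * c) ->
  exists l : V, forall n, `|l - y n| <= 2 * 2^-1 ^+ n * c.
Proof.
move=> hy; have c0 : 0 <= c by have := hy 0%N; rewrite expr0 mul1r; exact: le_trans.
have [c00|cn] := eqVneq c 0.
  exists (y 0%N) => n; rewrite c00 mulr0 normr_le0 subr_eq0 eq_sym; apply/eqP.
  elim: n => // n <-; apply/eqP; rewrite -subr_eq0 -normr_le0.
  by have := hy n; rewrite c00 mulr0.
have cp : 0 < c by rewrite lt_neqAle eq_sym cn.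
pose z n := c^-1 *: y n.
have hz n : `|z n.+1 - z n| <= 2^-1 ^+ n.
  by rewrite -scalerBr normrZ normfV (gtr0_norm cp) mulrC ler_pdivrMr.
have [l zl] := geometric_cvg hz; exists (c *: l) => n.
have -> : c *: l - y n = c *: (l - z n).
  by rewrite scalerBr scalerA divff // scale1r.
rewrite normrZ (gtr0_norm cp) mulrC ler_wpM2r //.
rewrite -subr_ge0; apply: (@cvg_ge0_lim R nat \oo _ (fun m => (n <= m)%N)
  (fun m => 2 * 2^-1 ^+ n - `|z m - z n|)).
- by exists n.
- apply: (cvgB (cvg_cst _)); apply: cvg_norm; exact: (cvgB zl (cvg_cst _)).
- by move=> m nm; rewrite subr_ge0; exact: geometric_dist.
Qed.

End GeometricLimits.

(** * Square roots and contractivity of *-homomorphisms *)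

Section SquareRoots.
Variables (R : realType) (A : cstarAlg R) (e : A).
Hypothesis ue : is_unit e.
Local Notation C := (cplx R).
Local Notation "x ** y" := (cs_mul x y) (at level 39, left associativity).

Lemma half_ge0 : 0 <= (2^-1 : C). Proof. by rewrite invr_ge0. Qed.
Lemma half_norm : `|2^-1 : C| = 2^-1. Proof. by rewrite ger0_norm ?half_ge0. Qed.
Lemma half2 : (2^-1 + 2^-1 : C) = 1.
Proof. by rewrite [RHS]splitr div1r. Qed.

Lemma half_le1 : (2^-1 : C) <= 1.
Proof. by rewrite invf_le1 // ler1n. Qed.

(* k = e - y, where y is the small solution of 2 y = h^2 + y^2, obtained by
   iterating a contraction. *)
Lemma sqrt_compl (h : A) : cs_adj h = h -> `|h| <= 2^-1 ->
  exists k : A, [/\ cs_adj k = k, h ** k = k ** h & k ** k = e - h ** h].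
Proof.
move=> sh nh; pose a := h ** h.
have na : `|a| <= 2^-1.
  apply: (le_trans (cs_normM h h)); apply: (@le_trans _ _ (2^-1 * 1)).
    by rewrite ler_pM // (le_trans nh) // half_le1.
  by rewrite mulr1.
pose F (z : A) := 2^-1 *: (a + z ** z).
pose y n := iter n F 0.
have ny n : `|y n| <= 2^-1.
  elim: n => [|n IH] /=; first by rewrite normr0 half_ge0.
  rewrite normrZ half_norm -[leRHS]mulr1 ler_pM2l ?invr_gt0 //.
  rewrite -half2; apply: (le_trans (ler_normD _ _)); rewrite lerD //.
  apply: (le_trans (cs_normM _ _)); apply: (@le_trans _ _ (2^-1 * 1)).
    by rewrite ler_pM // (le_trans IH) // half_le1.
  by rewrite mulr1.
have sqB (u v : A) : u ** u - v ** v = u ** (u - v) + (u - v) ** v.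
  by rewrite csBr csBl addrA subrK.
have Fl (u v : A) c : `|u| + `|v| <= c -> `|F u - F v| <= 2^-1 * (c * `|u - v|).
  move=> huv; rewrite /F -scalerBr opprD addrACA subrr add0r normrZ half_norm.
  rewrite ler_pM2l ?invr_gt0 // sqB; apply: (le_trans (ler_normD _ _)).
  apply: (le_trans (lerD (cs_normM _ _) (cs_normM _ _))).
  by rewrite [X in _ + X]mulrC -mulrDl ler_wpM2r.
have yd n : `|y n.+1 - y n| <= 2^-1 ^+ n.
  elim: n => [|n IH].
    by rewrite subr0 expr0 (le_trans (ny 1%N)) // half_le1.
  apply: (le_trans (Fl (y n.+1) (y n) 1 _)); first by rewrite -half2 lerD.
  by rewrite mul1r exprS ler_pM2l // invr_gt0.
have [l yl] := geometric_cvg yd.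
have near := cvg_norm_lt yl.
have h20 : 0 < (2^-1 : C) by rewrite invr_gt0.
have nl : `|l| <= 1.
  have [n /(_ n (leqnn n)) hn] := near _ h20.
  rewrite -[l](subrK (y n)); apply: (le_trans (ler_normD _ _)).
  by rewrite -half2 lerD // ltW.
(* How identities pass to the limit: r vanishes once it is bounded by twice the distance from l to
   late iterates. *)
have lim0 (r : A) : (forall n c, 0 < c -> `|l - y n| < c -> `|l - y n.+1| < c ->
    `|r| <= 2 * c) -> r = 0.
  move=> hr; apply/eqP; rewrite -normr_eq0; apply/eqP.
  apply: (@eps_le _ _ 2) => // c c0; have [n hn] := near c c0.
  by apply: (hr n c c0); [exact: hn|apply: hn].
have sy n : cs_adj (y n) = y n.
  elim: n => [|n IH]; first exact: cs_adj0.
  rewrite /y iterS -/(y n) /F cs_adjZ cs_adjD cs_adjM IH.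
  by rewrite /a cs_adjM sh geC0_conj ?half_ge0.
have cy n : h ** y n = y n ** h.
  elim: n => [|n IH]; first by rewrite cs0l cs0r.
  rewrite /y iterS -/(y n) /F csZl csZr csDl csDr; congr (_ *: (_ + _)).
    by rewrite /a cs_mulA.
  by rewrite cs_mulA IH -cs_mulA IH cs_mulA.
have sl : cs_adj l = l.
  apply/eqP; rewrite -subr_eq0; apply/eqP/lim0 => n c c0 h1 h2.
  rewrite (_ : _ - _ = cs_adj (l - y n) - (l - y n)); last first.
    by rewrite cs_adjB sy opprB addrA subrK.
  apply: (le_trans (ler_normB _ _)); rewrite cs_adj_norm.
  by rewrite mulr_natl mulr2n lerD // ltW.
have cl : h ** l = l ** h.
  apply/eqP; rewrite -subr_eq0; apply/eqP/lim0 => n c c0 h1 h2.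
  rewrite (_ : _ - _ = h ** (l - y n) - (l - y n) ** h); last first.
    by rewrite csBl csBr cy opprB addrA subrK.
  apply: (le_trans (ler_normB _ _)).
  apply: (le_trans (lerD (cs_normM _ _) (cs_normM _ _))).
  have h' : `|h| * `|l - y n| <= c.
    rewrite -[leRHS]mul1r; apply: ler_pM => //; last exact: ltW.
    exact: le_trans nh half_le1.
  by rewrite [X in _ + X]mulrC mulr_natl mulr2n lerD.
have fl : l = F l.
  apply/eqP; rewrite -subr_eq0; apply/eqP/lim0 => n c c0 h1 h2.
  rewrite (_ : _ - _ = (l - y n.+1) + (F (y n) - F l)); last by rewrite addrA subrK.
  apply: (le_trans (ler_normD _ _)); rewrite mulr_natl mulr2n lerD ?(ltW h2) //.
  apply: (le_trans (Fl (y n) l 2 _)).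
    by rewrite -[leRHS]/(1 + 1) lerD // (le_trans (ny n)) // half_le1.
  by rewrite mulrA mulVf ?pnatr_eq0 // mul1r distrC ltW.
exists (e - l); split.
- by rewrite cs_adjB sl (unit_adj ue).
- by rewrite csBl csBr (cs1l ue) (cs1r ue) cl.
- have l2 : l + l = a + l ** l.
    have := congr1 (fun z : A => z + z) fl.
    by rewrite /F -scalerDl half2 scale1r.
  have ll : l ** l = l + l - a by rewrite l2 addrAC subrr add0r.
  rewrite csBl !csBr (cs1l ue) !(cs1r ue) (cs1l ue) -/a ll opprB.
  have -> : l + l - a - l = l - a by rewrite addrAC addrK.
  by rewrite addrA subrK.
Qed.

End SquareRoots.

Section Contractive.
Variables (R : realType) (A B : cstarAlg R) (f : A -> B) (hf : star_hom f).
Variables (e : A) (ue : is_unit e).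
Local Notation C := (cplx R).
Local Notation "x ** y" := (cs_mul x y) (at level 39, left associativity).

Let fl : linear f. Proof. by case: hf. Qed.
Let fm x y : f (x ** y) = f x ** f y. Proof. by case: hf. Qed.
Let fa x : f (cs_adj x) = cs_adj (f x). Proof. by case: hf. Qed.

Let fe_norm : `|f e| <= 1.
Proof. by apply: proj_norm; rewrite -?fa -?fm ?(unit_adj ue) ?(cs1r ue). Qed.

Let unitary_norm u : cs_adj u ** u = e -> `|f u| <= 1.
Proof.
move=> hu; have := cs_norm_adj (f u); rewrite -fa -fm hu => h.
have : `|f u| ^+ 2 <= 1 ^+ 2 by rewrite -h expr1n.
by rewrite ler_pXn2r ?nnegrE.
Qed.

(* A self-adjoint h of norm at most 1/2 is the mean of the unitaries
   h + i k and h - i k, where k^2 = 1 - h^2. *)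
Let sa_bound (h : A) : cs_adj h = h -> `|h| <= 2^-1 -> `|f h| <= 1.
Proof.
move=> sh nh; have [k [sk hk kk]] := sqrt_compl ue sh nh.
pose u := h + 'i *: k.
have su : cs_adj u = h - 'i *: k.
  by rewrite cs_adjD cs_adjZ sh sk conjCi scaleNr.
have uu : cs_adj u ** u = e.
  rewrite su /u csDr !csBl !csZl !csZr ?csZl hk kk.
  rewrite scalerA -expr2 sqrCi scaleN1r opprK.
  by rewrite addrA subrK addrC subrK.
have uu' : cs_adj (cs_adj u) ** cs_adj u = e.
  rewrite cs_adjK su /u csDl !csBr !csZl !csZr ?csZl hk kk.
  rewrite scalerA -expr2 sqrCi scaleN1r opprK.
  by rewrite addrA subrK addrC subrK.
have -> : h = 2^-1 *: (u + cs_adj u).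
  by rewrite su /u addrACA subrr addr0 scalerDr -scalerDl half2 scale1r.
rewrite (linZ fl) (linD fl) normrZ half_norm.
apply: (@le_trans _ _ (2^-1 * 2)); last by rewrite mulVf // pnatr_eq0.
rewrite ler_pM2l ?invr_gt0 //; apply: (le_trans (ler_normD _ _)).
by rewrite -[leRHS]/(1 + 1) lerD // unitary_norm.
Qed.

(** [sa_bound] gives |f x| <= 2 |x| for self-adjoint x. Applied to x = h^(2^n) it bounds (|f h| /
    |h|)^(2^n) by 2 for all n, which improves the constant to 1. *)
Let sa_contr (h : A) : cs_adj h = h -> `|f h| <= `|h|.
Proof.
move=> sh; have [->|h0] := eqVneq h 0; first by rewrite (lin0 fl) !normr0.
have nh : 0 < `|h| by rewrite normr_gt0.
have b (x : A) : cs_adj x = x -> `|f x| <= 2 * `|x|.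
  move=> sx; have [->|x0] := eqVneq x 0; first by rewrite (lin0 fl) !normr0 mulr0.
  have nx : 0 < 2 * `|x| by rewrite mulr_gt0 // normr_gt0.
  have cr : ((2 * `|x|)^-1)^* = (2 * `|x|)^-1 by rewrite geC0_conj // invr_ge0 ltW.
  have := @sa_bound ((2 * `|x|)^-1 *: x); rewrite cs_adjZ sx cr => /(_ erefl).
  rewrite (linZ fl) !normrZ normfV (gtr0_norm nx) => h1.
  have : `|f x| / (2 * `|x|) <= 1.
    rewrite mulrC; apply: h1; rewrite invfM -mulrA mulVf ?mulr1 //.
      by rewrite normr_eq0.
  by rewrite ler_pdivrMr // mul1r.
have : `|f h| / `|h| <= 1.
  apply: (@pow2_bounded _ _ 2); first by rewrite divr_ge0.
  move=> n; rewrite expr_div_n ler_pdivrMr ?exprn_gt0 //.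
  rewrite -(sqpow_norm n sh) -sqpow_norm -?fa ?sh //.
  have -> : sqpow n (f h) = f (sqpow n h) by elim: n => //= n ->; rewrite fm.
  by apply: b; exact: sqpow_adj.
by rewrite ler_pdivrMr // mul1r.
Qed.

Lemma star_hom_contr x : `|f x| <= `|x|.
Proof.
rewrite -(@ler_pXn2r _ 2) ?nnegrE // -!cs_norm_adj -fa -fm.
by apply: sa_contr; rewrite cs_adjM cs_adjK.
Qed.

End Contractive.

Local Notation "x ** y" := (cs_mul x y) (at level 39, left associativity).

(** The unit vector is idempotent under the tensor product, so the scalar c by which W acts on it
    satisfies c^2 = c; it is nonzero because W is isometric. *)
Lemma nu_unit (R : realType) (T : drCat R) (H H' : embedding T) (W : natUnitary H H') :
  W unitO emb_unit = emb_unit.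
Proof.
set c := ip emb_unit (W unitO emb_unit).
have Wu : W unitO emb_unit = c *: emb_unit := emb_unitE _.
have : W unitO (emb_hom H (coe (tensO1l unitO)) (emb_tens emb_unit emb_unit)) =
       W unitO emb_unit by rewrite emb_tens1l.
rewrite nu_natural nu_tens Wu (linZ (emb_tens_linl _)) (linZ (emb_lin _)).
rewrite emb_tens1l => /(congr1 (ip emb_unit)).
rewrite !ipZr emb_unit_ip mulr1 => cc; have c0 : c != 0.
  apply/eqP => c0; have := nu_ip W (emb_unit : H unitO) emb_unit.
  rewrite Wu c0 scale0r ip0r emb_unit_ip => /eqP.
  by rewrite eq_sym oner_eq0.
suff -> : c = 1 by rewrite scale1r.
by apply: (mulfI c0); rewrite cc mulr1.
Qed.

(** * The Cuntz algebra *)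

Section Cuntz.
Variables (R : realType) (d : nat) (Od : cstarAlg R) (psi : 'I_d -> Od).
Hypothesis psi_cuntz : is_cuntz psi.
Local Notation C := (cplx R).

Definition cunit : Od := let: And3 cf _ _ := psi_cuntz in sval (cid cf).

Lemma cunitP : [/\ is_unit cunit,
    forall h k, cs_adj (psi h) ** psi k = (if h == k then cunit else 0)
    & \sum_k psi k ** cs_adj (psi k) = cunit].
Proof. by rewrite /cunit; case: psi_cuntz => cf _ _; exact: (svalP (cid cf)). Qed.

Lemma cunit_unit : is_unit cunit. Proof. by case: cunitP. Qed.

(** Equality on the generators passes to the closure because *-homomorphisms contract norms. *)
Lemma star_hom_ext (B : cstarAlg R) (f g : Od -> B) : star_hom f -> star_hom g ->
  (forall k, f (psi k) = g (psi k)) -> f =1 g.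
Proof.
move=> hf hg fg x; have [fl fm fa] := hf; have [gl gm ga] := hg.
have E y : star_generated (range psi) y -> f y = g y.
  elim=> {y} [_ [k _ <-]||c y z _ IHy _ IHz|y z _ IHy _ IHz|y _ IHy].
  - exact: fg.
  - by rewrite (lin0 fl) (lin0 gl).
  - by rewrite fl gl IHy IHz.
  - by rewrite fm gm IHy IHz.
  - by rewrite fa ga IHy.
apply/eqP; rewrite -subr_eq0 -normr_eq0; apply/eqP.
apply: (@eps_le _ _ 2) => // c c0.
have : closure (star_generated (range psi)) x by case: psi_cuntz => _ -> _.
move=> /(_ (ball x c) (nbhsx_ballx _ _ c0)) [y [/E Ey]].
rewrite -ball_normE /= => xy.
have -> : f x - g x = f (x - y) - g (x - y).
  by rewrite (linB fl) (linB gl) Ey opprB addrA subrK.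
apply: (le_trans (ler_normB _ _)).
apply: (le_trans (lerD (star_hom_contr hf cunit_unit _) (star_hom_contr hg cunit_unit _))).
by rewrite mulr_natl mulr2n lerD // ltW.
Qed.

Lemma aut_hom (a : cstar_aut Od) : star_hom a. Proof. by case: (aut_iso a). Qed.

Lemma aut_contr (a : cstar_aut Od) x : `|a x| <= `|x|.
Proof. exact: (star_hom_contr (aut_hom a) cunit_unit). Qed.

Lemma aut_ext (a b : cstar_aut Od) : (forall k, a (psi k) = b (psi k)) -> a = b.
Proof. by move=> E; apply/aut_eq/star_hom_ext => //; exact: aut_hom. Qed.

Lemma aut_unit (a : cstar_aut Od) : a cunit = cunit.
Proof.
apply: (unit_uniq cunit_unit) => x.
have [[al am aa] ab] := aut_iso a; have := inv_funVK ab x => <-.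
by rewrite -!am; case: (cunit_unit (inv_fun a x)) => -> ->.
Qed.

Definition unitary_mx (U : 'I_d -> 'I_d -> C) :=
  (forall h h', \sum_k (U k h)^* * U k h' = (h == h')%:R) /\
  (forall k k', \sum_h U k h * (U k' h)^* = (k == k')%:R).

Lemma psi_comb (u v : 'I_d -> C) :
  cs_adj (\sum_k u k *: psi k) ** (\sum_k v k *: psi k) =
  (\sum_k (u k)^* * v k) *: cunit.
Proof.
have [_ oo _] := cunitP.
rewrite cs_adj_sum cs_suml scaler_suml; apply: eq_bigr => k _.
rewrite cs_adjZ csZl cs_sumr (bigD1 k) //= csZr oo eqxx big1 ?addr0 ?scalerA //.
by move=> j jk; rewrite csZr oo eq_sym (negPf jk) scaler0.
Qed.

Lemma unitary_cuntz U : unitary_mx U ->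
  cuntz_family (fun h => \sum_k U k h *: psi k).
Proof.
move=> [U1 U2]; exists cunit; have [ue _ ss] := cunitP; split=> //.
  move=> h k; rewrite psi_comb U1.
  by case: eqP => _; rewrite ?scale1r ?scale0r.
rewrite -ss.
transitivity (\sum_h \sum_k \sum_k' (U k h * (U k' h)^*) *: (psi k ** cs_adj (psi k'))).
  apply: eq_bigr => h _; rewrite cs_adj_sum cs_suml; apply: eq_bigr => k _.
  rewrite cs_sumr; apply: eq_bigr => k' _.
  by rewrite cs_adjZ csZl csZr scalerA.
rewrite exchange_big; apply: eq_bigr => k _ /=; rewrite exchange_big /=.
rewrite (bigD1 k) //= -scaler_suml U2 eqxx scale1r big1 ?addr0 //.
by move=> j jk; rewrite -scaler_suml U2 eq_sym (negPf jk) scale0r.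
Qed.

Lemma unitary_hom U : unitary_mx U -> exists2 f : Od -> Od, star_hom f &
  forall h, f (psi h) = \sum_k U k h *: psi k.
Proof.
move=> /unitary_cuntz cU; have [_ _ univ] := psi_cuntz.
by have [f [hf fE]] := univ _ _ cU; exists f.
Qed.

Lemma star_hom_comp (A1 A2 A3 : cstarAlg R) (g : A2 -> A3) (f : A1 -> A2) :
  star_hom g -> star_hom f -> star_hom (g \o f).
Proof.
move=> [gl gm ga] [fl fm fa]; split=> [c x y|x y|x] /=.
- by rewrite fl gl.
- by rewrite fm gm.
- by rewrite fa ga.
Qed.

Lemma unitary_aut U : unitary_mx U -> exists a : cstar_aut Od,
  forall h, a (psi h) = \sum_k U k h *: psi k.
Proof.
move=> hU; have [U1 U2] := hU; have [f hf fE] := unitary_hom hU.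
pose V k h := (U h k)^*.
have hV : unitary_mx V.
  split=> h h'; rewrite /V.
    under eq_bigr do rewrite conjCK; rewrite U2 //.
  under eq_bigr do rewrite conjCK; rewrite U1 //.
have [g hg gE] := unitary_hom hV.
have key (U' V' : 'I_d -> 'I_d -> C) (f' g' : Od -> Od) : star_hom f' -> star_hom g' ->
    (forall h, f' (psi h) = \sum_k U' k h *: psi k) ->
    (forall h, g' (psi h) = \sum_k V' k h *: psi k) ->
    (forall h h', \sum_k V' h k * U' k h' = (h == h')%:R) -> cancel f' g'.
  move=> hf' hg' fE' gE' UV x.
  suff : g' \o f' =1 id by apply.
  apply: star_hom_ext; first exact: star_hom_comp.
    by split.
  move=> h /=; have [gl _ _] := hg'; rewrite fE' (lin_sum gl).
  transitivity (\sum_k \sum_j (V' j k * U' k h) *: psi j).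
    apply: eq_bigr => k _; rewrite (linZ gl) gE' scaler_sumr.
    by apply: eq_bigr => j _; rewrite scalerA mulrC.
  rewrite exchange_big /= (bigD1 h) //= -scaler_suml UV eqxx scale1r.
  rewrite big1 ?addr0 // => j jh.
  by rewrite -scaler_suml UV (negPf jh) scale0r.
have bf : bijective f.
  exists g.
    apply: (key U V) => // h h'; rewrite -U1; by apply: eq_bigr.
  apply: (key V U) => // h h'; rewrite -U2; by apply: eq_bigr.
by exists (CStarAut (conj hf bf)).
Qed.

(** Words of length n, nested in the same way as [tpow], so that the recursions for words, vectors
    and tensor powers match definitionally. *)
Fixpoint idx (n : nat) : finType :=
  if n is m.+1 then (idx m * 'I_d)%type else unit.

Fixpoint psiI n : idx n -> Od :=
  if n is m.+1 return idx n -> Od then fun p => psiI p.1 ** psi p.2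
  else fun=> cunit.

Lemma psiI_orth n (I J : idx n) :
  cs_adj (psiI I) ** psiI J = (I == J)%:R *: cunit.
Proof.
elim: n I J => [|n IH] /=.
  by move=> [] []; rewrite scale1r (unit_adj cunit_unit) (cs1l cunit_unit).
move=> [I i] [J j]; have [_ oo _] := cunitP.
rewrite /= cs_adjM -cs_mulA (cs_mulA (cs_adj (psiI I))) IH csZl csZr.
rewrite (cs1l cunit_unit) oo xpair_eqE.
by case: eqP => //= _; case: eqP; rewrite ?scale1r ?scale0r ?scaler0.
Qed.

Lemma psiI_sum n : \sum_(I : idx n) psiI I ** cs_adj (psiI I) = cunit.
Proof.
elim: n => [|n IH] /=.
  by rewrite (big_pred1 tt) ?(unit_adj cunit_unit) ?(cs1l cunit_unit) // => -[].
have [_ _ ss] := cunitP.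
rewrite -IH -(pair_bigA _ (fun I i => psiI I ** psi i ** cs_adj (psiI I ** psi i))) /=.
apply: eq_bigr => I _.
transitivity (psiI I ** (\sum_i psi i ** cs_adj (psi i)) ** cs_adj (psiI I)).
  rewrite cs_sumr cs_suml; apply: eq_bigr => i _.
  by rewrite cs_adjM !cs_mulA.
by rewrite ss (cs1r cunit_unit).
Qed.

Lemma psiI_ext n (a b : Od) : (forall I : idx n, a ** psiI I = b ** psiI I) -> a = b.
Proof.
move=> E; rewrite -[a](cs1r cunit_unit) -[b](cs1r cunit_unit) -(psiI_sum n) !cs_sumr.
by apply: eq_bigr => I _; rewrite !cs_mulA E.
Qed.

Section Embedded.
Variables (T : drCat R) (H : embedding T) (x : T) (e : 'I_d -> H x).
Hypothesis oe : onb e.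

Fixpoint eI n : idx n -> H (tpow x n) :=
  if n is m.+1 return idx n -> H (tpow x n) then fun p => emb_tens (eI p.1) (e p.2)
  else fun=> emb_unit.

Lemma eI_orth n (I J : idx n) : ip (eI I) (eI J) = (I == J)%:R.
Proof.
elim: n I J => [|n IH] /=; first by move=> [] []; rewrite emb_unit_ip.
move=> [I i] [J j]; rewrite emb_tens_ip IH (onb_ip oe) xpair_eqE.
by case: eqP => _; rewrite ?mul1r ?mul0r.
Qed.

Lemma eIE n (v : H (tpow x n)) : v = \sum_I ip (eI I) v *: eI I.
Proof.
elim: n v => [|n IH] /= v; first by rewrite (big_pred1 tt) -?emb_unitE // => -[].
apply: emb_tens_ext => u w; rewrite ip_sumr.
rewrite -(pair_bigA _ (fun I i => ip (emb_tens u w)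
   (ip (emb_tens (eI I) (e i)) v *: emb_tens (eI I) (e i)))) /=.
rewrite {1}(IH u) {1}(onbE oe w).
rewrite (lin_sum (emb_tens_linl _)) ip_suml; apply: eq_bigr => I _.
rewrite (linZ (emb_tens_linl _)) (lin_sum (emb_tens_linr _)) ipZl.
rewrite ip_suml mulr_sumr; apply: eq_bigr => j _.
rewrite (linZ (emb_tens_linr _)) ipZl ipZr emb_tens_ip.
by rewrite -!(ip_conj (eI I)) -!(ip_conj (e j)) mulrA mulrC.
Qed.

Definition vec (v : H x) : Od := \sum_k ip (e k) v *: psi k.
(** The linear copy of H (x^n) in O_d that sends e_I to psi_I; scalar products become multiples of
    the unit ([Psi_ip]). *)
Definition Psi n (v : H (tpow x n)) : Od := \sum_I ip (eI I) v *: psiI I.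

Lemma vec_lin : linear vec.
Proof.
move=> c v w; rewrite /vec scaler_sumr -big_split; apply: eq_bigr => k _ /=.
by rewrite ipDr ipZr scalerDl scalerA.
Qed.

Lemma Psi_lin n : linear (@Psi n).
Proof.
move=> c v w; rewrite /Psi scaler_sumr -big_split; apply: eq_bigr => k _ /=.
by rewrite ipDr ipZr scalerDl scalerA.
Qed.

Lemma vec_e k : vec (e k) = psi k.
Proof.
rewrite /vec (bigD1 k) //= (onb_ip oe) eqxx scale1r big1 ?addr0 // => j jk.
by rewrite (onb_ip oe) (negPf jk) scale0r.
Qed.

Lemma Psi_e n (I : idx n) : Psi (eI I) = psiI I.
Proof.
rewrite /Psi (bigD1 I) //= eI_orth eqxx scale1r big1 ?addr0 // => j jk.
by rewrite eI_orth (negPf jk) scale0r.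
Qed.

Lemma Psi_tens n (v : H (tpow x n)) (w : H x) :
  Psi (n := n.+1) (emb_tens v w) = Psi v ** vec w.
Proof.
rewrite /Psi /vec cs_suml /=.
rewrite -(pair_bigA _ (fun I i => ip (emb_tens (eI I) (e i)) (emb_tens v w) *:
  (psiI I ** psi i))) /=.
apply: eq_bigr => I _; rewrite cs_sumr; apply: eq_bigr => i _.
by rewrite emb_tens_ip csZl csZr scalerA.
Qed.

Lemma Psi_ip n (v w : H (tpow x n)) : cs_adj (Psi v) ** Psi w = ip v w *: cunit.
Proof.
rewrite {2}(eIE v) {2}(eIE w) ip_suml scaler_suml /Psi cs_adj_sum cs_suml.
apply: eq_bigr => I _; rewrite ip_sumr scaler_suml cs_sumr; apply: eq_bigr => J _.
rewrite cs_adjZ csZl csZr psiI_orth ipZl ipZr eI_orth !scalerA.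
by rewrite !mulrA.
Qed.

(** The sum of <e_I, t e_J> psi_I psi_J^* over all words I, J. It is determined by its products with
    the elements [Psi v] ([Theta_unique]), and its algebraic rules follow from that. *)
Definition Theta l m (t : arr (tpow x l) (tpow x m)) : Od :=
  \sum_(J : idx l) Psi (emb_hom H t (eI J)) ** cs_adj (psiI J).

Lemma Theta_Psi l m (t : arr (tpow x l) (tpow x m)) v :
  Theta t ** Psi v = Psi (emb_hom H t v).
Proof.
rewrite [in RHS](eIE v) (lin_sum (emb_lin t)) (lin_sum (@Psi_lin m)).
rewrite /Theta cs_suml; apply: eq_bigr => J _.
rewrite (linZ (emb_lin t)) (linZ (@Psi_lin m)) -cs_mulA -Psi_e Psi_ip csZr.
by rewrite (cs1r cunit_unit).
Qed.

Lemma Theta_unique l m (t : arr (tpow x l) (tpow x m)) a :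
  (forall v, a ** Psi v = Psi (emb_hom H t v)) -> a = Theta t.
Proof.
by move=> E; apply: (@psiI_ext l) => I; rewrite -Psi_e E Theta_Psi.
Qed.

Lemma Theta_lin l m : linear (@Theta l m).
Proof.
move=> c s t; apply/esym/Theta_unique => v.
by rewrite csDl csZl !Theta_Psi emb_homP (@Psi_lin m).
Qed.

Lemma Theta_comp l m n (s : arr (tpow x m) (tpow x n)) (t : arr (tpow x l) (tpow x m)) :
  Theta (s ∘ t) = Theta s ** Theta t.
Proof.
apply/esym/Theta_unique => v.
by rewrite -cs_mulA !Theta_Psi emb_hom_comp.
Qed.

Lemma Theta_adj l m (t : arr (tpow x l) (tpow x m)) :
  Theta (cadj t) = cs_adj (Theta t).
Proof.
apply/esym/Theta_unique => v; rewrite -[LHS](cs1l cunit_unit).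
rewrite -[RHS](cs1l cunit_unit) -(psiI_sum l) !cs_suml.
apply: eq_bigr => I _; rewrite -!cs_mulA; congr (_ ** _).
rewrite cs_mulA -cs_adjM -Psi_e Theta_Psi !Psi_ip.
by rewrite emb_hom_adj.
Qed.

Lemma Theta_stab l m (t : arr (tpow x l) (tpow x m)) :
  Theta (l := l.+1) (m := m.+1) (t ⊗ idc x) = Theta t.
Proof.
apply/esym/(@psiI_ext l.+1) => -[I i]; rewrite -Psi_e Theta_Psi /=.
by rewrite emb_tensH emb_hom_id !Psi_tens cs_mulA Theta_Psi.
Qed.

End Embedded.

Section Transport.
Variables (T : drCat R) (H H' : embedding T) (x : T) (e : 'I_d -> H x) (e' : 'I_d -> H' x).
Hypothesis (oe : onb e) (oe' : onb e').
Variables (W : natUnitary H H') (a : cstar_aut Od).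
Hypothesis aW : forall h, a (psi h) = vec e' (W _ (e h)).

Lemma aut_Psi n (v : H (tpow x n)) : a (Psi e v) = Psi e' (W _ v).
Proof.
have [al am aa] := aut_hom a.
have base (I : idx n) : a (psiI I) = Psi e' (W _ (eI e I)).
  elim: n I {v} => [|n IH] /=.
    by move=> _; rewrite nu_unit aut_unit (Psi_e _ (n := 0) tt).
  by move=> [I i]; rewrite am nu_tens Psi_tens IH aW.
rewrite {1}/Psi (lin_sum al) [in RHS](eIE oe v) (lin_sum (@nu_linear _ _ _ _ W _)).
rewrite (lin_sum (@Psi_lin _ _ _ e' n)); apply: eq_bigr => I _.
by rewrite (linZ al) (linZ (@nu_linear _ _ _ _ W _)) (linZ (@Psi_lin _ _ _ e' n)) base.
Qed.

(** Naturality of W: the automorphism intertwines the two copies of t. With [H' = H] and [e' = e] it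
    fixes [Theta t], so arrows lie in the fixed-point algebra. *)
Lemma aut_Theta l m (t : arr (tpow x l) (tpow x m)) : a (Theta e t) = Theta e' t.
Proof.
have [al am aa] := aut_hom a.
apply: (Theta_unique oe') => v; have [w <-] := nu_surj W v.
by rewrite -aut_Psi -am (Theta_Psi oe) aut_Psi nu_natural.
Qed.

End Transport.
End Cuntz.

(** Makes contractivity of *-homomorphisms available for [Theta] on endomorphisms. *)
Definition end_alg (R : realType) (T : cstarCat R) (x : T) : cstarAlg R :=
  @CStarAlg R (arr x x) (@ccomp _ _ x x x) (@cadj _ _ x x)
    (fun r s t => Defs.compA r s t) (fun s => comp_linl s) (fun t => comp_linr t)
    (@adjK _ _ x x) (@adj_antilin _ _ x x) (fun s t => adj_comp s t)
    (fun s t => norm_comp s t) (fun t => norm_adj t).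

Lemma end_alg_unit (R : realType) (T : cstarCat R) (x : T) :
  is_unit (idc x : end_alg x).
Proof. by move=> t; split; [exact: comp1c|exact: compc1]. Qed.

(** The mirror image of contractivity: a lower bound with some constant K improves to the constant 1
    along the powers h^(2^n). *)
Lemma sa_norm_le (R : realType) (A B : cstarAlg R) (f : A -> B) (K : cplx R) :
  star_hom f -> (forall x, `|x| <= K * `|f x|) ->
  forall x, cs_adj x = x -> `|x| <= `|f x|.
Proof.
move=> [fl fm fa] b h sh; have [->|h0] := eqVneq h 0; first by rewrite (lin0 fl) !normr0.
have nf : 0 < `|f h|.
  rewrite lt_neqAle normr_ge0 andbT eq_sym; apply: contra h0 => /eqP fh.
  by have := b h; rewrite fh mulr0 normr_le0.
have : `|h| / `|f h| <= 1.
  apply: (@pow2_bounded _ _ K); first by rewrite divr_ge0.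
  move=> n; rewrite expr_div_n ler_pdivrMr ?exprn_gt0 //.
  rewrite -(sqpow_norm n sh) -sqpow_norm -?fa ?sh //.
  have -> : sqpow n (f h) = f (sqpow n h) by elim: n => //= n ->; rewrite fm.
  exact: b.
by rewrite ler_pdivrMr // mul1r.
Qed.

(** * Isometric embedding of the arrows in the Cuntz algebra *)

Section ThetaNorm.
Variables (R : realType) (d : nat) (Od : cstarAlg R) (psi : 'I_d -> Od).
Hypothesis psi_cuntz : is_cuntz psi.
Local Notation C := (cplx R).
Local Notation cunit := (cunit psi_cuntz).
Variables (T : drCat R) (H : embedding T) (x : T) (e : 'I_d -> H x).
Hypothesis oe : onb e.
Local Notation Theta := (Theta psi_cuntz e).
Local Notation Psi := (Psi psi_cuntz e).

Lemma Theta_hom l : star_hom (fun t : end_alg (tpow x l) => Theta t).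
Proof.
split=> [c s t|s t|t]; first exact: Theta_lin.
  exact: (Theta_comp _ oe).
exact: (Theta_adj _ oe).
Qed.

Lemma Theta_contr l (t : arr (tpow x l) (tpow x l)) : `|Theta t| <= `|t|.
Proof. exact (@star_hom_contr _ (end_alg (tpow x l)) _ _ (Theta_hom l) _ (@end_alg_unit _ _ _) t). Qed.

Lemma eI_parseval l (v w : H (tpow x l)) :
  ip v w = \sum_(I : idx d l) ip v (eI e I) * ip (eI e I) w.
Proof.
rewrite {1}(eIE oe w) ip_sumr; apply: eq_bigr => I _.
by rewrite ipZr mulrC.
Qed.

Section NonZero.
Hypothesis nz : cunit != 0.

Lemma cunit_norm : `|cunit| = 1.
Proof.
have n0 : `|cunit| != 0 by rewrite normr_eq0.
apply: (mulfI n0); rewrite mulr1 -expr2 -cs_norm_adj.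
by rewrite (unit_adj (cunit_unit psi_cuntz)) (cs1l (cunit_unit psi_cuntz)).
Qed.

Lemma Psi_isom l (v : H (tpow x l)) : `|Psi v| = `|v|.
Proof.
apply/eqP; rewrite -(@eqrXn2 _ 2) // -cs_norm_adj Psi_ip // normrZ ip_norm.
by rewrite normrX normr_id cunit_norm mulr1.
Qed.

(** Arrows form a finite-dimensional space: t is expanded in an orthonormal basis, and its
    coefficients are controlled by the norms of the vectors t e_I, hence by [Theta t]. *)
Lemma Theta_bounded_below l : exists K : C,
  forall t : arr (tpow x l) (tpow x l), `|t| <= K * `|Theta t|.
Proof.
have [n [b ob]] := arr_onb H (tpow x l) (tpow x l).
exists (\sum_i (\sum_(I : idx d l) `|emb_hom H (b i) (eI e I)|) * `|b i|) => t.
have [_ _ bE] := ob; rewrite {1}(bE t) // mulr_suml.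
apply: (le_trans (ler_norm_sum _ _ _)); apply: ler_sum => i _.
rewrite normrZ -mulrA [`|b i| * _]mulrC mulrA ler_wpM2r // mulr_suml.
rewrite (hs_parseval _ _ (@eI_parseval l)).
apply: (le_trans (ler_norm_sum _ _ _)); apply: ler_sum => I _.
apply: (le_trans (ip_cauchy _ _)); rewrite ler_wpM2l //.
rewrite -Psi_isom -(Theta_Psi _ oe); apply: (le_trans (cs_normM _ _)).
rewrite Psi_isom -[leRHS]mulr1 ler_wpM2l // -(@ler_pXn2r _ 2) ?nnegrE //.
by rewrite -ip_norm (eI_orth oe) eqxx expr1n.
Qed.

Lemma Theta_isom l m (t : arr (tpow x l) (tpow x m)) : `|Theta t| = `|t|.
Proof.
have [K hK] := Theta_bounded_below l.
have E : `|Theta (cadj t ∘ t)| = `|cadj t ∘ t|.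
  apply/eqP; rewrite eq_le Theta_contr /=.
  apply: (sa_norm_le (Theta_hom l) hK (x := cadj t ∘ t)).
  by rewrite /= adj_comp adjK.
apply/eqP; rewrite -(@eqrXn2 _ 2) // -cs_norm_adj -norm_adj -E.
by rewrite (Theta_comp _ oe) (Theta_adj _ oe).
Qed.

End NonZero.

Lemma Theta_tens_stab l m (t : arr (tpow x l) (tpow x m)) r :
  Theta (tens_stab t r) = Theta t.
Proof. by elim: r => //= r IH; rewrite (Theta_stab _ oe). Qed.

Lemma Theta_norm_lim : ((0 < d)%N -> cunit != 0) ->
  forall l m (t : arr (tpow x l) (tpow x m)),
  `|tens_stab t r| @[r --> \oo] --> (`|Theta t| : C).
Proof.
move=> nz l m t; have [d0|/nz c0] := posnP d; last first.
  under eq_fun => r do rewrite -(Theta_isom c0) Theta_tens_stab.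
  exact: cvg_cst.
(* For d = 0 the unit is an empty sum and the algebra is zero. Then [idc x] is zero too and the
   sequence vanishes from r = 1 on; the term r = 0 need not vanish, hence the shift. *)
have cu0 : cunit = 0.
  have [_ _ <-] := cunitP psi_cuntz; apply: big1 => i _.
  by have := ltn_ord i; rewrite [X in (_ < X)%N]d0.
have -> : `|Theta t| = 0 by rewrite -(cs1l (cunit_unit psi_cuntz) (Theta t)) cu0 cs0l normr0.
have x0 : idc x = 0.
  apply: (@emb_hom_faithful _ _ H) => v.
  rewrite (lin0 (emb_arr_lin v)) emb_hom_id (onbE oe v) big1 // => i _.
  by have := ltn_ord i; rewrite [X in (_ < X)%N]d0.
rewrite -(cvg_shiftS (fun r => `|tens_stab t r|)).
under eq_fun => r do rewrite /= x0 (lin0 (tens_linr _)) normr0.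
exact: cvg_cst.
Qed.

End ThetaNorm.

(** * Construction of complete normed spaces and sub-C*-algebras *)

Record lsubspace (K : pzRingType) (V : lmodType K) := LSubspace {
  ss_set :> set V;
  ss_closed : GRing.submod_closed [pred x : V | x \in ss_set]
}.

Lemma submod_of_set (K : pzRingType) (V : lmodType K) (X : set V) :
  X 0 -> (forall c x y, X x -> X y -> X (c *: x + y)) ->
  GRing.submod_closed [pred x : V | x \in X].
Proof.
by move=> X0 Xl; split=> [|c x y]; rewrite ?inE //=; exact: Xl.
Qed.

Definition ss_type (K : pzRingType) (V : lmodType K) (X : lsubspace V) :=
  {x : V | [pred x : V | x \in ss_set X] x}.

Section SubspaceType.
Variables (K : pzRingType) (V : lmodType K) (X : lsubspace V).

HB.instance Definition _ := [isSub of ss_type X for @sval _ _].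
HB.instance Definition _ := [Choice of ss_type X by <:].
HB.instance Definition _ :=
  GRing.SubChoice_isSubLmodule.Build K V _ (ss_type X)
    (GRing.submod_closed_semi (ss_closed X)).

Lemma ss_valP (x : ss_type X) : ss_set X (val x).
Proof. by case: x => x /=; rewrite inE. Qed.

Definition ss_mk (x : V) (Xx : ss_set X x) : ss_type X := exist _ x (mem_set Xx).

End SubspaceType.

Lemma ss_val_lin (K : pzRingType) (V : lmodType K) (X : lsubspace V) :
  linear (val : ss_type X -> V).
Proof. by move=> c x y; rewrite GRing.valD GRing.valZ. Qed.

Section NormedBuilder.
Variables (R : realType).
Local Notation C := (cplx R).

(** Completeness is asked only of sequences whose k-th step is at most 2^-k, which is what each
    model can check directly. *)
Record norm_axioms (V : lmodType C) (n : V -> C) : Prop := NormAxioms {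
  na_D : forall x y, n (x + y) <= n x + n y;
  na_Z : forall c x, n (c *: x) = `|c| * n x;
  na_0 : forall x, n x = 0 -> x = 0;
  na_complete : forall y : nat -> V, (forall k, n (y k.+1 - y k) <= 2^-1 ^+ k) ->
    exists l, forall c, 0 < c -> exists N, forall m, (N <= m)%N -> n (l - y m) <= c
}.

Definition normed_of (V : lmodType C) (n : V -> C) (ax : norm_axioms n) : Type := V.

Section Build.
Variables (V : lmodType C) (n : V -> C) (ax : norm_axioms n).

HB.instance Definition _ := GRing.Lmodule.copy (normed_of ax) V.
HB.instance Definition _ := @Lmodule_isNormed.Build C (normed_of ax) n
  (na_D ax) (na_Z ax) (na_0 ax).

(** A Cauchy filter contains balls of radius 2^-(k+2). Consecutive ones meet, so their centres have
    steps at most 2^-k, and the limit of the centres is the limit of the filter. *)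
Lemma normed_of_complete (F : set_system (normed_of ax)) :
  ProperFilter F -> cauchy F -> cvg F.
Proof.
move=> FF cF.
have h (k : nat) : exists x : normed_of ax, F (ball x ((2^-1 : C) ^+ k.+2)).
  have cF' := (cauchyP F).1 cF.
  by apply: cF'; rewrite exprn_gt0 // invr_gt0.
have [y yF] := choice h.
have hy k : n (y k.+1 - y k) <= 2^-1 ^+ k.
  have [z [z1 z2]] := filter_ex (filterI (yF k) (yF k.+1)).
  move: z1 z2; rewrite -!ball_normE /= => z1 z2.
  rewrite -[n _]/(`|y k.+1 - y k|).
  have -> : y k.+1 - y k = (y k.+1 - z) - (y k - z) by rewrite opprB addrA subrK.
  apply: (le_trans (ler_normB _ _)); apply: (le_trans (lerD (ltW z2) (ltW z1))).
  have h3 : (2^-1 : C) ^+ k.+3 <= 2^-1 ^+ k.+1 by apply: ler_wiXn2l; rewrite ?half_ge0 ?half_le1 // ltnW.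
  have h2 : (2^-1 : C) ^+ k.+2 <= 2^-1 ^+ k.+1 by apply: ler_wiXn2l; rewrite ?half_ge0 ?half_le1.
  by apply: (le_trans (lerD h3 h2)); rewrite exprS -mulrDl half2 mul1r.
have [l hl] := na_complete ax hy.
apply/cvg_ex; exists (l : normed_of ax); apply/cvgrPdist_lt => c c0.
have c20 : 0 < c / 2 by rewrite divr_gt0.
have [N hN] := hl _ c20; have [M hM] := exists_pow2_lt c20.
apply: filterS (yF (maxn N M)) => x; rewrite -ball_normE /= => hx.
have -> : l - x = (l - y (maxn N M)) + (y (maxn N M) - x) by rewrite addrA subrK.
apply: (le_lt_trans (ler_normD _ _)); rewrite [ltRHS]splitr.
rewrite ler_ltD //; first by apply: hN; exact: leq_maxl.
apply: (lt_trans hx); apply: le_lt_trans hM.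
apply: ler_wiXn2l; rewrite ?half_ge0 ?half_le1 //.
by rewrite (leq_trans (leq_maxr N M)) // !leqW.
Qed.

HB.instance Definition _ := Uniform_isComplete.Build (normed_of ax) normed_of_complete.

End Build.
End NormedBuilder.

Definition build_cnm (R : realType) (V : lmodType (cplx R)) (n : V -> cplx R)
  (ax : norm_axioms n) : completeNormedModType (cplx R) := normed_of ax.

Lemma build_cnm_norm (R : realType) (V : lmodType (cplx R)) (n : V -> cplx R)
  (ax : norm_axioms n) (x : build_cnm ax) : `|x| = n x.
Proof. by []. Qed.

Section ClosedSubalgebra.
Variables (R : realType) (A : cstarAlg R) (X : lsubspace A).
Local Notation C := (cplx R).
Hypothesis X_mul : forall x y, ss_set X x -> ss_set X y -> ss_set X (cs_mul x y).
Hypothesis X_adj : forall x, ss_set X x -> ss_set X (cs_adj x).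
Hypothesis X_closed : closed (ss_set X).

Let nrm (x : ss_type X) : C := `|val x|.

Lemma sub_norm_axioms : norm_axioms nrm.
Proof.
split.
- by move=> x y; rewrite /nrm GRing.valD ler_normD.
- by move=> c x; rewrite /nrm GRing.valZ normrZ.
- by move=> x /normr0_eq0 x0; apply: val_inj; rewrite x0 raddf0.
- move=> y hy.
  have hy' k : `|val (y k.+1) - val (y k)| <= 2^-1 ^+ k by rewrite -GRing.valB; exact: hy.
  have [l yl] := geometric_cvg hy'.
  have Xl : ss_set X l.
    apply: X_closed => B nB; have [N _ hN] := yl _ nB.
    by exists (val (y N)); split; [exact: ss_valP|exact: hN (leqnn N)].
  exists (ss_mk Xl) => c c0; have [N hN] := cvg_norm_lt yl c0.
  by exists N => m Nm; rewrite /nrm GRing.valB ltW // hN.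
Qed.

Let S := build_cnm sub_norm_axioms.

Definition sub_mul (x y : S) : S := ss_mk (X_mul (ss_valP x) (ss_valP y)).
Definition sub_adj (x : S) : S := ss_mk (X_adj (ss_valP x)).

Let v (x : S) : A := val (x : ss_type X).
Let vlin : linear v. Proof. exact: ss_val_lin. Qed.

Definition sub_alg : cstarAlg R.
Proof.
apply: (@CStarAlg R S sub_mul sub_adj).
- by move=> x y z; apply: val_inj; exact: cs_mulA.
- move=> y c x z; apply: val_inj; rewrite -[LHS]/(cs_mul (v (c *: x + z)) (v y)).
  by rewrite -[RHS]/(v (c *: sub_mul x y + sub_mul z y)) !vlin; exact: cs_mul_linl.
- move=> y c x z; apply: val_inj; rewrite -[LHS]/(cs_mul (v y) (v (c *: x + z))).
  by rewrite -[RHS]/(v (c *: sub_mul y x + sub_mul y z)) !vlin; exact: cs_mul_linr.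
- by move=> x; apply: val_inj; exact: cs_adjK.
- move=> c x y; apply: val_inj; rewrite -[LHS]/(cs_adj (v (c *: x + y))).
  by rewrite -[RHS]/(v (c^* *: sub_adj x + sub_adj y)) !vlin; exact: cs_adj_antilin.
- by move=> x y; apply: val_inj; exact: cs_adjM.
- by move=> x y; exact: cs_normM.
- by move=> x; exact: cs_norm_adj.
Defined.

Definition sub_incl (x : sub_alg) : A := val (x : ss_type X).

Lemma sub_incl_onto : star_iso_onto sub_incl (ss_set X).
Proof.
split.
- by split=> //; exact: ss_val_lin.
- exact: val_inj.
- apply/seteqP; split=> [_ [x _ <-]|x Xx]; first exact: ss_valP.
  by exists (ss_mk Xx).
Qed.

Lemma sub_incl_norm (x : sub_alg) : `|sub_incl x| = `|x|.
Proof. by []. Qed.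

End ClosedSubalgebra.

(** * A nonzero Cuntz family *)

Section SquareSummable.
Variable R : realType.
Local Notation C := (cplx R).
Local Notation V := (nat -> (C : lmodType C)).
Implicit Types f g h : V.

Definition psum n f g : C := \sum_(i < n) (f i)^* * g i.

Definition l2_set : set V := [set f | exists M : C, forall n, psum n f f <= M].

Lemma psum_sesqform n : sesqform (psum n : V -> V -> C).
Proof.
split=> [f c g h|f g].
  rewrite /psum mulr_sumr -big_split; apply: eq_bigr => i _ /=.
  by rewrite mulrDr mulrCA.
rewrite rmorph_sum; apply: eq_bigr => i _ /=.
by rewrite rmorphM /= conjCK mulrC.
Qed.

Lemma psum_ge0 n f : 0 <= psum n f f.
Proof. by apply: sumr_ge0 => i _; rewrite mulrC -normCK exprn_ge0. Qed.

Lemma psum_mono m n f : (m <= n)%N -> psum m f f <= psum n f f.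
Proof.
move=> mn; rewrite /psum -(subnKC mn) big_split_ord /= lerDl.
by apply: sumr_ge0 => i _; rewrite mulrC -normCK exprn_ge0.
Qed.

Lemma psum_comb n c f g : psum n (c *: f + g) (c *: f + g) <=
  2 * (`|c| ^+ 2 * psum n f f) + 2 * psum n g g.
Proof.
have s := psum_sesqform n.
have h : 0 <= psum n (c *: f - g) (c *: f - g) := psum_ge0 _ _.
rewrite -subr_ge0; move: h; congr (0 <= _).
rewrite !(sqDr s, sqDl s, sqZl s, sqZr s, sqNl s, sqNr s) normCK; ring.
Qed.

Lemma l2_closed : GRing.submod_closed [pred f : V | f \in l2_set].
Proof.
apply: submod_of_set.
  by exists 0 => n; rewrite (sq0r (psum_sesqform n)).
move=> c f g [M hM] [N hN]; exists (2 * (`|c| ^+ 2 * M) + 2 * N) => n.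
apply: (le_trans (psum_comb _ _ _ _)).
by rewrite lerD // ler_wpM2l // ler_wpM2l // exprn_ge0.
Qed.

Definition l2_sub : lsubspace (V : lmodType C) := LSubspace l2_closed.

Lemma psum_diag_cvg f : l2_set f -> exists l : C, psum n f f @[n --> \oo] --> l.
Proof.
move=> [M hM]; pose r n : R := complex.Re (psum n f f).
have rE n : psum n f f = (real_complex R (r n) : C).
  by rewrite RRe_real // ger0_real // psum_ge0.
have : cvgn r.
  apply: nondecreasing_is_cvgn.
    by move=> m n mn; rewrite -lecR -!rE psum_mono.
  exists (complex.Re M) => _ [n _ <-].
  by have := hM n; rewrite rE lecE /= => /andP[].
move=> /cvg_ex [l hl]; exists (real_complex R l : C).
under eq_fun do rewrite rE.
apply/cvgrPdist_lt => e /real_cplx [-> e0].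
move/cvgrPdist_lt : hl => /(_ _ e0); apply: filterS => n h.
by rewrite -rmorphB normc_def /= expr0n /= addr0 sqrtr_sqr ltcR.
Qed.

(** Polarization reduces mixed sums to diagonal ones, which converge by monotonicity. *)
Lemma psum_cvg f g : l2_set f -> l2_set g -> exists l : C, psum n f g @[n --> \oo] --> l.
Proof.
move=> hf hg; have [_ lin] := l2_closed.
have cl c : l2_set (c *: f + g).
  by have := lin c f g; rewrite !inE => /(_ hf hg).
have pol n : psum n f g = 4^-1 * (psum n (1 *: f + g) (1 *: f + g)
   - psum n (-1 *: f + g) (-1 *: f + g)
   - 'i * psum n (- 'i *: f + g) (- 'i *: f + g)
   + 'i * psum n ('i *: f + g) ('i *: f + g)).
  have s := psum_sesqform n; have ii : 'i * 'i = -1 :> C by rewrite -expr2 sqrCi.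
  rewrite !(sqDr s, sqDl s, sqZl s, sqZr s) !rmorphN /= conjCi conjC1.
  apply: (mulfI (_ : (4 : C) != 0)); first by rewrite pnatr_eq0.
  rewrite mulrA mulfV ?pnatr_eq0 // mul1r.
  move: (psum n f f) (psum n f g) (psum n g f) (psum n g g) => a b c d.
  transitivity (2 * b - 2 * (('i * 'i) * b) + 2 * ('i * 'i + 1) * c); first by rewrite ii; ring.
  ring.
have [l1 h1] := psum_diag_cvg (cl 1); have [l2 h2] := psum_diag_cvg (cl (-1)).
have [l3 h3] := psum_diag_cvg (cl (- 'i)); have [l4 h4] := psum_diag_cvg (cl 'i).
exists (4^-1 * (l1 - l2 - 'i * l3 + 'i * l4)); under eq_fun do rewrite pol.
exact: (cvgM (cvg_cst _) (cvgD (cvgB (cvgB h1 h2) (cvgM (cvg_cst _) h3)) (cvgM (cvg_cst _) h4))).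
Qed.

Definition l2 := ss_type l2_sub.
Definition fn (x : l2) : V := val x.

Definition l2ip (x y : l2) : C := sval (cid (psum_cvg (ss_valP x) (ss_valP y))).

Lemma l2ipP x y : psum n (fn x) (fn y) @[n --> \oo] --> l2ip x y.
Proof. exact: (svalP (cid (psum_cvg (ss_valP x) (ss_valP y)))). Qed.

Arguments l2ipP : clear implicits.

Lemma l2ip_eq x y (l : C) : psum n (fn x) (fn y) @[n --> \oo] --> l -> l2ip x y = l.
Proof.
move=> h; have hp := l2ipP x y.
have FT : (\oo : set_system nat) setT by exact: filterT.
exact (cvg_eq_lim FT hp h (fun _ _ => erefl)).
Qed.

Lemma fn_lin : linear fn. Proof. exact: ss_val_lin. Qed.

Lemma l2ip_sesqform : sesqform (l2ip : l2 -> l2 -> C).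
Proof.
split=> [x c y z|x y]; apply: l2ip_eq.
  rewrite (_ : (fun n => _) = fun n => c * psum n (fn x) (fn y) + psum n (fn x) (fn z)).
    exact: (cvgD (cvgM (cvg_cst _) (l2ipP x y)) (l2ipP x z)).
  by apply/funext => n; rewrite fn_lin (psum_sesqform n).1.
rewrite (_ : (fun n => _) = fun n => (psum n (fn x) (fn y))^*).
  exact: cvg_conjC (l2ipP x y).
by apply/funext => n; rewrite (sq_conj (psum_sesqform n)).
Qed.

Lemma psum_le_ip n x : psum n (fn x) (fn x) <= l2ip x x.
Proof.
rewrite -subr_ge0; apply: (@cvg_ge0_lim R nat \oo _ (fun m => (n <= m)%N)
  (fun m => psum m (fn x) (fn x) - psum n (fn x) (fn x))).
- by exists n.
- exact: (cvgB (l2ipP x x) (cvg_cst _)).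
- by move=> m nm; rewrite subr_ge0 psum_mono.
Qed.

Lemma l2ip_le x M : (forall n, psum n (fn x) (fn x) <= M) -> l2ip x x <= M.
Proof.
move=> h; rewrite -subr_ge0; apply: (@cvg_ge0_lim R nat \oo _ setT
  (fun m => M - psum m (fn x) (fn x))).
- exact: filterT.
- exact: (cvgB (cvg_cst _) (l2ipP x x)).
- by move=> m _; rewrite subr_ge0.
Qed.

Lemma l2ip_ge0 x : 0 <= l2ip x x.
Proof. by apply: le_trans (psum_le_ip 0 x); exact: psum_ge0. Qed.

Lemma fn_le x i : `|fn x i| ^+ 2 <= l2ip x x.
Proof.
apply: le_trans (psum_le_ip i.+1 x); rewrite /psum big_ord_recr /= mulrC -normCK.
by rewrite lerDr psum_ge0.
Qed.

Lemma l2ip_def x : l2ip x x = 0 -> x = 0.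
Proof.
move=> x0; apply: val_inj; apply/funext => i.
have := fn_le x i; rewrite x0 -[fn x]/(val x) => h.
have : `|val x i| ^+ 2 == 0 by rewrite eq_le h exprn_ge0.
by rewrite expf_eq0 /= normr_eq0 => /eqP ->.
Qed.

Definition l2norm (x : l2) : C := sqrtC (l2ip x x).

Lemma l2norm_ge0 x : 0 <= l2norm x.
Proof. by rewrite sqrtC_ge0 l2ip_ge0. Qed.

Lemma l2norm_sq x : l2norm x ^+ 2 = l2ip x x.
Proof. exact: sqrtCK. Qed.

Lemma Cr_complete (y : nat -> C) : (forall n, `|y n.+1 - y n| <= 2^-1 ^+ n) ->
  exists l : C, y @ \oo --> l.
Proof.
move=> hy.
have sm (e : R) : 0 < e -> exists n, 2^-1 ^+ n < e.
  move=> e0; have [|n] := @exists_pow2_lt R (real_complex R e); first by rewrite ltcR.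
  have -> : (2^-1 : C) = real_complex R (2^-1) by rewrite fmorphV rmorph_nat.
  by rewrite -rmorphXn ltcR => h; exists n.
have b n : complex.Re `|y n.+1 - y n| <= (2^-1 : R) ^+ n.
  have := hy n; have -> : (2^-1 : C) = real_complex R (2^-1) by rewrite fmorphV rmorph_nat.
  by rewrite -rmorphXn normc_def lecR.
have [a ha] := @geometric_cvg0 R sm R (fun n => complex.Re (y n)) (fun n =>
  le_trans (eq_ind_r (fun z => `|z| <= _) (norm_Re (y n.+1 - y n)) (cReB _ _)) (b n)).
have [c hc] := @geometric_cvg0 R sm R (fun n => complex.Im (y n)) (fun n =>
  le_trans (eq_ind_r (fun z => `|z| <= _) (norm_Im (y n.+1 - y n)) (cImB _ _)) (b n)).
exists (mkc a c).
have yE : y = fun n => mkc (complex.Re (y n)) (complex.Im (y n)).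
  by apply/funext => n; case: (y n).
rewrite yE; have hp : (fun n => (complex.Re (y n), complex.Im (y n))) @ \oo --> ((a, c) : R * R).
  by have h3 := cvg_pair ha hc; apply h3; typeclasses eauto.
exact (cvg_comp _ _ hp (@mkc_continuous R (a, c))).
Qed.

Lemma l2norm_D x y : l2norm (x + y) <= l2norm x + l2norm y.
Proof.
have s := l2ip_sesqform; rewrite -(@ler_pXn2r _ 2) ?nnegrE ?addr_ge0 ?l2norm_ge0 //.
rewrite l2norm_sq (sqDr s) !(sqDl s) sqrrD !l2norm_sq.
have h : `|l2ip x y| <= l2norm x * l2norm y.
  rewrite -(@ler_pXn2r _ 2) ?nnegrE ?mulr_ge0 ?l2norm_ge0 //.
  rewrite exprMn !l2norm_sq; apply: (sq_cauchy s); [exact: l2ip_ge0|exact: l2ip_def].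
rewrite -subr_ge0.
have -> : l2ip x x + l2norm x * l2norm y *+ 2 + l2ip y y -
   (l2ip x x + l2ip y x + (l2ip x y + l2ip y y)) =
   l2norm x * l2norm y *+ 2 - (l2ip x y + l2ip y x) by ring.
have rr : l2ip x y + l2ip y x \is Num.real.
  by rewrite CrealE rmorphD /= -!(sq_conj s) addrC.
rewrite subr_ge0; apply: (le_trans (real_ler_norm rr)).
apply: (le_trans (ler_normD _ _)); rewrite (sq_conj s x y) norm_conjC mulr2n.
exact: lerD.
Qed.

Lemma l2norm_le x (c : C) : 0 <= c ->
  (forall n, psum n (fn x) (fn x) <= c ^+ 2) -> l2norm x <= c.
Proof.
move=> c0 h; rewrite -(@ler_pXn2r _ 2) ?nnegrE ?l2norm_ge0 //.
by rewrite l2norm_sq; exact: l2ip_le.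
Qed.

(** The limit is taken coordinatewise; the estimate for each finite partial sum passes to the limit
    and gives both summability and the distance bound. *)
Lemma l2_complete (y : nat -> l2) : (forall k, l2norm (y k.+1 - y k) <= 2^-1 ^+ k) ->
  exists l, forall k, l2norm (l - y k) <= 2 * 2^-1 ^+ k.
Proof.
move=> hy; have p0 k : 0 <= (2^-1 : C) ^+ k by rewrite exprn_ge0 // half_ge0.
have bound k m : l2norm (y (k + m)%N - y k) <= 2 * 2^-1 ^+ k - 2 * 2^-1 ^+ (k + m).
  elim: m => [|m IH].
    by rewrite addn0 !subrr /l2norm (sq0r l2ip_sesqform) sqrtC0.
  rewrite addnS (_ : y _ - y k = (y (k + m).+1 - y (k + m)%N) + (y (k + m)%N - y k)).
    apply: (le_trans (l2norm_D _ _)); apply: (le_trans (lerD (hy _) IH)).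
    by rewrite le_eqVlt; apply/orP; left; apply/eqP; rewrite exprS; field.
  by rewrite addrA subrK.
have dist k m : (k <= m)%N -> l2norm (y m - y k) <= 2 * 2^-1 ^+ k.
  move=> km; rewrite -(subnKC km); apply: (le_trans (bound _ _)).
  by rewrite gerBl mulr_ge0.
have coord i k : `|fn (y k.+1) i - fn (y k) i| <= 2^-1 ^+ k.
  rewrite -(@ler_pXn2r _ 2) ?nnegrE // -[fn _ i - fn _ i]/((fn (y k.+1) - fn (y k)) i).
  rewrite -(linB fn_lin); apply: (le_trans (fn_le _ _)); rewrite -l2norm_sq.
  by rewrite ler_pXn2r ?nnegrE ?l2norm_ge0.
have [g gl] := choice (fun i => Cr_complete (coord i)).
have gb n k : psum n (g - fn (y k)) (g - fn (y k)) <= (2 * 2^-1 ^+ k) ^+ 2.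
  rewrite -subr_ge0; apply: (@cvg_ge0_lim R nat \oo _ (fun m => (k <= m)%N)
    (fun m => (2 * 2^-1 ^+ k) ^+ 2 - psum n (fn (y m) - fn (y k)) (fn (y m) - fn (y k)))).
  - by exists k.
  - have ci i : fn (y m) i - fn (y k) i @[m --> \oo] --> g i - fn (y k) i.
      exact: (cvgB (gl i) (cvg_cst _)).
    apply: (cvgB (cvg_cst _)); apply: cvg_bigsum => i.
    exact: (cvgM (cvg_conjC (ci i)) (ci i)).
  - move=> m km; rewrite subr_ge0 -(linB fn_lin).
    apply: (le_trans (psum_le_ip _ _)); rewrite -l2norm_sq.
    by rewrite ler_pXn2r ?nnegrE ?l2norm_ge0 ?mulr_ge0 //; exact: dist.
have l2g : l2_set g.
  have [_ lin] := l2_closed.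
  have h0 : l2_set (g - fn (y 0%N)) by exists ((2 * 2^-1 ^+ 0) ^+ 2) => n; exact: gb.
  have := lin 1 (g - fn (y 0%N)) (fn (y 0%N)); rewrite !inE scale1r subrK; apply=> //.
  exact: (ss_valP (y 0%N)).
exists (ss_mk (X := l2_sub) l2g) => k; apply: l2norm_le => [|n].
  by rewrite mulr_ge0.
by rewrite (linB fn_lin); exact: gb.
Qed.

Lemma l2_norm_axioms : norm_axioms l2norm.
Proof.
have s := l2ip_sesqform; split; first exact: l2norm_D.
- move=> c x; rewrite /l2norm (sqZl s) (sqZr s) mulrA [c^* * c]mulrC -normCK.
  by rewrite sqrtCM ?nnegrE ?exprn_ge0 ?l2ip_ge0 // sqrCK.
- by move=> x /eqP; rewrite sqrtC_eq0 => /eqP; exact: l2ip_def.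
- move=> y /l2_complete [l hl]; exists l => c c0.
  have [N hN] := exists_pow2_lt (divr_gt0 c0 (ltr0Sn _ 1)).
  exists N => m Nm; apply: (le_trans (hl m)).
  rewrite mulrC -ler_pdivlMr // (le_trans _ (ltW hN)) //.
  by apply: ler_wiXn2l; rewrite ?half_ge0 ?half_le1.
Qed.

Definition l2_hilbert : hilbert R.
Proof.
apply: (@Hilbert R (build_cnm l2_norm_axioms) l2ip).
- by move=> x c y z; rewrite -(l2ip_sesqform.1 x c y z).
- by move=> x y; exact: (sq_conj l2ip_sesqform).
- by move=> x; rewrite build_cnm_norm l2norm_sq.
Defined.

End SquareSummable.

(** * The C*-algebra of bounded operators on a Hilbert space *)

Section BoundedOperators.
Variables (R : realType) (K : hilbert R).
Local Notation C := (cplx R).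
Local Notation V := (K -> (K : lmodType C)).

Definition is_adj (T T' : V) := forall x y, ip (T x) y = ip x (T' y).
Definition bounded_by (T : V) (M : C) := forall x, `|T x| <= M * `|x|.
(** The existence of an adjoint is built in; linearity follows from it ([adj_linear]). *)
Definition bop_set : set V := [set T | exists T', is_adj T T' /\ exists M, bounded_by T M].

Lemma is_adjC (T T' : V) : is_adj T T' -> is_adj T' T.
Proof. by move=> h x y; rewrite ip_conj -h -ip_conj. Qed.

Lemma adj_linear (T T' : V) : is_adj T T' -> linear T.
Proof.
move=> /is_adjC h c x y; apply: ip_ext => w.
by rewrite -h ipDr ipZr !h ipDr ipZr.
Qed.

Lemma bop_closed : GRing.submod_closed [pred T : V | T \in bop_set].
Proof.
apply: submod_of_set.
  exists (fun=> 0); split; first by move=> x y; rewrite ip0l ip0r.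
  by exists 0 => x; rewrite mul0r normr0.
move=> c T S [T' [hT [M hM]]] [S' [hS [N hN]]].
exists (fun y => c^* *: T' y + S' y); split.
  by move=> x y; rewrite -[(_ + _) x]/(c *: T x + S x) ipDl ipZl ipDr ipZr hT hS.
exists (`|c| * M + N) => x; rewrite -[(_ + _) x]/(c *: T x + S x).
apply: (le_trans (ler_normD _ _)); rewrite normrZ mulrDl lerD //.
by rewrite -mulrA ler_wpM2l.
Qed.

Definition bop_sub : lsubspace (V : lmodType C) := LSubspace bop_closed.
Definition bop := ss_type bop_sub.
Implicit Types T S : bop.

Definition bfun (T : bop) : V := val T.

Lemma bfun_ex (T : bop) : exists T' : V, is_adj (bfun T) T' /\ exists M, bounded_by (bfun T) M.
Proof. exact: (ss_valP T). Qed.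

Lemma bfun_lin (T : bop) : linear (bfun T).
Proof. by have [T' [/adj_linear]] := bfun_ex T. Qed.

Lemma bfunD c (T S : bop) x : bfun (c *: T + S) x = c *: bfun T x + bfun S x.
Proof. by rewrite /bfun (@ss_val_lin _ _ bop_sub c T S). Qed.

Lemma bfunB (T S : bop) x : bfun (T - S) x = bfun T x - bfun S x.
Proof.
have -> : T - S = (-1) *: S + T by rewrite scaleN1r addrC.
by rewrite bfunD scaleN1r addrC.
Qed.

Let nset (T : bop) : set R := [set complex.Re `|bfun T x| | x in [set x | `|x| <= 1]].

Definition opn (T : bop) : C := real_complex R (sup (nset T)).

Let nset_sup (T : bop) : has_sup (nset T).
Proof.
have [_ [_ [M hM]]] := bfun_ex T; split.
  by exists (complex.Re `|bfun T 0|), 0; rewrite /= ?normr0.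
exists (complex.Re `|M|) => _ [x /= x1 <-].
have h : `|bfun T x| <= `|M|.
  rewrite -[leLHS]normr_id; have E : `|bfun T x| <= `| `|bfun T x| | by rewrite normr_id.
  have h0 : 0 <= M * `|x| by apply: le_trans (hM x).
  rewrite normr_id; apply: (le_trans (hM x)); rewrite -(ger0_norm h0) normrM normr_id.
  by rewrite -[leRHS]mulr1 ler_wpM2l.
by move: h; rewrite lecE => /andP[].
Qed.

Lemma opn_ge0 T : 0 <= opn T.
Proof.
rewrite -(rmorph0 (real_complex R)) lecR.
apply: (@le_trans _ _ (complex.Re `|bfun T 0|)); first by rewrite (lin0 (bfun_lin T)) normr0.
by apply: (ub_le_sup (nset_sup T).2); exists 0; rewrite /= ?normr0.
Qed.

Lemma opn_le T x : `|bfun T x| <= opn T * `|x|.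
Proof.
have [->|x0] := eqVneq x 0; first by rewrite (lin0 (bfun_lin T)) !normr0 mulr0.
have nx : 0 < `|x| by rewrite normr_gt0.
rewrite -ler_pdivrMr // mulrC.
have -> : `|x|^-1 * `|bfun T x| = `|bfun T (`|x|^-1 *: x)|.
  by rewrite (linZ (bfun_lin T)) normrZ normfV normr_id.
set y := _ *: x.
have y1 : `|y| <= 1 by rewrite normrZ normfV normr_id mulVf // gt_eqF.
rewrite (_ : `|bfun T y| = real_complex R (complex.Re `|bfun T y|)); last first.
  by rewrite RRe_real // normr_real.
by rewrite lecR; apply: (ub_le_sup (nset_sup T).2); exists y.
Qed.

Lemma opn_lub T M : 0 <= M -> bounded_by (bfun T) M -> opn T <= M.
Proof.
move=> M0 hM; rewrite (_ : M = real_complex R (complex.Re M)); last first.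
  by rewrite RRe_real // ger0_real.
rewrite lecR; apply: ge_sup; first exact: (nset_sup T).1.
move=> _ [x /= x1 <-]; have : `|bfun T x| <= M.
  by apply: (le_trans (hM x)); rewrite -[leRHS]mulr1 ler_wpM2l.
by rewrite lecE => /andP[].
Qed.

Lemma bop_adj_ex (T : bop) : exists S : bop, is_adj (bfun T) (bfun S).
Proof.
have [T' [hT [M hM]]] := bfun_ex T.
suff hb : bop_set T' by exists (ss_mk (X := bop_sub) hb).
exists (bfun T); split; first exact: is_adjC.
exists (opn T) => y; have [->|y0] := eqVneq (T' y) 0.
  by rewrite normr0 mulr_ge0 ?opn_ge0.
have ny : 0 < `|T' y| by rewrite normr_gt0.
rewrite -(@ler_pM2l _ `|T' y|) // -expr2 -ip_norm -hT.
have -> : ip (bfun T (T' y)) y = `|ip (bfun T (T' y)) y| by rewrite hT ger0_norm ?ip_ge0.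
apply: (le_trans (ip_cauchy _ _)); rewrite mulrA ler_wpM2r // mulrC.
exact: opn_le.
Qed.

Definition badj (T : bop) : bop := sval (cid (bop_adj_ex T)).
Lemma badjP (T : bop) x y : ip (bfun T x) y = ip x (bfun (badj T) y).
Proof. exact: (svalP (cid (bop_adj_ex T))). Qed.

Lemma bop_eq (T S : bop) : bfun T =1 bfun S -> T = S.
Proof. by move=> h; apply: val_inj; apply/funext. Qed.

Lemma badj_eq (T S : bop) : is_adj (bfun T) (bfun S) -> badj T = S.
Proof. by move=> h; apply: bop_eq => y; apply: ip_ext => w; rewrite -badjP -h. Qed.

Lemma badjK T : badj (badj T) = T.
Proof. by apply: badj_eq; apply: is_adjC => x y; exact: badjP. Qed.

Lemma bmul_ex (T S : bop) : bop_set (bfun T \o bfun S).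
Proof.
exists (bfun (badj S) \o bfun (badj T)); split.
  by move=> x y /=; rewrite !badjP.
exists (opn T * opn S) => x /=; apply: (le_trans (opn_le _ _)).
by rewrite -mulrA ler_wpM2l ?opn_ge0 // opn_le.
Qed.

Definition bmul (T S : bop) : bop := ss_mk (X := bop_sub) (bmul_ex T S).

Lemma bmulE T S x : bfun (bmul T S) x = bfun T (bfun S x). Proof. by []. Qed.

Lemma opn_mul T S : opn (bmul T S) <= opn T * opn S.
Proof.
apply: opn_lub => [|x]; first by rewrite mulr_ge0 ?opn_ge0.
rewrite bmulE; apply: (le_trans (opn_le _ _)).
by rewrite -mulrA ler_wpM2l ?opn_ge0 // opn_le.
Qed.

Lemma opn_adj_le T : opn (badj T) <= opn T.
Proof.
apply: opn_lub => [|y]; first exact: opn_ge0.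
have [->|y0] := eqVneq (bfun (badj T) y) 0.
  by rewrite normr0 mulr_ge0 ?opn_ge0.
have ny : 0 < `|bfun (badj T) y| by rewrite normr_gt0.
rewrite -(@ler_pM2l _ `|bfun (badj T) y|) // -expr2 -ip_norm -badjP.
have -> : ip (bfun T (bfun (badj T) y)) y = `|ip (bfun T (bfun (badj T) y)) y|.
  by rewrite badjP ger0_norm ?ip_ge0.
apply: (le_trans (ip_cauchy _ _)); rewrite mulrA ler_wpM2r // mulrC.
exact: opn_le.
Qed.

Lemma opn_adj T : opn (badj T) = opn T.
Proof. by apply/eqP; rewrite eq_le opn_adj_le -{1}[T]badjK opn_adj_le. Qed.

Lemma opn_cstar T : opn (bmul (badj T) T) = opn T ^+ 2.
Proof.
apply/eqP; rewrite eq_le; apply/andP; split.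
  by apply: (le_trans (opn_mul _ _)); rewrite opn_adj expr2.
pose s := sqrtC (opn (bmul (badj T) T)).
have s0 : 0 <= s by rewrite sqrtC_ge0 opn_ge0.
have s2 : s ^+ 2 = opn (bmul (badj T) T) by exact: sqrtCK.
rewrite -s2 ler_pXn2r ?nnegrE ?opn_ge0 //; apply: opn_lub => // x.
rewrite -(@ler_pXn2r _ 2) ?nnegrE ?mulr_ge0 // -ip_norm badjP -bmulE.
have -> : ip x (bfun (bmul (badj T) T) x) = `|ip x (bfun (bmul (badj T) T) x)|.
  by rewrite bmulE -badjP ger0_norm ?ip_ge0.
apply: (le_trans (ip_cauchy _ _)); rewrite exprMn s2 expr2 mulrCA ler_wpM2l //.
exact: opn_le.
Qed.

Lemma bop_norm_axioms : norm_axioms opn.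
Proof.
split.
- move=> T S; apply: opn_lub => [|x]; first by rewrite addr_ge0 ?opn_ge0.
  rewrite -[T]scale1r bfunD scale1r scale1r; apply: (le_trans (ler_normD _ _)).
  by rewrite mulrDl lerD // opn_le.
- have h c T : opn (c *: T) <= `|c| * opn T.
    apply: opn_lub => [|x]; first by rewrite mulr_ge0 ?opn_ge0.
    rewrite -[c *: T]addr0 bfunD -[bfun 0 x]/((val (0 : bop) : V) x) raddf0 addr0.
    by rewrite normrZ -mulrA ler_wpM2l // opn_le.
  move=> c T; apply/eqP; rewrite eq_le h /=.
  have [->|c0] := eqVneq c 0; first by rewrite normr0 mul0r opn_ge0.
  have := h c^-1 (c *: T); rewrite scalerA mulVf // scale1r normfV.
  by rewrite mulrC ler_pdivlMr ?normr_gt0 // mulrC.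
- move=> T T0; apply: bop_eq => x; rewrite -[bfun 0 x]/((val (0 : bop) : V) x) raddf0.
  apply/eqP; rewrite -normr_le0; apply: (le_trans (opn_le _ _)).
  by rewrite T0 mul0r.
- move=> y hy.
  have hyx (z : nat -> bop) : (forall k, opn (z k.+1 - z k) <= 2^-1 ^+ k) ->
      forall x, exists l, forall n, `|l - bfun (z n) x| <= 2 * 2^-1 ^+ n * `|x|.
    move=> hz x; apply: geometric_lim => n.
    apply: (@le_trans _ _ (opn (z n.+1 - z n) * `|x|)); last by rewrite ler_wpM2r.
    rewrite (_ : _ - _ = bfun (z n.+1 - z n) x); first exact: opn_le.
    by rewrite bfunB.
  have [L LP] := choice (hyx y hy).
  (* The adjoints converge at the same rate; their pointwise limit will be the adjoint of the
     limit. *)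
  have hy' k : opn (badj (y k.+1) - badj (y k)) <= 2^-1 ^+ k.
    rewrite (_ : _ - _ = badj (y k.+1 - y k)) ?opn_adj //.
    apply/esym/badj_eq => u w; rewrite !bfunB ipBl ipBr.
    by rewrite !badjP.
  have [L' LP'] := choice (hyx (fun k => badj (y k)) hy').
  have adjL : is_adj L L'.
    move=> u w; apply/eqP; rewrite -subr_eq0 -normr_eq0; apply/eqP.
    apply: (@eps_le _ _ (4 * `|u| * `|w|)); rewrite ?mulr_ge0 // => c c0.
    have [n hn] := exists_pow2_lt c0.
    have -> : ip (L u) w - ip u (L' w) =
        ip (L u - bfun (y n) u) w - ip u (L' w - bfun (badj (y n)) w).
      by rewrite ipBl ipBr badjP opprB addrA subrK.
    apply: (le_trans (ler_normB _ _)).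
    apply: (le_trans (lerD (ip_cauchy _ _) (ip_cauchy _ _))).
    have h1 : `|L u - bfun (y n) u| * `|w| <= 2 * c * `|u| * `|w|.
      rewrite ler_wpM2r // (le_trans (LP u n)) // ler_wpM2r // ler_wpM2l //.
      exact: ltW.
    have h2 : `|u| * `|L' w - bfun (badj (y n)) w| <= `|u| * (2 * c * `|w|).
      rewrite ler_wpM2l // (le_trans (LP' w n)) // ler_wpM2r // ler_wpM2l //.
      exact: ltW.
    apply: (le_trans (lerD h1 h2)); rewrite le_eqVlt; apply/orP; left; apply/eqP.
    ring.
  have Lb : bop_set L.
    exists L'; split=> //; exists (opn (y 0%N) + 2) => x.
    rewrite -[L x](subrK (bfun (y 0%N) x)) addrC; apply: (le_trans (ler_normD _ _)).
    rewrite mulrDl lerD ?opn_le // (le_trans (LP x 0%N)) //.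
    by rewrite expr0 mulr1.
  exists (ss_mk (X := bop_sub) Lb) => c c0.
  have [N hN] := exists_pow2_lt (divr_gt0 c0 (ltr0Sn _ 1)).
  exists N => m Nm; apply: (@le_trans _ _ (2 * 2^-1 ^+ m)).
    apply: opn_lub => [|x]; first by rewrite mulr_ge0 // exprn_ge0 // half_ge0.
    rewrite (_ : bfun _ x = L x - bfun (y m) x); first exact: LP.
    by rewrite bfunB.
  rewrite mulrC -ler_pdivlMr // (le_trans _ (ltW hN)) //.
  by apply: ler_wiXn2l; rewrite ?half_ge0 ?half_le1.
Qed.

Let S := build_cnm bop_norm_axioms.
Let v (x : S) : V := bfun x.
Let vlin : linear v. Proof. exact: ss_val_lin. Qed.

Definition bounded_ops : cstarAlg R.
Proof.
apply: (@CStarAlg R S bmul badj).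
- by move=> x y z; exact: bop_eq.
- move=> y c x z; apply: bop_eq => u; rewrite -[LHS]/(v (c *: x + z) (bfun y u)).
  by rewrite -[RHS]/(v (c *: (bmul x y : S) + (bmul z y : S)) u) !vlin.
- move=> y c x z; apply: bop_eq => u; rewrite -[LHS]/(bfun y (v (c *: x + z) u)).
  rewrite -[RHS]/(v (c *: (bmul y x : S) + (bmul y z : S)) u) !vlin.
  exact: bfun_lin.
- exact: badjK.
- move=> c x y; apply: badj_eq => u w.
  rewrite -[bfun _ u]/(v (c *: x + y) u) -[bfun (_ + _) w]/(v (c^* *: (badj x : S) + (badj y : S)) w).
  rewrite !vlin -[(_ + _) u]/(c *: bfun x u + bfun y u).
  rewrite -[(_ + _) w]/(c^* *: bfun (badj x) w + bfun (badj y) w).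
  by rewrite ipDl ipZl ipDr ipZr !badjP.
- by move=> x y; apply: badj_eq => u w; rewrite !bmulE !badjP.
- exact: opn_mul.
- exact: opn_cstar.
Defined.

End BoundedOperators.

(** * Cuntz isometries on square-summable sequences *)

Section CuntzIsometries.
Variables (R : realType) (d : nat).
Hypothesis d0 : (0 < d)%N.
Local Notation C := (cplx R).
Local Notation V := (nat -> (C : lmodType C)).
Local Notation K := (l2_hilbert R).

Lemma sum_block n (F : nat -> C) :
  \sum_(i < n * d) F i = \sum_(k < n) \sum_(h < d) F (k * d + h)%N.
Proof.
elim: n => [|n IH]; first by rewrite !big_ord0.
rewrite big_ord_recr /= -IH -!(big_mkord xpredT F) mulSnr.
rewrite (@big_cat_nat _ _ _ (n * d)) ?leq_addr //=; congr (_ + _).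
rewrite -{1}[(n * d)%N]add0n big_addn addKn big_mkord.
by apply: eq_bigr => i _; rewrite addnC.
Qed.

(** The isometry that spreads f over the residue class of h modulo d; its adjoint [adf] samples that
    class. *)
Definition shf (h : 'I_d) (f : V) : V := fun m => if (m %% d == h)%N then f (m %/ d)%N else 0.
Definition adf (h : 'I_d) (f : V) : V := fun n => f (n * d + h)%N.

Lemma shf_block h f k (j : 'I_d) : shf h f (k * d + j)%N = if j == h then f k else 0.
Proof. by rewrite /shf modnMDl modn_small // divnMDl // divn_small // addn0. Qed.

Lemma adf_shf h k f : adf h (shf k f) = if h == k then f else 0.
Proof. by apply/funext => n; rewrite /adf shf_block; case: eqP. Qed.

Lemma shf_psum n h f g : psum (n * d) (shf h f) g = psum n f (adf h g).
Proof.
rewrite /psum (sum_block _ (fun i => (shf h f i)^* * g i)); apply: eq_bigr => k _.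
rewrite (bigD1 h) //= shf_block eqxx big1 ?addr0 // => j jh.
by rewrite shf_block (negPf jh) conjC0 mul0r.
Qed.

Lemma leq_block n : (n <= n * d)%N. Proof. by rewrite leq_pmulr. Qed.

Lemma shf_l2 h f : l2_set f -> l2_set (shf h f).
Proof.
move=> [M hM]; exists M => n; apply: (le_trans (psum_mono _ (leq_block n))).
by rewrite shf_psum adf_shf eqxx.
Qed.

Lemma adf_l2 h f : l2_set f -> l2_set (adf h f).
Proof.
move=> [M hM]; exists M => n; apply: le_trans (hM (n * d)%N).
rewrite /psum (sum_block _ (fun i => (f i)^* * f i)); apply: ler_sum => k _.
rewrite (bigD1 h) //= /adf lerDl; apply: sumr_ge0 => j _.
by rewrite mulrC -normCK exprn_ge0.
Qed.

Definition shl h (x : K) : K := ss_mk (X := l2_sub R) (shf_l2 h (ss_valP (x : l2 R))).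
Definition adl h (x : K) : K := ss_mk (X := l2_sub R) (adf_l2 h (ss_valP (x : l2 R))).

Lemma sh_adj h (x y : K) : ip (shl h x) y = ip x (adl h y).
Proof.
apply/esym; apply: l2ip_eq.
rewrite (_ : (fun n => _) = (fun n => psum (n * d) (fn (shl h x : l2 R)) (fn (y : l2 R)))).
  have hd : (fun n => n * d)%N @ \oo --> \oo.
    by move=> A [N _ hN]; exists N => // n Nn; apply: hN; exact: leq_trans Nn (leq_block n).
  exact (cvg_comp _ _ hd (@l2ipP R (shl h x : l2 R) (y : l2 R))).
by apply/funext => n; rewrite -shf_psum.
Qed.

Lemma fn_eq (x y : K) : fn (x : l2 R) = fn (y : l2 R) -> x = y.
Proof. exact: val_inj. Qed.

Lemma ad_sh h k (x : K) : adl h (shl k x) = if h == k then x else 0.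
Proof.
apply: fn_eq; rewrite -[LHS]/(adf h (shf k (fn (x : l2 R)))) adf_shf.
by case: eqP => // _; rewrite (lin0 (@fn_lin R)).
Qed.

Lemma sh_norm h (x : K) : `|shl h x| = `|x|.
Proof.
apply/eqP; rewrite -(@eqrXn2 _ 2) // -!ip_norm sh_adj.
by have := ad_sh h h x; rewrite eqxx => ->.
Qed.

Lemma shl_bop h : bop_set (shl h).
Proof.
exists (adl h); split; first exact: sh_adj.
by exists 1 => x; rewrite sh_norm mul1r.
Qed.

Definition iso_op h : bounded_ops K := ss_mk (X := bop_sub K) (shl_bop h).

Lemma idb_bop : bop_set (fun x : K => x).
Proof. by exists (fun x => x); split=> //; exists 1 => x; rewrite mul1r. Qed.

Definition id_op : bounded_ops K := ss_mk (X := bop_sub K) idb_bop.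

Lemma iso_adj h x : bfun (badj (iso_op h)) x = adl h x.
Proof.
by apply: ip_ext => w; rewrite -badjP -sh_adj.
Qed.

Lemma iso_cuntz : cuntz_family iso_op.
Proof.
exists id_op; split.
- by move=> T; split; apply: bop_eq.
- move=> h k; apply: bop_eq => x.
  rewrite -[LHS]/(bfun (badj (iso_op h)) (shl k x)) iso_adj ad_sh.
  by case: eqP => // _; rewrite -[bfun 0 x]/((val (0 : bop K) : K -> K) x) raddf0.
- apply: bop_eq => x.
  have bs (I : Type) (r : seq I) (F : I -> bop K) :
      bfun (\sum_(i <- r) F i) x = \sum_(i <- r) bfun (F i) x.
    elim: r => [|i r IH]; first by rewrite !big_nil -[bfun 0 x]/((val (0 : bop K) : K -> K) x) raddf0.
    by rewrite !big_cons -IH -[F i in LHS]scale1r bfunD scale1r.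
  rewrite -[LHS]/(bfun (\sum_k (bmul (iso_op k) (badj (iso_op k)) : bop K)) x) bs.
  rewrite -[RHS]/x; apply: fn_eq; apply/funext => m.
  rewrite -[fn _ m]/((fn (\sum_k (shl k (bfun (badj (iso_op k)) x) : l2 R))) m).
  rewrite (lin_sum (@fn_lin R)).
  have fs (I : Type) (r : seq I) (F : I -> V) :
      (\sum_(i <- r) F i) m = \sum_(i <- r) (F i m).
    by elim: r => [|i r IH]; rewrite ?big_nil // !big_cons -IH.
  (* At the index m only the range projection of the residue class of m contributes. *)
  have mh : (m %% d < d)%N by rewrite ltn_mod.
  rewrite fs (bigD1 (Ordinal mh)) //= big1 ?addr0.
    rewrite iso_adj -[LHS]/(shf (Ordinal mh) (adf (Ordinal mh) (fn (x : l2 R))) m).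
    by rewrite /shf /= eqxx /adf -divn_eq.
  move=> j jm; rewrite -[LHS]/(shf j (fn (bfun (badj (iso_op j)) x : l2 R)) m) /shf.
  by rewrite -[(m %% d)%N]/(nat_of_ord (Ordinal mh)) (inj_eq val_inj) eq_sym (negPf jm).
Qed.

Lemma delta_l2 : l2_set ((fun i => (i == 0%N)%:R) : V).
Proof.
exists 1 => n; rewrite /psum; case: n => [|n]; first by rewrite big_ord0.
rewrite big_ord_recl /= big1 ?addr0 ?conjC1 ?mulr1 // => i _.
by rewrite mulr0.
Qed.

Lemma id_op_neq0 : id_op <> 0.
Proof.
move=> h; pose x : K := ss_mk (X := l2_sub R) delta_l2.
have : bfun id_op x = 0 by rewrite h -[bfun 0 x]/((val (0 : bop K) : K -> K) x) raddf0.
move=> /(congr1 (fun y : K => fn (y : l2 R) 0%N)) /eqP.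
by rewrite (lin0 (@fn_lin R)) /= oner_eq0.
Qed.

(** The universal property maps O_d to bounded operators; a zero unit would make the concrete
    isometries, hence the identity operator, vanish. *)
Lemma cuntz_unit_neq0 (Od : cstarAlg R) (psi : 'I_d -> Od) (e : Od) :
  is_cuntz psi -> is_unit e -> e != 0.
Proof.
move=> [_ _ univ] ue; have [f [hf fE]] := univ _ _ iso_cuntz.
apply/eqP => e0; have z x : x = 0 :> Od by rewrite -(cs1l ue x) e0 cs0l.
have [fl _ _] := hf.
have i0 k : iso_op k = 0 by rewrite -fE (z (psi k)) (lin0 fl).
have [u [uu _ us]] := iso_cuntz; apply: id_op_neq0.
have -> : id_op = u by apply: (unit_uniq uu) => T; split; apply: bop_eq.
by rewrite -us big1 // => k _; rewrite i0 cs0l.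
Qed.

End CuntzIsometries.

(** * Transport of embeddings along functors *)

Section CoeLemmas.
Variables (R : realType).

Lemma fhom_coe (S T : drCat R) (F : tensorFunctor S T) (x y : S) (e : x = y)
  (e' : F x = F y) : fhom F (coe e) = coe e'.
Proof. by subst y; rewrite (coe_id e') fhom_id. Qed.

Lemma coe_sandwich (T : cstarCat R) (x x' y y' : T) (e1 e2 : y = y') (e1' e2' : x = x')
  (t : arr x' y) : coe e1 ∘ (t ∘ coe e1') = coe e2 ∘ (t ∘ coe e2').
Proof. by rewrite (coe_irr e1 e2) (coe_irr e1' e2'). Qed.

Lemma emb_coe_id (T : drCat R) (H : embedding T) (x : T) (e : x = x) v :
  emb_hom H (coe e) v = v.
Proof. by rewrite coe_id emb_hom_id. Qed.

Lemma emb_coe_tens (T : drCat R) (H : embedding T) (x y x' y' : T) (e : x = y)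
  (e' : x' = y') (E : x ⊠ x' = y ⊠ y') v w :
  emb_tens (emb_hom H (coe e) v) (emb_hom H (coe e') w) =
  emb_hom H (coe E) (emb_tens v w).
Proof. by rewrite -emb_tensH (coe_tens e e' E). Qed.

Lemma emb_coe_norm (T : drCat R) (H : embedding T) (x y : T) (e : x = y) v :
  `|emb_hom H (coe e) v| = `|v|.
Proof. by apply/eqP; rewrite -(@eqrXn2 _ 2) // -!ip_norm emb_coe_ip. Qed.

Lemma emb_tens_coel (T : drCat R) (H : embedding T) (x y z : T) (e : x = y) v (w : H z) :
  emb_tens (emb_hom H (coe e) v) w =
  emb_hom H (coe (f_equal (fun a => a ⊠ z) e)) (emb_tens v w).
Proof. by rewrite -{1}[w](emb_hom_id (e := H)) (emb_coe_tens (H := H) e erefl (f_equal (fun a => a ⊠ z) e)). Qed.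

Lemma emb_tens_coer (T : drCat R) (H : embedding T) (x y z : T) (e : x = y) v (w : H z) :
  emb_tens w (emb_hom H (coe e) v) =
  emb_hom H (coe (f_equal (fun a => z ⊠ a) e)) (emb_tens w v).
Proof. by rewrite -{1}[w](emb_hom_id (e := H)) (emb_coe_tens (H := H) erefl e (f_equal (fun a => z ⊠ a) e)). Qed.

End CoeLemmas.

Section Pullback.
Variables (R : realType) (S T : drCat R) (F : tensorFunctor S T) (H : embedding T).
Hypothesis hF : tensor_iso F.
Local Notation C := (cplx R).

Let ten (x y : S) (v : H (F x)) (w : H (F y)) : H (F (x ⊠ y)) :=
  emb_hom H (coe (esym (fobj_tens F x y))) (emb_tens v w).

Let ten_dense (x y : S) :
  closure (lin_span [set u | exists v w, u = @ten x y v w]) = setT.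
Proof.
apply/seteqP; split=> // z _ B /nbhs_ballP [e /= e0 hB].
have : closure (lin_span [set u | exists v w, u = @emb_tens _ _ H (F x) (F y) v w])
    (emb_hom H (coe (fobj_tens F x y)) z) by rewrite emb_tens_dense.
move=> /(_ _ (nbhsx_ballx _ _ e0)) [s [[n [c [f [hf sE]]]]]].
rewrite -ball_normE /= => hs.
exists (emb_hom H (coe (esym (fobj_tens F x y))) s); split.
  exists n, c, (fun i => emb_hom H (coe (esym (fobj_tens F x y))) (f i)); split.
    by move=> i; have [v [w ->]] := hf i; exists v, w.
  rewrite sE (lin_sum (emb_lin _)); apply: eq_bigr => i _.
  by rewrite (linZ (emb_lin _)).
apply: hB; rewrite -ball_normE /=.
rewrite -(emb_coe_norm (H := H) (fobj_tens F x y)) (linB (emb_lin _)) emb_coeK.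
exact: hs.
Qed.

Let coe_sw (x y x' y' : T) (e : x = y) (e' : x' = y') (s : arr x x') (t : arr y y') :
  coe e' ∘ s = t ∘ coe e -> coe (esym e') ∘ t = s ∘ coe (esym e).
Proof. by subst y y'; rewrite !comp1c !compc1 => ->. Qed.

(** The composite of H with F. Its tensor maps are those of H corrected by the identity arrows of
    [fobj_tens]; bijectivity of F on arrows gives faithfulness. *)
Definition embF : embedding S.
Proof.
apply: (@Embedding R S (fun x => H (F x)) (fun x y t => emb_hom H (fhom F t))
  _ _ _ _ _ _ _ ten _ _ _ ten_dense (emb_hom H (coe (esym (fobj_unit F))) emb_unit)).
- by move=> x y t; exact: emb_hom_linear.
- by move=> x y t; exact: emb_hom_continuous.
- by move=> x y c s t v; rewrite fhom_lin emb_homP.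
- by move=> x v; rewrite fhom_id emb_hom_id.
- by move=> x y z s t v; rewrite fhom_comp emb_hom_comp.
- by move=> x y t v w; rewrite fhom_adj emb_hom_adj.
- by move=> x y s t /(@emb_hom_faithful _ _ H); have [_ /(_ x y) /bij_inj] := hF; apply.
- by move=> x y w c v v'; rewrite /ten emb_tens_linl (emb_lin _).
- by move=> x y v c w w'; rewrite /ten emb_tens_linr (emb_lin _).
- by move=> x y v v' w w'; rewrite /ten emb_coe_ip emb_tens_ip.
- by rewrite emb_coe_norm emb_unit_norm.
- move=> v; have [c cE] := emb_unit_span (emb_hom H (coe (fobj_unit F)) v).
  exists c; rewrite -(linZ (emb_lin _)) -cE emb_coeK //.
- move=> x y x' y' s t v w; rewrite /ten -emb_hom_comp.
  by rewrite -(coe_sw (fhom_tens F s t)) emb_hom_comp emb_tensH.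
- move=> x y z u v w; rewrite /ten.
  rewrite (fhom_coe (F := F) _ (f_equal F (tensOA x y z))) emb_tens_coer emb_tens_coel.
  by rewrite -emb_tensA -!emb_hom_comp !coe_comp; congr (emb_hom _ _ _); exact: coe_irr.
- move=> x v; rewrite /ten (fhom_coe (F := F) _ (f_equal F (tensO1l x))) emb_tens_coel.
  rewrite -emb_unitl -!emb_hom_comp !coe_comp; exact: emb_coe_id.
- move=> x v; rewrite /ten (fhom_coe (F := F) _ (f_equal F (tensO1r x))) emb_tens_coer.
  rewrite -emb_unitr -!emb_hom_comp !coe_comp; exact: emb_coe_id.
- move=> x y v w; rewrite /ten -emb_hom_comp.
  by rewrite -(coe_sw (fhom_sym F x y)) emb_hom_comp emb_sym.
Defined.

End Pullback.

Section NatUnitaryGroupoid.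
Variables (R : realType) (T : drCat R).

Definition nu_id (H : embedding T) : natUnitary H H.
Proof. by apply: (@NatUnitary _ _ H H (fun x v => v)) => // x w; exists w. Defined.

Definition nu_comp (H1 H2 H3 : embedding T) (W' : natUnitary H2 H3)
  (W : natUnitary H1 H2) : natUnitary H1 H3.
Proof.
apply: (@NatUnitary _ _ H1 H3 (fun x v => W' x (W x v))).
- by move=> x c v w; rewrite !nu_linear.
- by move=> x v w; rewrite !nu_ip.
- move=> x w; have [v <-] := nu_surj W' w; have [u <-] := nu_surj W v.
  by exists u.
- by move=> x y t v; rewrite !nu_natural.
- by move=> x y v w; rewrite !nu_tens.
Defined.

Lemma nu_inj (H1 H2 : embedding T) (W : natUnitary H1 H2) x : injective (W x).
Proof.
move=> v w E; apply: ip_ext => u.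
by rewrite -(nu_ip W) E nu_ip.
Qed.

Lemma nu_inv (H1 H2 : embedding T) (W : natUnitary H1 H2) :
  exists V : natUnitary H2 H1, forall x v, W x (V x v) = v.
Proof.
pose V x (v : H2 x) : H1 x := sval (cid (nu_surj W v)).
have VE x v : W x (V x v) = v by exact: (svalP (cid (nu_surj W v))).
unshelve eexists (@NatUnitary _ _ H2 H1 V _ _ _ _ _) => //=.
- by move=> x c v w; apply: (@nu_inj _ _ W); rewrite nu_linear !VE.
- by move=> x v w; rewrite -(nu_ip W) !VE.
- by move=> x w; exists (W x w); apply: (@nu_inj _ _ W); rewrite VE.
- by move=> x y t v; apply: (@nu_inj _ _ W); rewrite nu_natural !VE.
- by move=> x y v w; apply: (@nu_inj _ _ W); rewrite nu_tens !VE.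
Qed.

Definition nu_of_tu (H : embedding T) (g : tensorUnitary H) : natUnitary H H :=
  NatUnitary (@tu_linear _ _ _ g) (@tu_ip _ _ _ g) (@tu_surj _ _ _ g)
    (@tu_natural _ _ _ g) (@tu_tens _ _ _ g).

Definition tu_of_nu (H : embedding T) (W : natUnitary H H) : tensorUnitary H :=
  TensorUnitary (@nu_linear _ _ _ _ W) (@nu_ip _ _ _ _ W) (@nu_surj _ _ _ _ W)
    (@nu_natural _ _ _ _ W) (@nu_tens _ _ _ _ W).

End NatUnitaryGroupoid.

Section Whiskering.
Variables (R : realType) (S T U : drCat R).

Definition nu_whisker (F : tensorFunctor S T) (hF : tensor_iso F) (H H' : embedding T)
  (W : natUnitary H H') : natUnitary (embF H hF) (embF H' hF).
Proof.
apply: (@NatUnitary _ _ (embF H hF) (embF H' hF) (fun x => W (F x))).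
- by move=> x; exact (@nu_linear _ _ _ _ W (F x)).
- by move=> x v w /=; rewrite nu_ip.
- by move=> x w; exact (nu_surj W w).
- by move=> x y t v /=; rewrite nu_natural.
- by move=> x y v w /=; rewrite nu_natural nu_tens.
Defined.

(** The objects G (F x) and L x are only propositionally equal, so the two pulled back embeddings
    are identified by the images of identity arrows. *)
Definition nu_coe (F : tensorFunctor S T) (G : tensorFunctor T U) (L : tensorFunctor S U)
  (hF : tensor_iso F) (hG : tensor_iso G) (hL : tensor_iso L) (H : embedding U)
  (q : forall x, G (F x) = L x)
  (hq : forall x y (t : arr x y),
    coe (q y) ∘ fhom G (fhom F t) = fhom L t ∘ coe (q x)) :
  natUnitary (embF (embF H hG) hF) (embF H hL).
Proof.
apply: (@NatUnitary _ _ (embF (embF H hG) hF) (embF H hL)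
   (fun x => emb_hom H (coe (q x)))).
- by move=> x; exact (@emb_lin _ _ H _ _ (coe (q x))).
- by move=> x v w; exact: emb_coe_ip.
- by move=> x w; exists (emb_hom H (coe (esym (q x))) w); exact (@emb_coeK _ _ H _ _ _ _ w).
- by move=> x y t v /=; rewrite -!emb_hom_comp hq.
- move=> x y v w /=; rewrite emb_tens_coel emb_tens_coer.
  rewrite (fhom_coe (F := G) _ (f_equal G (esym (fobj_tens F x y)))).
  by rewrite -!emb_hom_comp !coe_comp; congr (emb_hom _ _ _); exact: coe_irr.
Defined.

End Whiskering.

Section InverseFunctor.
Variables (R : realType) (S T : drCat R).

(** The inverse on objects is known only through equalities, so arrows are defined by conjugating
    with identity arrows; the functor laws are checked after applying F, which is injective on
    arrows. *)
Lemma tensor_iso_inverse (F : tensorFunctor S T) : tensor_iso F ->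
  exists (G : tensorFunctor T S) (p : forall y, F (G y) = y) (q : forall x, G (F x) = x),
  [/\ tensor_iso G,
    forall y y' (t : arr y y'), coe (p y') ∘ fhom F (fhom G t) = t ∘ coe (p y)
  & forall x x' (t : arr x x'), coe (q x') ∘ fhom G (fhom F t) = t ∘ coe (q x)].
Proof.
move=> [[g gK Kg] hb].
have inj x y (s t : arr x y) : fhom F s = fhom F t -> s = t by exact: bij_inj.
pose hom y y' (t : arr y y') : arr (g y) (g y') :=
  inv_fun (@fhom _ _ _ F (g y) (g y')) (coe (esym (Kg y')) ∘ t ∘ coe (Kg y)).
have homE y y' (t : arr y y') :
    fhom F (hom _ _ t) = coe (esym (Kg y')) ∘ t ∘ coe (Kg y).
  exact: (inv_funVK (hb _ _)).
have coK x y (e : x = y :> T) z (t : arr z y) : coe e ∘ (coe (esym e) ∘ t) = t.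
  by rewrite Defs.compA coeK comp1c.
have coK' x y (e : x = y :> T) z (t : arr z x) : coe (esym e) ∘ (coe e ∘ t) = t.
  by rewrite Defs.compA coeK comp1c.
have g1 : g unitO = unitO by rewrite -[RHS]gK fobj_unit.
have gt x y : g (x ⊠ y) = g x ⊠ g y by rewrite -[RHS]gK fobj_tens !Kg.
have hom_lin y y' : linear (@hom y y').
  move=> c s t; apply: inj; rewrite fhom_lin !homE comp_linr comp_linl.
  by [].
unshelve eexists (@TensorFunctor _ T S g hom hom_lin _ _ _ g1 gt _ _), Kg, gK.
- by move=> y; apply: inj; rewrite homE fhom_id compc1 coeK.
- move=> x y z s t; apply: inj; rewrite fhom_comp !homE -!Defs.compA.
  by rewrite coK.
- move=> x y t; apply: inj; rewrite fhom_adj !homE !adj_comp !coe_adj Defs.compA.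
  by congr (_ ∘ _ ∘ _); exact: coe_irr.
- move=> x y x' y' s t; apply: inj; rewrite !fhom_comp homE.
  rewrite (fhom_coe (F := F) _ (f_equal F (gt y y'))) (fhom_coe (F := F) _ (f_equal F (gt x x'))).
  rewrite -[fhom F (_ ⊗ _)](coK' _ _ (fobj_tens F _ _)) fhom_tens !homE.
  rewrite !tens_comp (coe_tens _ _ (f_equal2 (@tensO R T) (esym (Kg y)) (esym (Kg y')))).
  rewrite (coe_tens _ _ (f_equal2 (@tensO R T) (Kg x) (Kg x'))).
  rewrite !Defs.compA !coe_comp -!Defs.compA !coe_comp; exact: coe_sandwich.
- move=> x y; apply: inj; rewrite !fhom_comp homE.
  rewrite (fhom_coe (F := F) _ (f_equal F (gt x y))) (fhom_coe (F := F) _ (f_equal F (gt y x))).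
  rewrite -[fhom F (sym _ _)](coK' _ _ (fobj_tens F _ _)) fhom_sym.
  have sc a a' b b' (u : a = a' :> T) (v : b = b') :
      sym a b = coe (esym (f_equal2 (@tensO R T) v u)) ∘ sym a' b' ∘ coe (f_equal2 (@tensO R T) u v).
    by subst a' b'; rewrite !coe_id comp1c compc1.
  rewrite (sc _ _ _ _ (Kg x) (Kg y)).
  rewrite !Defs.compA !coe_comp -!Defs.compA !coe_comp; exact: coe_sandwich.
split.
- split; first by exists F.
  move=> x y; exists (fun t => coe (Kg y) ∘ fhom F t ∘ coe (esym (Kg x))).
    by move=> t /=; rewrite homE -!Defs.compA coK coeK compc1.
  move=> t /=; apply: inj; rewrite homE -!Defs.compA coK' coeK.
  by rewrite compc1.
- by move=> y y' t /=; rewrite homE -!Defs.compA coK.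
- move=> x x' t; apply: (@inj); rewrite !fhom_comp homE.
  rewrite (fhom_coe (F := F) _ (Kg _)) (fhom_coe (F := F) _ (Kg _)).
  by rewrite -!Defs.compA coK.
Qed.

End InverseFunctor.

(** * Automorphisms implementing natural unitaries *)

Section Implementation.
Variables (R : realType) (d : nat) (Od : cstarAlg R) (psi : 'I_d -> Od).
Hypothesis psi_cuntz : is_cuntz psi.
Local Notation C := (cplx R).

Section Implements.
Variable T : drCat R.

Definition implements (H H' : embedding T) (x : T) (e : 'I_d -> H x) (e' : 'I_d -> H' x)
  (W : natUnitary H H') (a : cstar_aut Od) : Prop :=
  forall h, a (psi h) = vec psi e' (W _ (e h)).

Section One.
Variables (H H' : embedding T) (x : T) (e : 'I_d -> H x) (e' : 'I_d -> H' x).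
Hypothesis (oe : onb e) (oe' : onb e').

Lemma implements_vec W a : implements e e' W a ->
  forall v, a (vec psi e v) = vec psi e' (W _ v).
Proof.
move=> aW v; have [al _ _] := aut_hom a.
rewrite [in RHS](onbE oe v) (lin_sum (@nu_linear _ _ _ _ W _)) (lin_sum (vec_lin _ _)).
rewrite {1}/vec (lin_sum al); apply: eq_bigr => k _.
by rewrite (linZ al) (linZ (@nu_linear _ _ _ _ W _)) (linZ (vec_lin _ _)) aW.
Qed.

(** The matrix of W in two orthonormal bases is unitary. *)
Lemma implements_exists W : exists a, implements e e' W a.
Proof.
apply: (unitary_aut psi_cuntz (U := fun k h => ip (e' k) (W _ (e h)))); split.
  move=> h h'; rewrite -(onb_ip oe) -(nu_ip W) (ip_parseval oe').
  by apply: eq_bigr => k _; rewrite -ip_conj.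
move=> k k'; rewrite -(onb_ip oe').
have [v <-] := nu_surj W (e' k); have [w <-] := nu_surj W (e' k').
rewrite nu_ip (ip_parseval oe); apply: eq_bigr => h _.
by rewrite -ip_conj !nu_ip.
Qed.

Lemma implements_inv (W : natUnitary H H') (V : natUnitary H' H) a : (forall y (v : H' y), W y (V y v) = v) ->
  implements e e' W a -> implements e' e V a^-1%g.
Proof.
move=> VK aW h; have [_ ab] := aut_iso a; apply: (bij_inj ab).
rewrite (implements_vec aW) VK vec_e //; exact: (inv_funVK ab).
Qed.

End One.

Lemma implements_comp (H H' H'' : embedding T) (x : T) (e : 'I_d -> H x)
  (e' : 'I_d -> H' x) (e'' : 'I_d -> H'' x)
  (W : natUnitary H H') (W' : natUnitary H' H'') a a' : onb e' ->
  implements e e' W a -> implements e' e'' W' a' ->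
  implements e e'' (nu_comp W' W) (a' * a)%g.
Proof.
move=> oe' aW aW' h; transitivity (a' (a (psi h))) => //.
by rewrite aW (implements_vec oe' aW').
Qed.

(** The image in Aut O_d of the unitary group of H, relative to the basis e. *)
Definition autset (H : embedding T) x (e : 'I_d -> H x) : set (cstar_aut Od) :=
  [set a | exists W : natUnitary H H, implements e e W a].

(** Conjugation by W identifies the two unitary groups. When both have the same image, this says
    that the implementer normalizes it. *)
Lemma implements_autset (H H' : embedding T) x (e : 'I_d -> H x)
  (e' : 'I_d -> H' x) (W : natUnitary H H') a b : onb e -> onb e' -> implements e e' W a ->
  autset e' b <-> autset e (a^-1 * b * a)%g.
Proof.
move=> oe oe' aW; have [V VK] := nu_inv W; split=> -[U bU].
  exists (nu_comp V (nu_comp U W)); rewrite -mulgA.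
  apply: (implements_comp (e' := e')) => //.
    exact: (implements_comp (e' := e')).
  exact: implements_inv aW.
exists (nu_comp W (nu_comp U V)).
have -> : b = (a * (a^-1 * b * a * a^-1))%g by rewrite !mulgA mulgV mul1g mulgK.
apply: (implements_comp (e' := e)) => //.
apply: (implements_comp (e' := e)) => //.
exact: implements_inv aW.
Qed.

Lemma implements_torsor (H H' : embedding T) x (e : 'I_d -> H x)
  (e' : 'I_d -> H' x) (W W' : natUnitary H H') a a' : onb e -> onb e' ->
  implements e e' W a -> implements e e' W' a' -> autset e (a^-1 * a')%g.
Proof.
move=> oe oe' aW aW'; have [V VK] := nu_inv W; exists (nu_comp V W').
apply: (implements_comp (e' := e')) => //; exact: implements_inv aW.
Qed.

End Implements.

Section Pulled.
Variables (S T : drCat R) (F : tensorFunctor S T) (hF : tensor_iso F).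

(** Natural unitaries of the pullback come from those of H: with an inverse G of F, conjugate W at G
    y by the identity arrow from F (G y) to y. *)
Lemma autset_embF (H : embedding T) x (e : 'I_d -> H (F x)) :
  @autset _ (embF H hF) x e = @autset _ H (F x) e.
Proof.
apply/seteqP; split=> a [W aW]; last by exists (nu_whisker hF W).
have [G [p [q [hG Gp Gq]]]] := tensor_iso_inverse hF.
have pe y y' (t : arr y y') v : emb_hom H (coe (esym (p y'))) (emb_hom H t v) =
    emb_hom (embF H hF) (fhom G t) (emb_hom H (coe (esym (p y))) v).
  rewrite /= -!emb_hom_comp; congr (emb_hom _ _ _).
  rewrite -[t in LHS]compc1 -(coeK (esym (p y)) (p y)) [t ∘ _]Defs.compA -Gp.
  by rewrite !Defs.compA coeK comp1c.
pose V y (v : H y) : H y := emb_hom H (coe (p y)) (W (G y) (emb_hom H (coe (esym (p y))) v)).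
unshelve eexists (@NatUnitary _ _ H H V _ _ _ _ _).
- move=> y c v w; rewrite /V (emb_lin _) (@nu_linear _ _ _ _ W (G y)).
  exact: emb_lin.
- by move=> y v w; rewrite /V emb_coe_ip (nu_ip W) /= emb_coe_ip.
- move=> y w; have [v vE] := nu_surj W (x := G y) (emb_hom H (coe (esym (p y))) w).
  exists (emb_hom H (coe (p y)) v); rewrite /V.
  by rewrite emb_coeK vE emb_coeK.
- move=> y y' t v; rewrite /V pe nu_natural /= -!emb_hom_comp Gp.
  by rewrite emb_hom_comp.
- move=> y y' v w; rewrite /V.
  have E : emb_hom H (coe (esym (p (y ⊠ y')))) (emb_tens v w) =
      emb_hom (embF H hF) (coe (esym (fobj_tens G y y')))
       (@emb_tens _ _ (embF H hF) (G y) (G y') (emb_hom H (coe (esym (p y))) v)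
         (emb_hom H (coe (esym (p y'))) w)).
    rewrite /= emb_tens_coel emb_tens_coer.
    rewrite (fhom_coe (F := F) _ (f_equal F (esym (fobj_tens G y y')))).
    by rewrite -!emb_hom_comp !coe_comp; congr (emb_hom _ _ _); exact: coe_irr.
  rewrite E nu_natural nu_tens /= emb_tens_coel emb_tens_coer.
  rewrite (fhom_coe (F := F) _ (f_equal F (esym (fobj_tens G y y')))).
  by rewrite -!emb_hom_comp !coe_comp; congr (emb_hom _ _ _); exact: coe_irr.
move=> h /=; rewrite aW; congr (vec _ _ _); rewrite /V.
have E z : emb_hom H (coe (esym (p (F x)))) z = emb_hom (embF H hF) (coe (esym (q x))) z.
  by rewrite /= (fhom_coe (F := F) _ (esym (p (F x)))).
rewrite E nu_natural /= (fhom_coe (F := F) _ (esym (p (F x)))).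
by rewrite emb_coeK.
Qed.

Definition pbasis (H : embedding T) x y (p : F x = y) (e : 'I_d -> H y) :
  'I_d -> embF H hF x := fun k => emb_hom H (coe (esym p)) (e k).

Lemma pbasis_refl (H : embedding T) x (e : 'I_d -> H (F x)) :
  pbasis (erefl (F x)) e = e.
Proof. by apply/funext => k; rewrite /pbasis emb_coe_id. Qed.

Lemma pbasis_onb (H : embedding T) x y (p : F x = y) (e : 'I_d -> H y) :
  onb e -> onb (pbasis p e).
Proof. by subst y => oe; rewrite pbasis_refl. Qed.

Lemma autset_pbasis (H : embedding T) x y (p : F x = y) (e : 'I_d -> H y) :
  autset (pbasis p e) = autset e.
Proof. by subst y; rewrite pbasis_refl autset_embF. Qed.

Lemma eI_embF (H : embedding T) x (e : 'I_d -> H (F x)) n (I : idx d n) :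
  @eI _ _ _ (embF H hF) x e n I =
  emb_hom H (coe (esym (fobj_tpow n (erefl (F x))))) (eI e I).
Proof.
elim: n I => [|n IH] /=.
  by move=> _; congr (emb_hom _ _ _); exact: coe_irr.
move=> [I i] /=; rewrite IH emb_tens_coel -!emb_hom_comp coe_comp.
by congr (emb_hom _ _ _); exact: coe_irr.
Qed.

Lemma Theta_pbasis (H : embedding T) x y (p : F x = y) (e : 'I_d -> H y) l m
  (t : arr (tpow x l) (tpow x m)) :
  Theta psi_cuntz (pbasis p e) t = Theta psi_cuntz e (fhom_tpow p t).
Proof.
subst y; rewrite pbasis_refl; apply: eq_bigr => J _; congr (_ ** _).
rewrite eI_embF /fhom_tpow !emb_hom_comp /=; apply: eq_bigr => I _.
by rewrite eI_embF [in RHS]emb_adjr coe_adj.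
Qed.

End Pulled.
End Implementation.

Lemma nu_norm (R : realType) (T : drCat R) (H H' : embedding T) (W : natUnitary H H') x (v : H x) :
  `|W x v| = `|v|.
Proof. by apply/eqP; rewrite -(@eqrXn2 _ 2) // -!ip_norm nu_ip. Qed.

(** * Fixed points of the Cuntz algebra *)

Section Averaging.
Variables (R : realType) (T : drCat R) (H : embedding T) (S : finType) (p q : S -> pt H H).
Local Notation C := (cplx R).

Definition dev (W : natUnitary H H) s : C :=
  coef W (p s) * (coef W (q s))^* - haar (p s) (q s).

Lemma twice_reB (z w : C) : twice_re (z - w) = twice_re z - twice_re w.
Proof. by rewrite /twice_re rmorphB /= opprD addrACA. Qed.

(** The weights are absorbed by scaling the points; subtracting its mean from the linear functional
    leaves one that is somewhere nonpositive. *)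
Lemma dev_descent (u : S -> C) : exists W, \sum_s twice_re ((u s)^* * dev W s) <= 0.
Proof.
have [W hW] := natural_unitary_exists
  [seq (pscale (u s)^* (p s), q s) | s <- index_enum S].
exists W; move: hW; rewrite -subr_le0 /linval !big_map -sumrB.
apply: le_trans; rewrite le_eqVlt; apply/orP; left; apply/eqP/eq_bigr => s _ /=.
rewrite k_scale; last exact: haar_kernel.
rewrite mulrBr twice_reB; congr (twice_re _ - _).
rewrite mulrA; congr (_ * _); rewrite /coef /=.
by rewrite (linZ (@nu_linear _ _ _ _ W _)) ipZr.
Qed.

Definition dev_max s : C :=
  `|pt_w (p s)| * `|pt_v (p s)| * (`|pt_w (q s)| * `|pt_v (q s)|) + `|haar (p s) (q s)|.

Lemma coef_le (W : natUnitary H H) (r : pt H H) : `|coef W r| <= `|pt_w r| * `|pt_v r|.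
Proof. by apply: (le_trans (ip_cauchy _ _)); rewrite nu_norm. Qed.

Lemma dev_le W s : `|dev W s| <= dev_max s.
Proof.
apply: (le_trans (ler_normB _ _)); rewrite lerD2r normrM norm_conjC.
by rewrite ler_pM ?coef_le.
Qed.

(* By [dev_descent] the cross term can be made nonpositive at every step, so the
   squared norm of the sum grows at most linearly. *)
Lemma dev_greedy n : exists2 Ws : seq (natUnitary H H), size Ws = n &
  \sum_s `|\sum_(W <- Ws) dev W s| ^+ 2 <= n%:R * \sum_s dev_max s ^+ 2.
Proof.
elim: n => [|n [Ws sW IH]].
  exists [::] => //; rewrite mul0r big1 // => s _.
  by rewrite big_nil normr0 expr0n.
have [W hW] := dev_descent (fun s => \sum_(W <- Ws) dev W s).
exists (W :: Ws); first by rewrite /= sW.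
have E s : `|\sum_(V <- W :: Ws) dev V s| ^+ 2 = `|\sum_(V <- Ws) dev V s| ^+ 2 +
    twice_re ((\sum_(V <- Ws) dev V s)^* * dev W s) + `|dev W s| ^+ 2.
  rewrite big_cons !normCK /twice_re rmorphD rmorphM /= conjCK; ring.
under eq_bigr do rewrite E.
rewrite 2!big_split /= -natr1 mulrDl mul1r; apply: lerD.
  rewrite -[leRHS]addr0; exact: (lerD IH hW).
by apply: ler_sum => s _; rewrite lerXn2r ?nnegrE ?dev_le // (le_trans _ (dev_le W s)).
Qed.

(** The deviations add up only like the square root of the number of elements, so their mean tends
    to zero. The number 2^n is taken large enough that 2^n c^2 exceeds the bound M for one step. *)
Lemma dev_average (c : C) : 0 < c -> exists2 Ws : seq (natUnitary H H), (0 < size Ws)%N &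
  forall s, `|\sum_(W <- Ws) dev W s| <= c * (size Ws)%:R.
Proof.
move=> c0; set M := \sum_s dev_max s ^+ 2.
have dm0 s : 0 <= dev_max s by exact: le_trans (normr_ge0 _) (dev_le (nu_id H) s).
have M0 : 0 <= M by apply: sumr_ge0 => s _; rewrite exprn_ge0.
have M1 : 0 < M + 1 by rewrite ltr_wpDl.
have [|n hn] := @exists_pow2_lt R (c ^+ 2 / (M + 1)); first by rewrite divr_gt0 ?exprn_gt0.
have [Ws sW hW] := dev_greedy (2 ^ n); exists Ws; rewrite sW ?expn_gt0 // => s.
have n0 : 0 < (2 ^ n)%:R :> C by rewrite ltr0n expn_gt0.
rewrite -(@ler_pXn2r _ 2) ?nnegrE ?mulr_ge0 ?(ltW c0) ?(ltW n0) //.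
apply: (@le_trans _ _ ((2 ^ n)%:R * M)).
  apply: le_trans hW; rewrite (bigD1 s) //= lerDl; apply: sumr_ge0 => j _.
  by rewrite exprn_ge0.
rewrite exprMn [leRHS]mulrC [X in _ <= X * _]expr2 -mulrA ler_pM2l //.
have h : M + 1 <= (2 ^ n)%:R * c ^+ 2.
  move: hn; rewrite ltr_pdivlMr // natrX exprVn mulrC ltr_pdivrMr ?exprn_gt0 //.
  by rewrite mulrC; exact: ltW.
by apply: le_trans h; rewrite lerDl ler01.
Qed.

End Averaging.

Lemma lin_span_in (K : numDomainType) (V : lmodType K) (X : set V) x : X x -> lin_span X x.
Proof.
move=> Xx; exists 1%N, (fun=> 1), (fun=> x); split=> //.
by rewrite big_ord1 scale1r.
Qed.

Lemma lin_span_lin (K : numDomainType) (V : lmodType K) (X : set V) c x y :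
  lin_span X x -> lin_span X y -> lin_span X (c *: x + y).
Proof.
move=> [m [a [u [Xu ->]]]] [n [b [v [Xv ->]]]].
exists (m + n)%N, (fun i => match fintype.split i with inl j => c * a j | inr j => b j end),
  (fun i => match fintype.split i with inl j => u j | inr j => v j end); split.
  by move=> i; case: (fintype.split i).
rewrite big_split_ord scaler_sumr /=; congr (_ + _); apply: eq_bigr => i _.
  by have -> : fintype.split (lshift n i) = inl i := unsplitK (inl i); rewrite scalerA.
by have -> : fintype.split (rshift m i) = inr i := unsplitK (inr i).
Qed.

Lemma lin_span0 (K : numDomainType) (V : lmodType K) (X : set V) : lin_span X 0.
Proof. by exists 0%N, (fun=> 0), (fun=> 0); split; [case|rewrite big_ord0]. Qed.

Lemma lin_span_linear (K : numDomainType) (V W : lmodType K) (X : set V) (Y : set W) (f : V -> W) :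
  linear f -> (forall x, X x -> lin_span Y (f x)) -> forall x, lin_span X x -> lin_span Y (f x).
Proof.
move=> fl XY _ [n [c [x [Xx ->]]]]; rewrite (lin_sum fl).
elim/big_ind: _ => [|u v hu hv|i _]; first exact: lin_span0.
  by rewrite -[u]scale1r; exact: lin_span_lin.
by rewrite (linZ fl) -[_ *: _]addr0; apply: lin_span_lin; [exact: XY|exact: lin_span0].
Qed.

(** * Density of the arrows in the fixed points *)

Section Words.
Variables (R : realType) (d : nat) (Od : cstarAlg R) (psi : 'I_d -> Od).
Hypothesis psi_cuntz : is_cuntz psi.
Local Notation C := (cplx R).
Local Notation psi_I := (psiI psi_cuntz).

Definition cuntz_words : set Od :=
  [set z | exists w : {l & idx d l} * {l & idx d l},
    z = psi_I (tagged w.1) ** cs_adj (psi_I (tagged w.2))].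

Lemma psi_cons k n (I : idx d n) : exists I' : idx d n.+1, psi k ** psi_I I = psi_I I'.
Proof.
have u := cunit_unit psi_cuntz.
elim: n I => [|n IH] I; first by exists (tt, k); rewrite /= (cs1l u) (cs1r u).
case: I => I i; have [I' E] := IH I; exists (I', i).
by rewrite /= cs_mulA E.
Qed.

Lemma psi_uncons n (I : idx d n.+1) : exists k (I' : idx d n), psi_I I = psi k ** psi_I I'.
Proof.
have u := cunit_unit psi_cuntz.
elim: n I => [|n IH] [I i]; first by exists i, tt; rewrite /= (cs1l u) (cs1r u).
have [k [I' E]] := IH I; exists k, (I', i).
by rewrite -[LHS]/(@psiI _ _ _ _ psi_cuntz n.+1 I ** psi i) E -cs_mulA.
Qed.

(** The claim is strengthened for the induction: left multiplication by y and by its adjoint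
    preserves the span of the words. It is then applied to the unit, which is a word. *)
Lemma star_generated_words y : star_generated (range psi) y -> lin_span cuntz_words y.
Proof.
have u := cunit_unit psi_cuntz; have [_ oo _] := cunitP psi_cuntz.
pose stable b := forall z, lin_span cuntz_words z -> lin_span cuntz_words (b ** z).
have st b : (forall z, cuntz_words z -> lin_span cuntz_words (b ** z)) -> stable b.
  by move=> h z; apply: (lin_span_linear (@mul_linr _ _ b)) => w /h.
suff : star_generated (range psi) y -> stable y /\ stable (cs_adj y).
  move=> h /h [sy _]; rewrite -[y](cs1r u); apply: sy; apply: lin_span_in.
  by exists (existT _ 0%N tt, existT _ 0%N tt); rewrite /= (cs1l u) (unit_adj u).
elim=> {y} [_ [k _ <-]||c y z _ [h1 h2] _ [h3 h4]|y z _ [h1 h2] _ [h3 h4]|y _ [h1 h2]].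
- split; apply: st => _ [[[l I] [m J]] /= ->].
    have [I' E] := psi_cons k I; apply: lin_span_in; exists (existT _ l.+1 I', existT _ m J).
    by rewrite cs_mulA E.
  (* The adjoint of psi_k removes the first letter of the first word or kills it; if that word is
     empty, the letter is appended to the second word. *)
  case: l I => [|l] I.
    apply: lin_span_in; exists (existT _ 0%N tt, existT _ m.+1 (J, k)).
    by rewrite /= cs_adjM !(cs1l u).
  have [j [I' E]] := psi_uncons I; rewrite E !cs_mulA oo.
  case: eqP => _; last by rewrite !cs0l; exact: lin_span0.
  by rewrite (cs1l u); apply: lin_span_in; exists (existT _ l I', existT _ m J).
- split=> z _; rewrite ?cs_adj0 cs0l; exact: lin_span0.
- split=> w hw; rewrite ?cs_adjD ?cs_adjZ csDl csZl; apply: lin_span_lin; auto.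
- by split=> w hw; rewrite ?cs_adjM -cs_mulA; auto.
- by split; rewrite ?cs_adjK.
Qed.

Section Density.
Variables (T : drCat R) (H : embedding T) (x : T) (e : 'I_d -> H x).
Hypothesis oe : onb e.
Local Notation Theta := (Theta psi_cuntz e).

Definition word_pt l (I K : idx d l) : pt H H := Pt (eI e I) (eI e K).

Lemma word_deviation (W : natUnitary H H) a l m (I : idx d l) (J : idx d m) :
  implements psi e e W a ->
  a (psi_I I ** cs_adj (psi_I J)) - Theta (hrep (eI e I) (eI e J)) =
  \sum_K \sum_L (coef W (word_pt I K) * (coef W (word_pt J L))^* -
     haar (word_pt I K) (word_pt J L)) *: (psi_I K ** cs_adj (psi_I L)).
Proof.
move=> aW; have [_ am aa] := aut_hom a; rewrite am aa -!(Psi_e psi_cuntz oe).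
rewrite !(aut_Psi psi_cuntz oe oe aW).
have -> : Theta (hrep (eI e I) (eI e J)) = \sum_K \sum_L
    haar (word_pt I K) (word_pt J L) *: (psi_I K ** cs_adj (psi_I L)).
  rewrite exchange_big; apply: eq_bigr => L _.
  by rewrite cs_suml; apply: eq_bigr => K _; rewrite csZl.
rewrite /Psi cs_adj_sum cs_suml -sumrB; apply: eq_bigr => K _.
rewrite cs_sumr -sumrB; apply: eq_bigr => L _.
by rewrite cs_adjZ csZl csZr scalerA scalerBl.
Qed.

(** A combination y1 of words approximates y, and z is its formal average. Averaging over
    well-chosen group elements fixes y, does not increase the error y - y1, and brings y1 close to
    z. *)
Lemma fixed_approx (y : Od) (c : C) : (forall a, autset psi e a -> a y = y) -> 0 < c ->
  exists2 z, lin_span [set z | exists l m (t : arr (tpow x l) (tpow x m)), z = Theta t] z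
    & `|y - z| < c.
Proof.
move=> fy c0; have c20 : 0 < c / 2 by rewrite divr_gt0.
have : closure (star_generated (range psi)) y by case: psi_cuntz => _ -> _.
move=> /(_ (ball y (c / 2)) (nbhsx_ballx _ _ c20)) [y1 [/star_generated_words]].
move=> [n [b [u [/choice [w wE] y1E]]]]; rewrite -ball_normE /= => hy1.
(* All matrix coefficients of all words of y1, so that one list of group elements serves them
   simultaneously. *)
pose S := {i : 'I_n & (idx d (tag (w i).1) * idx d (tag (w i).2))%type}.
pose I i := tagged (w i).1; pose J i := tagged (w i).2.
pose z := \sum_i b i *: Theta (hrep (eI e (I i)) (eI e (J i))).
exists z.
  by exists n, b, (fun i => Theta (hrep (eI e (I i)) (eI e (J i)))); split=> // i; do 3 eexists.
(* The common bound on the mean deviations enters the error multiplied by at most M; the added 1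
   keeps the divisor positive when M = 0. *)
pose M := \sum_i `|b i| * \sum_K \sum_L `|@psiI _ _ _ _ psi_cuntz (tag (w i).1) K
   ** cs_adj (@psiI _ _ _ _ psi_cuntz (tag (w i).2) L)|.
have M0 : 0 <= M.
  apply: sumr_ge0 => i _; rewrite mulr_ge0 //; apply: sumr_ge0 => K _.
  by apply: sumr_ge0 => L _.
have M1 : 0 < 2 * (M + 1) by rewrite mulr_gt0 // ltr_wpDl.
have e0 : 0 < c / (2 * (M + 1)) by rewrite divr_gt0.
have [Ws sWs hWs] := @dev_average R T H S
  (fun s => word_pt (I (tag s)) (tagged s).1) (fun s => word_pt (J (tag s)) (tagged s).2) _ e0.
set k := size Ws in hWs; have k0 : 0 < k%:R :> C by rewrite ltr0n.
pose av W := sval (cid (implements_exists psi_cuntz oe oe W)).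
have avE W : implements psi e e W (av W) by exact: (svalP (cid (implements_exists psi_cuntz oe oe W))).
have E : k%:R *: (y - z) = \sum_(W <- Ws) av W (y - y1) + \sum_(W <- Ws) (av W y1 - z).
  rewrite -big_split /= (eq_bigr (fun=> y - z)) => [|W _].
    by rewrite big_const_seq count_predT iter_addr_0 scaler_nat.
  have [al _ _] := aut_hom (av W); rewrite (linB al) fy ?addrA ?subrK //.
  by exists W; exact: avE.
rewrite -(ltr_pM2l k0) -[k%:R in X in X < _](normr_nat C) -normrZ E.
apply: (le_lt_trans (ler_normD _ _)).
have h1 : `|\sum_(W <- Ws) av W (y - y1)| <= k%:R * `|y - y1|.
  apply: (le_trans (ler_norm_sum _ _ _)).
  rewrite (le_trans (ler_sum _ (fun W _ => aut_contr psi_cuntz (av W) (y - y1)))) //.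
  by rewrite big_const_seq count_predT iter_addr_0 mulr_natl.
have h2 : `|\sum_(W <- Ws) (av W y1 - z)| <= c / (2 * (M + 1)) * k%:R * M.
  have -> : \sum_(W <- Ws) (av W y1 - z) = \sum_i b i *: \sum_K \sum_L
     (\sum_(W <- Ws) dev (fun s : S => word_pt (I (tag s)) (tagged s).1)
       (fun s : S => word_pt (J (tag s)) (tagged s).2) W
       (Tagged (fun i => (idx d (tag (w i).1) * idx d (tag (w i).2))%type) (i:=i) (K, L)))
       *: (psi_I K ** cs_adj (psi_I L)).
    transitivity (\sum_(W <- Ws) \sum_i b i *: (av W (u i) - Theta (hrep (eI e (I i)) (eI e (J i))))).
      apply: eq_bigr => W _; have [al _ _] := aut_hom (av W).
      rewrite y1E (lin_sum al) /z -sumrB; apply: eq_bigr => i _.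
      by rewrite (linZ al) scalerBr.
    rewrite exchange_big; apply: eq_bigr => i _; rewrite -scaler_sumr; congr (_ *: _).
    transitivity (\sum_(W <- Ws) \sum_K \sum_L
       (coef W (word_pt (I i) K) * (coef W (word_pt (J i) L))^* -
        haar (word_pt (I i) K) (word_pt (J i) L)) *: (psi_I K ** cs_adj (psi_I L))).
      by apply: eq_bigr => W _; rewrite wE (word_deviation _ _ (avE W)).
    rewrite exchange_big; apply: eq_bigr => K _; rewrite exchange_big; apply: eq_bigr => L _.
    by rewrite scaler_suml.
  rewrite /M mulr_sumr; apply: (le_trans (ler_norm_sum _ _ _)); apply: ler_sum => i _.
  rewrite normrZ mulrCA ler_wpM2l // mulr_sumr.
  apply: (le_trans (ler_norm_sum _ _ _)); apply: ler_sum => K _; rewrite mulr_sumr.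
  apply: (le_trans (ler_norm_sum _ _ _)); apply: ler_sum => L _; rewrite normrZ.
  by rewrite ler_wpM2r.
rewrite [c in ltRHS](splitr c) mulrDr; apply: ltr_leD.
  by apply: (le_lt_trans h1); rewrite ltr_pM2l.
apply: (le_trans h2); rewrite mulrAC [leRHS]mulrC ler_wpM2r ?(ltW k0) //.
have -> : c / (2 * (M + 1)) * M = c / 2 * (M / (M + 1)) by rewrite invfM; ring.
rewrite -[leRHS]mulr1 ler_wpM2l ?(ltW c20) //.
by rewrite ler_pdivrMr ?ltr_wpDl // mul1r lerDl ler01.
Qed.

End Density.
End Words.

(** * The circle action *)

Section Gauge.
Variables (R : realType) (d : nat) (Od : cstarAlg R) (psi : 'I_d -> Od).
Hypothesis psi_cuntz : is_cuntz psi.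
Local Notation C := (cplx R).
Local Notation psi_I := (psiI psi_cuntz).

(** Off the unit circle the automorphism is arbitrary, which makes [gauge] total. *)
Lemma gauge_exists (z : C) : exists a : cstar_aut Od,
  `|z| = 1 -> forall h, a (psi h) = z *: psi h.
Proof.
have [z1|] := pselect (`|z| = 1); last by exists 1%g.
have zz : z * z^* = 1 by rewrite -normCK z1 expr1n.
have [|a aE] := unitary_aut psi_cuntz (U := fun k h => (k == h)%:R * z).
  split=> h h'; rewrite (bigD1 h) //= big1 => [|j /negPf jh].
  - rewrite eqxx mul1r; case: eqP => _; last by rewrite mul0r mulr0 addr0.
    by rewrite mul1r mulrC zz addr0.
  - by rewrite jh mul0r conjC0 mul0r.
  - rewrite eqxx mul1r eq_sym; case: eqP => _; last by rewrite mul0r conjC0 mulr0 addr0.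
    by rewrite mul1r zz addr0.
  - by rewrite eq_sym jh mul0r mul0r.
exists a => _ h; rewrite aE (bigD1 h) //= eqxx mul1r big1 ?addr0 // => j /negPf jh.
by rewrite jh mul0r scale0r.
Qed.

Definition gauge (z : C) : cstar_aut Od := sval (cid (gauge_exists z)).

Lemma gauge_psi z h : `|z| = 1 -> gauge z (psi h) = z *: psi h.
Proof. by move=> z1; exact: (svalP (cid (gauge_exists z)) z1 h). Qed.

Lemma gaugeM z w a : `|z| = 1 -> `|w| = 1 -> gauge (z * w) a = gauge z (gauge w a).
Proof.
move=> z1 w1; have -> : gauge (z * w) = (gauge z * gauge w)%g => //.
apply: (aut_ext psi_cuntz) => h; have [gl _ _] := aut_hom (gauge z).
rewrite gauge_psi ?normrM ?z1 ?w1 ?mulr1 //.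
transitivity (gauge z (gauge w (psi h))) => //.
by rewrite !gauge_psi // (linZ gl) gauge_psi // scalerA mulrC.
Qed.

Lemma gauge1 a : gauge 1 a = a.
Proof.
have -> : gauge 1 = 1%g => //.
by apply: (aut_ext psi_cuntz) => h; rewrite gauge_psi ?normr1 // scale1r.
Qed.

Lemma gauge_psiI z n (I : idx d n) : `|z| = 1 -> gauge z (psi_I I) = z ^+ n *: psi_I I.
Proof.
move=> z1; have [gl gm _] := aut_hom (gauge z).
elim: n I => [|n IH] I /=; first by rewrite (aut_unit psi_cuntz) expr0 scale1r.
case: I => I i; rewrite gm IH gauge_psi // csZl csZr scalerA.
by rewrite exprSr.
Qed.

Lemma gauge_word z m l (I : idx d m) (J : idx d l) : `|z| = 1 ->
  gauge z (psi_I I ** cs_adj (psi_I J)) = (z ^+ m * z^* ^+ l) *: (psi_I I ** cs_adj (psi_I J)).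
Proof.
move=> z1; have [gl gm ga] := aut_hom (gauge z).
by rewrite gm ga !gauge_psiI // cs_adjZ csZl csZr scalerA rmorphXn.
Qed.

Lemma circle_powB (z w : C) n : `|z| = 1 -> `|w| = 1 ->
  `|z ^+ n - w ^+ n| <= n%:R * `|z - w|.
Proof.
move=> z1 w1; elim: n => [|n IH]; first by rewrite subrr normr0 mul0r.
have -> : z ^+ n.+1 - w ^+ n.+1 = (z - w) * z ^+ n + w * (z ^+ n - w ^+ n) by rewrite !exprS mulrBl mulrBr addrA subrK.
apply: (le_trans (ler_normD _ _)); rewrite !normrM normrX z1 w1 expr1n mulr1 mul1r.
by rewrite -natr1 mulrDl mul1r addrC lerD2r.
Qed.

Lemma circle_monomialB (z w : C) m l : `|z| = 1 -> `|w| = 1 ->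
  `|z ^+ m * z^* ^+ l - w ^+ m * w^* ^+ l| <= (m + l)%:R * `|z - w|.
Proof.
move=> z1 w1.
have -> : z ^+ m * z^* ^+ l - w ^+ m * w^* ^+ l =
  z^* ^+ l * (z ^+ m - w ^+ m) + w ^+ m * (z^* ^+ l - w^* ^+ l).
  by rewrite !mulrBr addrA [_ * z ^+ m]mulrC [_ * w ^+ m]mulrC subrK.
apply: (le_trans (ler_normD _ _)); rewrite !normrM !normrX norm_conjC z1 w1 !expr1n !mul1r.
rewrite natrD mulrDl; apply: lerD; first exact: circle_powB.
apply: (le_trans (circle_powB _ _ _)); rewrite ?norm_conjC //.
by rewrite -rmorphB norm_conjC.
Qed.

(** On a word the action multiplies by a monomial in z and its conjugate, which is Lipschitz on the
    circle. Density of the words and contractivity extend continuity to all a, with errors c/4, c/4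
    and c/2. *)
Lemma gauge_continuous (a : Od) : {within [set z | `|z| = 1], continuous (gauge ^~ a)}.
Proof.
apply/subspace_continuousP => z0 /= z01; apply/cvgrPdist_lt => c c0.
have c4 : 0 < c / 4 by rewrite divr_gt0.
have : closure (star_generated (range psi)) a by case: psi_cuntz => _ -> _.
move=> /(_ (ball a (c / 4)) (nbhsx_ballx _ _ c4)) [y [/(star_generated_words psi_cuntz)]].
move=> [n [b [u [/choice [w wE] yE]]]]; rewrite -ball_normE /= => hy.
pose f (z : C) : Od := \sum_i (b i * (z ^+ tag (w i).1 * z^* ^+ tag (w i).2)) *: u i.
have fE z : `|z| = 1 -> gauge z y = f z.
  move=> z1; have [gl _ _] := aut_hom (gauge z).
  rewrite yE (lin_sum gl); apply: eq_bigr => i _.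
  by rewrite (linZ gl) wE gauge_word // scalerA.
pose K := \sum_i `|b i| * (tag (w i).1 + tag (w i).2)%:R * `|u i|.
have K0 : 0 <= K by apply: sumr_ge0 => i _; rewrite !mulr_ge0.
have c2 : 0 < c / 2 / (K + 1) by rewrite !divr_gt0 // ltr_wpDl.
have fK z : `|z| = 1 -> `|f z0 - f z| <= K * `|z0 - z|.
  move=> z1; rewrite /f -sumrB mulr_suml; apply: (le_trans (ler_norm_sum _ _ _)).
  apply: ler_sum => i _; rewrite -scalerBl -mulrBr normrZ normrM.
  by rewrite [leRHS]mulrAC ler_wpM2r // -mulrA ler_wpM2l // circle_monomialB.
near=> z.
have z1 : `|z| = 1 by near: z; exact: withinT.
have zz : `|z0 - z| < c / 2 / (K + 1).
  by near: z; rewrite near_withinE; apply/nbhs_ballP; exists (c / 2 / (K + 1)) => // w'.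
have [gl _ _] := aut_hom (gauge z); have [gl0 _ _] := aut_hom (gauge z0).
have -> : gauge z0 a - gauge z a = gauge z0 (a - y) - gauge z (a - y) + (f z0 - f z).
  by rewrite (linB gl) (linB gl0) -!fE // opprB -addrA [X in _ = _ + X]addrC !subrKA.
rewrite (splitr c); apply: (le_lt_trans (ler_normD _ _)); apply: ltrD.
  rewrite (splitr (c / 2)); apply: (le_lt_trans (ler_normB _ _)).
  have -> : c / 2 / 2 = c / 4 by rewrite -mulrA -invfM -natrM.
  by apply: ltrD; apply: (le_lt_trans (aut_contr psi_cuntz _ _)).
apply: (le_lt_trans (fK _ z1)); apply: (@le_lt_trans _ _ ((K + 1) * `|z0 - z|)).
  by rewrite ler_wpM2r // lerDl ler01.
by rewrite mulrC -ltr_pdivlMr // ltr_wpDl.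
Unshelve. all: by end_near.
Qed.

Section GaugeTheta.
Variables (T : drCat R) (H : embedding T) (x : T) (e : 'I_d -> H x).
Hypothesis oe : onb e.
Local Notation Th := (Theta psi_cuntz e).

(** Both automorphisms preserve the span of the psi_k, and the gauge acts there by a scalar. *)
Lemma gauge_autset z a y : `|z| = 1 -> autset psi e a -> a (gauge z y) = gauge z (a y).
Proof.
move=> z1 [W aW]; have [al _ _] := aut_hom a; have [gl _ _] := aut_hom (gauge z).
suff E : (a * gauge z = gauge z * a)%g by rewrite -[LHS]/((a * gauge z)%g y) E.
apply: (aut_ext psi_cuntz) => h; transitivity (a (gauge z (psi h))) => //.
transitivity (gauge z (a (psi h))) => //.
rewrite gauge_psi // (linZ al) aW /vec (lin_sum gl) scaler_sumr.
by apply: eq_bigr => k _; rewrite (linZ gl) gauge_psi // !scalerA mulrC.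
Qed.

Lemma gauge_Theta z l m (t : arr (tpow x l) (tpow x m)) : `|z| = 1 ->
  gauge z (Th t) = z ^ (m%:Z - l%:Z) *: Th t.
Proof.
move=> z1; have [gl gm ga] := aut_hom (gauge z).
have zV : z^* = z^-1.
  have z0 : z != 0 by rewrite -normr_gt0 z1.
  by apply: (mulfI z0); rewrite -normCK z1 expr1n divff.
have -> : z ^ (m%:Z - l%:Z) = z ^+ m * z^* ^+ l.
  rewrite expfzDr; last by rewrite -normr_gt0 z1.
  by rewrite -invr_expz zV exprVn.
rewrite /Theta (lin_sum gl) scaler_sumr; apply: eq_bigr => J _.
rewrite /Psi !cs_suml (lin_sum gl) scaler_sumr; apply: eq_bigr => I _.
by rewrite !csZl (linZ gl) gauge_word // !scalerA mulrC.
Qed.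

End GaugeTheta.

End Gauge.

(** * The fixed-point algebra as a Doplicher-Roberts algebra *)

Section FixedAlgebra.
Variables (R : realType) (d : nat) (Od : cstarAlg R) (psi : 'I_d -> Od).
Hypothesis psi_cuntz : is_cuntz psi.
Local Notation C := (cplx R).

Definition fixed_by (K : set (cstar_aut Od)) : set Od := [set y | forall a, K a -> a y = y].

Lemma fixed_algebra_exists (K : set (cstar_aut Od)) :
  exists (O : cstarAlg R) (f : O -> Od), star_iso_onto f (fixed_by K) /\ forall y, `|f y| = `|y|.
Proof.
have X0 : fixed_by K 0 by move=> a _; have [al _ _] := aut_hom a; rewrite (lin0 al).
have Xl c x y : fixed_by K x -> fixed_by K y -> fixed_by K (c *: x + y).
  by move=> hx hy a Ka; have [al _ _] := aut_hom a; rewrite al hx ?hy.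
pose X := LSubspace (submod_of_set X0 Xl).
have Xm (x y : Od) : ss_set X x -> ss_set X y -> ss_set X (x ** y).
  by move=> hx hy a Ka; have [_ am _] := aut_hom a; rewrite am hx ?hy.
have Xa (x : Od) : ss_set X x -> ss_set X (cs_adj x).
  by move=> hx a Ka; have [_ _ aa] := aut_hom a; rewrite aa hx.
have Xc : closed (ss_set X).
  move=> y cy a Ka; have [al _ _] := aut_hom a.
  apply/eqP; rewrite -subr_eq0 -normr_eq0; apply/eqP.
  apply: (@eps_le _ _ 2) => // c c0.
  have [z [hz]] := cy (ball y c) (nbhsx_ballx _ _ c0).
  rewrite -ball_normE /= => yz.
  have -> : a y - y = a (y - z) - (y - z) by rewrite (linB al) hz // opprB addrA subrK.
  apply: (le_trans (ler_normB _ _)); rewrite mulr_natl mulr2n.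
  by apply: lerD; rewrite ?(le_trans (aut_contr psi_cuntz _ _)) // ltW.
exists (sub_alg Xm Xa Xc), (@sub_incl _ _ _ Xm Xa Xc); split; first exact: sub_incl_onto.
exact: sub_incl_norm.
Qed.

End FixedAlgebra.

Section IsoOnto.
Variables (R : realType) (O A : cstarAlg R) (f : O -> A) (X : set A).
Hypothesis hf : star_iso_onto f X.

Definition onto_lift (y : A) : O := xget 0 [set z | f z = y].

Lemma onto_in z : X (f z). Proof. by have [_ _ <-] := hf; exists z. Qed.

Lemma onto_liftK y : X y -> f (onto_lift y) = y.
Proof.
have [_ _ <-] := hf; move=> [z _ zy]; rewrite /onto_lift; case: xgetP => // /(_ z) /=.
by rewrite zy.
Qed.

Lemma onto_inj : injective f. Proof. by case: hf. Qed.
Lemma onto_hom : star_hom f. Proof. by case: hf. Qed.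

Lemma lift_star_iso (a : cstar_aut A) (b : A -> A) :
  (forall y, X y -> X (a y)) -> (forall y, X y -> X (b y)) ->
  (forall y, a (b y) = y) -> star_iso (fun z => onto_lift (a (f z))).
Proof.
move=> Xa Xb ab; have [fl fm fa] := onto_hom; have [[al am aa] abij] := aut_iso a.
have ba y : b (a y) = y by apply: (bij_inj abij); rewrite ab.
have E z : f (onto_lift (a (f z))) = a (f z) by apply/onto_liftK/Xa/onto_in.
split; last first.
  exists (fun z => onto_lift (b (f z))) => z; apply: onto_inj.
    by rewrite E ba onto_liftK //; exact: onto_in.
  by rewrite E onto_liftK ?ab //; exact/Xb/onto_in.
split=> [c y z|y z|y]; apply: onto_inj.
- by rewrite E !fl al !E.
- by rewrite E !fm am !E.
- by rewrite E !fa aa E.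
Qed.

End IsoOnto.

Section DRAlgebra.
Variables (R : realType) (d : nat) (Od : cstarAlg R) (psi : 'I_d -> Od).
Hypothesis psi_cuntz : is_cuntz psi.
Local Notation C := (cplx R).
Variables (T : drCat R) (H : embedding T) (x : T) (e : 'I_d -> H x).
Hypothesis oe : onb e.
Variables (O : cstarAlg R) (f : O -> Od).
Hypothesis hf : star_iso_onto f (fixed_by (autset psi e)).
Hypothesis fnorm : forall y, `|f y| = `|y|.
Local Notation Theta := (Theta psi_cuntz e).

Lemma Theta_fixed l m (t : arr (tpow x l) (tpow x m)) : fixed_by (autset psi e) (Theta t).
Proof. by move=> a [W aW]; exact: (aut_Theta psi_cuntz oe oe aW). Qed.

Definition dr_theta l m (t : arr (tpow x l) (tpow x m)) : O := onto_lift f (Theta t).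

Lemma dr_thetaE l m (t : arr (tpow x l) (tpow x m)) : f (dr_theta t) = Theta t.
Proof. exact/(onto_liftK hf)/Theta_fixed. Qed.

Lemma gauge_fixed z y : `|z| = 1 -> fixed_by (autset psi e) y ->
  fixed_by (autset psi e) (gauge psi_cuntz z y).
Proof. by move=> z1 hy a Ka; rewrite (gauge_autset psi_cuntz _ z1 Ka) hy. Qed.

(** Identities are checked in O_d after applying the injective f. The norm limit uses that the unit
    is nonzero for d > 0, density is [fixed_approx], and the circle action restricts because it
    commutes with the group. *)
Lemma dr_theta_algebra : is_dr_algebra dr_theta.
Proof.
have [fl fm fa] := onto_hom hf; have fi := onto_inj hf.
have gV (z : C) : `|z| = 1 -> `|z^*| = 1 /\ z * z^* = 1.
  by move=> z1; rewrite norm_conjC -normCK z1 expr1n.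
pose beta z y := onto_lift f (gauge psi_cuntz z (f y)).
have bE z y : `|z| = 1 -> f (beta z y) = gauge psi_cuntz z (f y).
  by move=> z1; apply: (onto_liftK hf); apply: gauge_fixed => //; exact: (onto_in hf).
split.
- by move=> l m c s t; apply: fi; rewrite fl !dr_thetaE (Theta_lin psi_cuntz oe).
- by move=> l m t; apply: fi; rewrite !dr_thetaE (Theta_stab psi_cuntz oe).
- move=> l m t; have nz (d0 : (0 < d)%N) : cunit psi_cuntz != 0.
    exact: (cuntz_unit_neq0 d0 psi_cuntz (cunit_unit psi_cuntz)).
  by rewrite -fnorm dr_thetaE; exact (@Theta_norm_lim _ _ _ _ _ _ _ _ _ oe nz _ _ t).
- by move=> l m n s t; apply: fi; rewrite fm !dr_thetaE (Theta_comp psi_cuntz oe).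
- by move=> l m t; apply: fi; rewrite fa !dr_thetaE (Theta_adj psi_cuntz oe).
- apply/seteqP; split=> // y _ B /nbhs_ballP [c /= c0 cB].
  have [z] := fixed_approx psi_cuntz oe (onto_in hf y) c0.
  move=> [n [b [u [hu ->]]]] hz.
  have uE i : f (onto_lift f (u i)) = u i.
    by apply: (onto_liftK hf); have [l [m [t ->]]] := hu i; exact: Theta_fixed.
  exists (\sum_i b i *: onto_lift f (u i)); split.
    exists n, b, (fun i => onto_lift f (u i)); split=> // i.
    by have [l [m [t ->]]] := hu i; exists l, m, t.
  apply: cB; rewrite -ball_normE /= -fnorm (linB fl) (lin_sum fl).
  by under eq_bigr do rewrite (linZ fl) uE.
- exists beta; split.
  + move=> z z1; have [zc1 zz] := gV z z1.
    apply: (lift_star_iso hf (b := gauge psi_cuntz z^*)).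
    * by move=> y; exact: gauge_fixed.
    * by move=> y; exact: gauge_fixed.
    * by move=> y; rewrite -gaugeM // zz gauge1.
  + move=> z w y z1 w1; apply: fi; rewrite !bE ?normrM ?z1 ?w1 ?mulr1 //.
    exact: gaugeM.
  + move=> y; apply/subspace_continuousP => z0 /= z01; apply/cvgrPdist_lt => c c0.
    have /subspace_continuousP /(_ z0 z01) /cvgrPdist_lt /(_ c c0) := @gauge_continuous _ _ _ _ psi_cuntz (f y).
    rewrite !near_withinE; apply: filterS => z h z1.
    by rewrite -fnorm (linB fl) !bE //; exact: h.
  + move=> z l m t z1; apply: fi.
    by rewrite bE // (linZ fl) dr_thetaE gauge_Theta.
Qed.

End DRAlgebra.

Section CuntzAction.
Variables (R : realType) (d : nat) (Od : cstarAlg R) (psi : 'I_d -> Od).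
Hypothesis psi_cuntz : is_cuntz psi.
Variables (T : drCat R) (H : embedding T) (x : T) (e : 'I_d -> H x).
Hypothesis oe : onb e.

Definition cuntz_act (g : tensorUnitary H) : cstar_aut Od :=
  sval (cid (implements_exists psi_cuntz oe oe (nu_of_tu g))).

Lemma cuntz_actP g : implements psi e e (nu_of_tu g) (cuntz_act g).
Proof. exact: (svalP (cid (implements_exists psi_cuntz oe oe (nu_of_tu g)))). Qed.

Lemma cuntz_actM : {morph cuntz_act : g h / (g * h)%g}.
Proof.
move=> g h; apply: (aut_ext psi_cuntz) => k.
rewrite cuntz_actP; symmetry.
exact: (implements_comp oe (cuntz_actP h) (cuntz_actP g)).
Qed.

HB.instance Definition _ := isMultiplicative.Build _ _ cuntz_act cuntz_actM.

Lemma cuntz_action : is_cuntz_action e psi cuntz_act.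
Proof. by move=> g h; exact: cuntz_actP. Qed.

Lemma range_cuntz_act : range cuntz_act = autset psi e.
Proof.
apply/seteqP; split=> [_ [g _ <-]|a [W aW]]; first by exists (nu_of_tu g); exact: cuntz_actP.
exists (tu_of_nu W) => //; apply: (aut_ext psi_cuntz) => k.
by rewrite cuntz_actP aW.
Qed.

End CuntzAction.

(** * Transport of embeddings along the poset *)

Section Transport.
Variables (R : realType) (d : nat) (Od : cstarAlg R) (psi : 'I_d -> Od).
Hypothesis psi_cuntz : is_cuntz psi.

Lemma implements_whisker (S T : drCat R) (F : tensorFunctor S T) (hF : tensor_iso F)
  (H H' : embedding T) (x : S) (y : T) (p : F x = y) (e : 'I_d -> H y) (e' : 'I_d -> H' y)
  (W : natUnitary H H') (a : cstar_aut Od) : implements psi e e' W a ->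
  implements psi (pbasis hF p e) (pbasis hF p e') (nu_whisker hF W) a.
Proof. by subst y; rewrite !pbasis_refl. Qed.

Lemma implements_coe (S T U : drCat R) (F : tensorFunctor S T) (G : tensorFunctor T U)
  (L : tensorFunctor S U) (hF : tensor_iso F) (hG : tensor_iso G) (hL : tensor_iso L)
  (H : embedding U) (q : forall x, G (F x) = L x)
  (hq : forall x y (t : arr x y),
    coe (q y) ∘ fhom G (fhom F t) = fhom L t ∘ coe (q x))
  (x : S) (y : T) (z : U) (p1 : F x = y) (p2 : G y = z) (p3 : L x = z) (e : 'I_d -> H z) :
  onb e ->
  implements psi (pbasis hF p1 (pbasis hG p2 e)) (pbasis hL p3 e)
    (nu_coe hF hG hL H hq) 1%g.
Proof.
move=> oe h; rewrite -[LHS](vec_e psi (pbasis_onb hL p3 oe)); congr (vec _ _ _).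
rewrite /pbasis /= (fhom_coe (F := G) _ (f_equal G (esym p1))).
by rewrite -!emb_hom_comp !coe_comp; congr (emb_hom _ _ _); exact: coe_irr.
Qed.

Variables (disp : Order.disp_t) (D : porderType disp).
Variables (S : drPresheaf R D) (rho : drSection S) (K : set (cstar_aut Od)).

(** An embedding at o whose unitary group has the prescribed image; K, taken from the base point,
    becomes one subgroup common to all points. *)
Definition reference (o : D) := exists (H : embedding (S o)) (e : 'I_d -> H (rho o)),
  onb e /\ autset psi e = K.

Lemma reference_up o w : (o <= w)%O -> reference o -> reference w.
Proof.
move=> h [H [e [oe eK]]]; exists (embF H (dp_iso S h)), (pbasis (dp_iso S h) (ds_res rho h) e).
by split; [exact: pbasis_onb|rewrite autset_pbasis].
Qed.

Lemma reference_down o w : (o <= w)%O -> reference w -> reference o.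
Proof.
move=> h [H [e [oe eK]]].
have [G [p [q [hG _ _]]]] := tensor_iso_inverse (dp_iso S h).
have Gr : G (rho o) = rho w by rewrite -(ds_res rho h) q.
exists (embF H hG), (pbasis hG Gr e).
by split; [exact: pbasis_onb|rewrite autset_pbasis].
Qed.

Lemma reference_path o w : ppath o w -> reference o -> reference w.
Proof.
have step (b : presimplex D 1) : is_simplex b -> reference (face 1 b) -> reference (face 0 b).
  move=> hb; move/(reference_up (simplex1_le (isT : 1 <= 1)%N hb)).
  exact: (reference_down (simplex1_le (isT : 0 <= 1)%N hb)).
by elim=> [b /step //|v b /step hb p IH /IH].
Qed.

Hypothesis refs : forall o, reference o.

Definition refH o : embedding (S o) := projT1 (cid (refs o)).
Definition refe o : 'I_d -> refH o (rho o) := projT1 (cid (projT2 (cid (refs o)))).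

Lemma refP o : onb (@refe o) /\ autset psi (@refe o) = K.
Proof. exact: (projT2 (cid (projT2 (cid (refs o))))). Qed.

Definition pulled o w (h : (o <= w)%O) : 'I_d -> embF (refH o) (dp_iso S h) (rho w) :=
  pbasis (dp_iso S h) (ds_res rho h) (@refe o).

Lemma transport_exists o w (h : (o <= w)%O) :
  exists (W : natUnitary (refH w) (embF (refH o) (dp_iso S h))) a,
    implements psi (@refe w) (pulled h) W a.
Proof.
(* With the empty list the inequality is void and only the existence of a natural unitary
   remains. *)
have [W _] := @natural_unitary_exists _ _ (refH w) (embF (refH o) (dp_iso S h)) [::].
have [oe _] := refP o; have [ow _] := refP w.
have [a aW] := implements_exists psi_cuntz ow (pbasis_onb (dp_iso S h) (ds_res rho h) oe) W.
by exists W, a.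
Qed.

Definition transport o w (h : (o <= w)%O) : cstar_aut Od :=
  sval (cid (svalP (cid (transport_exists h)))).

Lemma transportP o w (h : (o <= w)%O) :
  exists W, implements psi (@refe w) (pulled h) W (transport h).
Proof.
exists (sval (cid (transport_exists h))).
exact: (svalP (cid (svalP (cid (transport_exists h))))).
Qed.

Lemma transport_normal o w (h : (o <= w)%O) b :
  K b <-> K ((transport h)^-1 * b * transport h)%g.
Proof.
have [W hW] := transportP h; have [oe oK] := refP o; have [ow wK] := refP w.
have := implements_autset b ow (pbasis_onb (dp_iso S h) (ds_res rho h) oe) hW.
by rewrite autset_pbasis oK wK.
Qed.

(** Going from x to o through w and going directly give implementers of two unitaries between the
    same embeddings, once the two pullbacks of H_o to x are identified; this identification is
    implemented by 1. *)
Lemma transport_chain o w x (h1 : (o <= w)%O) (h2 : (w <= x)%O) (h3 : (o <= x)%O) :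
  K ((transport h3)^-1 * (transport h1 * transport h2))%g.
Proof.
have [W1 i1] := transportP h1; have [W2 i2] := transportP h2; have [W3 i3] := transportP h3.
have [oe oK] := refP o; have [ow wK] := refP w; have [ox xK] := refP x.
rewrite -xK.
have j1 := implements_whisker (dp_iso S h2) (ds_res rho h2) i1.
have j2 := @implements_coe _ _ _ _ _ _ (dp_iso S h2) (dp_iso S h1) (dp_iso S h3) (refH o) _
  (@dp_res_hom _ _ _ S _ _ _ h1 h2 h3) _ _ _ (ds_res rho h2) (ds_res rho h1) (ds_res rho h3) _ oe.
rewrite -[(transport h1 * _)%g]mul1g.
have op1 := pbasis_onb (dp_iso S h2) (ds_res rho h2) ow.
have op2 := pbasis_onb (dp_iso S h2) (ds_res rho h2) (pbasis_onb (dp_iso S h1) (ds_res rho h1) oe).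
have op3 := pbasis_onb (dp_iso S h3) (ds_res rho h3) oe.
apply: (implements_torsor ox op3 i3).
exact: (implements_comp op2 (implements_comp op1 i2 j1) j2).
Qed.

Lemma transport_Theta o w (h : (o <= w)%O) l m (t : arr (tpow (rho w) l) (tpow (rho w) m)) :
  transport h (Theta psi_cuntz (@refe w) t) =
  Theta psi_cuntz (@refe o) (fhom_tpow (ds_res rho h) t).
Proof.
have [W hW] := transportP h; have [oe oK] := refP o; have [ow wK] := refP w.
rewrite -(Theta_pbasis psi_cuntz (dp_iso S h)).
exact: (aut_Theta psi_cuntz ow (pbasis_onb (dp_iso S h) (ds_res rho h) oe) hW).
Qed.

End Transport.

(** * Cocycles and gerbes from transition automorphisms *)

Section CongruenceModSubgroup.
Local Open Scope group_scope.
Variables (G : groupType) (K : subgroup G).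
Local Notation N := (normalizer_set K).

Lemma sg1 : sg_set K 1.
Proof. by have [K1 _] := sg_closed K; rewrite inE in K1. Qed.

Lemma sgV x : sg_set K x -> sg_set K x^-1.
Proof.
move=> Kx; have [_ Kd] := sg_closed K.
by have := Kd 1 x; rewrite !inE /= mul1g; apply => //; exact: sg1.
Qed.

Lemma sgM x y : sg_set K x -> sg_set K y -> sg_set K (x * y).
Proof.
move=> Kx Ky; have [_ Kd] := sg_closed K.
have := Kd x y^-1; rewrite !inE /= invgK; apply => //; exact: sgV.
Qed.

Lemma normM u v : N u -> N v -> N (u * v).
Proof.
move=> Nu Nv x; rewrite invgM !mulgA -[u * v * x * v^-1]mulgA -[u * v * _]mulgA.
rewrite [v * _]mulgA (Nv x) (Nu (v * x * v^-1)).
by rewrite !mulgA.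
Qed.

Lemma normV u : N u -> N u^-1.
Proof. by move=> Nu x; rewrite (Nu (u^-1 * x * u^-1^-1)) invgK !mulgA mulgV mul1g mulgK. Qed.

(** Congruence modulo K; its compatibility with products, [eqK_mul], uses that the left factor
    normalizes K. *)
Definition eqK x y := sg_set K (x * y^-1).

Lemma eqK_refl x : eqK x x.
Proof. by rewrite /eqK mulgV; exact: sg1. Qed.

Lemma eqK_sym x y : eqK x y -> eqK y x.
Proof. by rewrite /eqK => /sgV; rewrite invgM invgK. Qed.

Lemma eqK_trans x y z : eqK x y -> eqK y z -> eqK x z.
Proof. by rewrite /eqK => /sgM h /h; rewrite mulgA mulgVK. Qed.

Lemma eqK_mul x x' y y' : N x -> eqK x x' -> eqK y y' -> eqK (x * y) (x' * y').
Proof.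
rewrite /eqK => Nx Ex Ey; have [/(_ Ey) h _] := Nx (y * y'^-1).
by have := sgM h Ex; rewrite invgM !mulgA mulgVK.
Qed.

Lemma eqK_inv x y : N x -> eqK x y -> eqK x^-1 y^-1.
Proof.
move=> Nx /eqK_sym Exy; have [/(_ Exy) h _] := normV Nx (y * x^-1).
by move: h; rewrite /eqK !invgK -!mulgA mulVg mulg1.
Qed.

Section Transition.
Variables (disp : Order.disp_t) (D : porderType disp) (n : D -> D -> G).
Hypothesis n_norm : forall o w, N (n o w).
Hypothesis n_chain : forall o w x, (o <= w)%O -> (w <= x)%O ->
  eqK (n w x * n o w) (n o x).

Definition transition (b : presimplex D 1) : G :=
  (n (face 0 b) (supp b))^-1 * n (face 1 b) (supp b).

Lemma transition_norm b : N (transition b).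
Proof. by apply: normM; [exact: normV|]. Qed.

(** Inserting n (supp b) s on the left of both factors leaves the quotient unchanged, and the chain
    rule then replaces the support by s modulo K. *)
Lemma transition_eq b s : is_simplex b -> (supp b <= s)%O ->
  eqK (transition b) ((n (face 0 b) s)^-1 * n (face 1 b) s).
Proof.
move=> hb bs; have h0 := simplex1_le (isT : 0 <= 1)%N hb.
have h1 := simplex1_le (isT : 1 <= 1)%N hb.
have -> : transition b = (n (supp b) s * n (face 0 b) (supp b))^-1 *
    (n (supp b) s * n (face 1 b) (supp b)) by rewrite invgM !mulgA mulgVK.
apply: eqK_mul; [by apply/normV/normM| |exact: n_chain].
by apply: eqK_inv; [exact: normM|exact: n_chain].
Qed.

Definition defect (c : presimplex D 2) : G :=
  transition (face 0 c) * transition (face 2 c) * (transition (face 1 c))^-1.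

(** Measured against the common support of c, the three edges telescope. *)
Lemma defect_in c : is_simplex c -> sg_set K (defect c).
Proof.
move=> [hf hi]; have [s0 l0] := hf 0%N isT; have [s1 l1] := hf 1%N isT.
have [s2 l2] := hf 2%N isT.
have e00 : face 0 (face 0 c) = face 0 (face 1 c) by exact: (hi 0%N 0%N isT).
have e10 : face 1 (face 0 c) = face 0 (face 2 c) by exact: (hi 1%N 0%N isT).
have e11 : face 1 (face 1 c) = face 1 (face 2 c) by exact: (hi 1%N 1%N isT).
suff : eqK (transition (face 0 c) * transition (face 2 c)) (transition (face 1 c)) by [].
apply: (eqK_trans (y := (n (face 0 (face 1 c)) (supp c))^-1 * n (face 1 (face 1 c)) (supp c)));
  last by apply/eqK_sym/transition_eq.
have -> : (n (face 0 (face 1 c)) (supp c))^-1 * n (face 1 (face 1 c)) (supp c) =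
   ((n (face 0 (face 0 c)) (supp c))^-1 * n (face 1 (face 0 c)) (supp c)) *
   ((n (face 0 (face 2 c)) (supp c))^-1 * n (face 1 (face 2 c)) (supp c)).
  by rewrite e00 e10 e11 !mulgA mulgK.
by apply: eqK_mul; [exact: transition_norm|exact: transition_eq|exact: transition_eq].
Qed.

Definition tr_u (b : presimplex D 1) : sg_type (normalizer K) :=
  exist _ (transition b) (mem_set (transition_norm b)).

(** The value 1 off the simplices is a default; the cocycle conditions concern simplices only. *)
Definition tr_g (c : presimplex D 2) : sg_type K :=
  if pselect (is_simplex c) is left h then exist _ (defect c) (mem_set (defect_in h)) else 1.

Lemma tr_gE c : is_simplex c -> \val (tr_g c) = defect c.
Proof. by rewrite /tr_g => hc; case: pselect. Qed.

(** The elements g_c are defects of a group-valued u, so coherence is an identity of words in the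
    group once the faces are identified. *)
Definition tr_cocycle : cocycle D (normalizer_twoGroup K).
Proof.
apply: (@Cocycle _ D (normalizer_twoGroup K) tr_u tr_g).
  by move=> c hc; apply: val_inj; rewrite /= tr_gE.
move=> t [hf hi]; have [s0 _] := hf 0%N isT; have [s1 _] := hf 1%N isT.
have [s2 _] := hf 2%N isT; have [s3 _] := hf 3%N isT.
apply: val_inj; rewrite /= !tr_gE // /defect /=.
have e00 : face 0 (face 0 t) = face 0 (face 1 t) by exact: (hi 0%N 0%N isT).
have e10 : face 1 (face 0 t) = face 0 (face 2 t) by exact: (hi 1%N 0%N isT).
have e20 : face 2 (face 0 t) = face 0 (face 3 t) by exact: (hi 2%N 0%N isT).
have e11 : face 1 (face 1 t) = face 1 (face 2 t) by exact: (hi 1%N 1%N isT).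
have e21 : face 2 (face 1 t) = face 1 (face 3 t) by exact: (hi 2%N 1%N isT).
have e22 : face 2 (face 2 t) = face 2 (face 3 t) by exact: (hi 2%N 2%N isT).
rewrite e00 e10 e20 e11 e21 e22.
move: (transition (face 0 (face 1 t))) (transition (face 0 (face 3 t)))
  (transition (face 0 (face 2 t))) (transition (face 2 (face 3 t)))
  (transition (face 1 (face 2 t))) (transition (face 1 (face 3 t))) => A B E F G' H'.
by rewrite !mulgA !mulgVK.
Defined.

Definition holonomy (s : seq (presimplex D 1)) : G :=
  foldl (fun x b => transition b * x) 1 s.

Lemma holonomy_cat s t : holonomy (s ++ t) = holonomy t * holonomy s.
Proof.
elim/last_ind: t => [|t b IH]; first by rewrite cats0 mul1g.
by rewrite -rcons_cat /holonomy !foldl_rcons -/(holonomy _) IH mulgA.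
Qed.

Lemma holonomy_norm s : N (holonomy s).
Proof.
elim/last_ind: s => [|s b IH]; first by move=> x; rewrite mul1g invg1 mulg1.
by rewrite /holonomy foldl_rcons; apply: normM => //; exact: transition_norm.
Qed.

Lemma holonomy_homotopic s t : homotopic s t -> eqK (holonomy s) (holonomy t).
Proof.
elim=> {s t} [s t c hc|s|s t _|s t v _ h1 _ h2].
- rewrite !holonomy_cat -cat1s -[face 2 c :: _]/([:: face 2 c; face 0 c] ++ t) !holonomy_cat.
  apply: eqK_mul; [by apply: normM; exact: holonomy_norm| |exact: eqK_refl].
  apply: eqK_mul; [exact: holonomy_norm|exact: eqK_refl|].
  by apply: eqK_sym; rewrite /holonomy /= !mulg1; exact: defect_in.
- exact: eqK_refl.
- exact: eqK_sym.
- exact: eqK_trans h1 h2.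
Qed.

Variable a : D.

Lemma holonomy_loops (s : pi1 a -> ppath a a) : (forall l, \pi_(pi1 a)%qT (s l) = l) ->
  forall l m, eqK (holonomy (trace (s l)) * holonomy (trace (s m)))
     (holonomy (trace (s (l * m)))).
Proof.
move=> hs l m; rewrite -holonomy_cat; apply: holonomy_homotopic.
have hr k : homotopic (trace (repr k)) (trace (s k)).
  by rewrite -{1}(hs k); exact: pi1_repr.
apply: htp_trans (hr _); apply: htp_sym.
have -> : (l * m)%g = \pi_(pi1 a)%qT (pcat (repr m) (repr l) : loop a) by [].
apply: (htp_trans (pi1_repr _)); rewrite trace_cat.
by apply: htp_cat; exact: hr.
Qed.

End Transition.
End CongruenceModSubgroup.

Section TransitionGerbe.
Variables (R : realType) (A : cstarAlg R) (K : subgroup (cstar_aut A)).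
Variables (disp : Order.disp_t) (D : porderType disp) (n : D -> D -> cstar_aut A).
Hypothesis n_norm : forall o w, normalizer_set K (n o w).
Hypothesis n_chain : forall o w x, (o <= w)%O -> (w <= x)%O ->
  eqK K (n w x * n o w)%g (n o x).

Let q := tr_cocycle n_norm n_chain.

Let act : {multiplicative sg_type K -> cstar_aut A} := \val.

Lemma nerve1P (o w : D) : (o <= w)%O -> is_simplex (nerve1 o w).
Proof. by move=> h; apply: is_simplex1. Qed.

Lemma nerve2P (o w x : D) : (o <= w)%O -> (w <= x)%O -> is_simplex (nerve2 o w x).
Proof.
move=> h1 h2; have h3 := le_trans h1 h2.
by apply: is_simplex2 => //; exact: nerve1P.
Qed.

Definition tr_gerbe : cstarGerbe R q.
Proof.
apply: (@CStarGerbe R _ D (normalizer_twoGroup K) q (fun=> A) (fun=> act)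
  (fun o w _ => transition n (nerve1 o w))).
- by move=> o w h; exact: aut_iso.
- move=> o w x h1 h2 h3 v.
  have -> : act (co_g q (nerve2 o w x)) = defect n (nerve2 o w x).
    exact (tr_gE n_norm n_chain (nerve2P h1 h2)).
  rewrite -[LHS]/((defect n (nerve2 o w x) * transition n (nerve1 o x))%g v).
  have -> : (defect n (nerve2 o w x) * transition n (nerve1 o x))%g =
      (transition n (nerve1 w x) * transition n (nerve1 o w))%g by exact: mulgVK.
  by [].
- move=> o w h g v.
  rewrite -[RHS]/((transition n (nerve1 o w) * \val g * (transition n (nerve1 o w))^-1
    * transition n (nerve1 o w))%g v).
  by rewrite mulgVK.
Defined.

Lemma tr_gerbe_hol x y (p : ppath x y) v :
  ge_hol (F := tr_gerbe) p v = holonomy n (trace p) v.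
Proof.
have E (b : presimplex D 1) (hb : is_simplex b) w :
    ge_map1 (F := tr_gerbe) hb w = transition n b w.
  rewrite -[LHS]/(((transition n (nerve1 (face 0 b) (supp b)))^-1 *
    transition n (nerve1 (face 1 b) (supp b)))%g w).
  (* With s the support, both gerbe maps into s carry the factor n s s inverse, which need not be 1;
     it cancels between one map and the inverse of the other. *)
  have key (a1 a2 a3 : cstar_aut A) : ((a1^-1 * a2)^-1 * (a1^-1 * a3) = a2^-1 * a3)%g.
    by rewrite invgM invgK !mulgA mulgK.
  have -> : ((transition n (nerve1 (face 0 b) (supp b)))^-1 *
    transition n (nerve1 (face 1 b) (supp b)))%g = transition n b by exact: key.
  by [].
elim: p v => [b hb|z b hb p IH] v.
  by rewrite [LHS]E -[transition n b]mulg1.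
have -> : holonomy n (trace (pcons hb p)) = (transition n b * holonomy n (trace p))%g.
  by rewrite /holonomy /= foldl_rcons.
by rewrite -[LHS]/(ge_map1 (F := tr_gerbe) hb (ge_hol (F := tr_gerbe) p v)) IH E.
Qed.

End TransitionGerbe.

Lemma orthonormal_basis_onb (R : realType) (H : hilbert R) d (e : 'I_d -> H) :
  orthonormal_basis e -> onb e.
Proof.
move=> [eo es]; split=> // v _.
have : lin_span (range e) v by rewrite es.
move=> [n [c [u [hu ->]]]].
transitivity (\sum_i \sum_k ip (e k) (c i *: u i) *: e k).
  apply: eq_bigr => i _; have [j _ <-] := hu i.
  rewrite (bigD1 j) //= ipZr eo eqxx mulr1 big1 ?addr0 // => k kj.
  by rewrite ipZr eo (negPf kj) mulr0 scale0r.
rewrite exchange_big; apply: eq_bigr => k _ /=.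
by rewrite ip_sumr scaler_suml.
Qed.

(** * Topology and Borel maps on the discrete fundamental group *)

Section DiscreteLoops.
Variables (disp : Order.disp_t) (D : porderType disp) (a : D).

Lemma pi1_nbhs (l : pi1 a) (A : set (pi1 a)) : A l -> nbhs l A.
Proof. by move=> Al; apply/principal_filterP. Qed.

Lemma pi1_borel (U : topologicalType) (f : pi1 a -> U) : borel_map f.
Proof.
move=> V _; apply: sub_sigma_algebra => /=.
by rewrite openE => l Vl; exact: pi1_nbhs.
Qed.

Lemma pi1_borel2 (U : topologicalType) (f : pi1 a * pi1 a -> U) : borel_map f.
Proof.
move=> V _; apply: sub_sigma_algebra => /=.
rewrite openE => -[l m] Vl; exists ([set l], [set m]) => /=.
  by split; exact: pi1_nbhs.
by move=> [l' m'] /= [-> ->].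
Qed.

Lemma pi1_locally_compact : locally_compact [set: pi1 a].
Proof.
move=> l _; exists [set l]; first by apply: pi1_nbhs.
split; first exact: compact_set1.
by move=> m /(_ _ (@pi1_nbhs m [set m] erefl)) [_ [-> ->]].
Qed.

End DiscreteLoops.

Theorem proposition5p5 (R : realType) (disp : Order.disp_t)
  (D : porderType disp) (a : D)
  (D_connected : poset_connected D)
  (pi1_countable : countable [set: pi1 a])
  (S : drPresheaf R D) (rho : drSection S)
  (H : embedding (S a))
  (d : nat) (e : 'I_d -> H (rho a)) (e_basis : orthonormal_basis e)
  (Od : cstarAlg R) (psi : 'I_d -> Od) (Od_cuntz : is_cuntz psi) :
  exists alpha : {multiplicative tensorUnitary H -> cstar_aut Od},
    is_cuntz_action e psi alpha /\
  exists (O : cstarBundle R D)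
    (theta : forall (o : D) (l m : nat),
       arr (tpow (rho o) l) (tpow (rho o) m) -> O o),
    (* (i) *)
    [/\ forall o, is_dr_algebra (theta o),
        forall (o w : D) (ow : (o <= w)%O) (l m : nat)
          (t : arr (tpow (rho w) l) (tpow (rho w) m)),
          cb_map O ow
            (theta o l m (fhom_tpow (ds_res rho ow) t)) = theta w l m t
      & forall o, exists f : O o -> Od, star_iso_onto f (fixed_points alpha)]
    /\
  exists (q : cocycle D (normalizer_twoGroup (image_subgroup alpha)))
    (F : cstarGerbe R q) (kappa : forall o : D, F o -> Od),
    (* (ii) *)
    [/\ forall o, star_iso (kappa o),
        forall (o : D) (g : sg_type (image_subgroup alpha)) (v : F o),
          kappa o (ge_act F o g v) = (\val g) (kappa o v)
      & exists phi : forall o : D, O o -> F o, fixed_point_bundle_iso phi]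
    /\
    (* (iii) *)
    forall s : pi1 a -> ppath a a,
      (forall l, \pi_(pi1 a) (s l) = l) -> s 1%g = prefl a ->
      exists nu : pi1 a -> cstar_aut Od,
        (forall l (v : F a), nu l (kappa a v) = kappa a (ge_hol (s l) v)) /\
        let twisted_by (gamma : pi1 a -> pi1 a -> tensorUnitary H) :=
          forall l m,
            alpha (gamma l m) = (nu l * nu m * (nu (l * m)%g)^-1)%g in
        (exists gamma, twisted_by gamma) /\
        (forall gamma, twisted_by gamma -> twisted_system alpha nu gamma).
Proof.
have oe := orthonormal_basis_onb e_basis.
pose alpha : {multiplicative tensorUnitary H -> cstar_aut Od} := cuntz_act Od_cuntz oe.
pose K := image_subgroup alpha.
have KE : autset psi e = K by rewrite -range_cuntz_act.
exists alpha; split; first exact: cuntz_action.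
have refs o : reference psi rho K o.
  have [p] := D_connected a o; apply: (reference_path p).
  by exists H, e.
(* The identity is the value when o <= w fails, so n is total and normalizes K everywhere. The
   inverse is taken because [transport] leads from the larger point to the smaller. *)
pose n o w : cstar_aut Od :=
  (if @idP (o <= w)%O is ReflectT h then transport Od_cuntz refs h else 1)^-1%g.
have nE o w (h : (o <= w)%O) : n o w = (transport Od_cuntz refs h)^-1%g.
  rewrite /n; case: {-}_ / idP => [h'|//].
  by rewrite (Prop_irrelevance h' h).
have n_norm o w : normalizer_set K (n o w).
  rewrite /n; case: {-}_ / idP => [h|_] x.
    by rewrite invgK; exact: transport_normal.
  by rewrite invg1 mul1g invg1 mulg1.
have n_chain o w x : (o <= w)%O -> (w <= x)%O -> eqK K (n w x * n o w)%g (n o x).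
  move=> h1 h2; have h3 := le_trans h1 h2.
  rewrite (nE _ _ h1) (nE _ _ h2) (nE _ _ h3).
  have := sgV (transport_chain Od_cuntz refs h1 h2 h3).
  by rewrite /eqK !invgM !invgK.
(* n o o comes from a chosen unitary and is 1 only modulo K. *)
have n_refl o : sg_set K (n o o).
  by have := n_chain o o o (lexx o) (lexx o); rewrite /eqK mulgK.
(* One algebra serves as fibre over every point; the points differ by the copy of the arrows inside
   it, determined by [refe]. *)
have [Of [f [hf fnorm]]] := fixed_algebra_exists Od_cuntz K.
have [fl fm fa] := onto_hom hf; have fi := onto_inj hf.
pose u o w := transition n (nerve1 o w).
have fix_norm v y : normalizer_set K v -> fixed_by K y -> fixed_by K (v y).
  move=> Nv hy b Kb; have [_ h] := Nv (v^-1 * b * v)%g.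
  have /h/hy E : sg_set K (v * (v^-1 * b * v) * v^-1)%g by rewrite !mulgA mulgV mul1g mulgK.
  rewrite -[LHS]/((b * v)%g y) -[in RHS]E -[RHS]/((v * (v^-1 * b * v))%g y).
  by rewrite !mulgA mulgV mul1g.
have fix_u o w y : fixed_by K y -> fixed_by K (u o w y).
  by apply: fix_norm; exact: transition_norm.
have fix_uV o w y : fixed_by K y -> fixed_by K ((u o w)^-1%g y).
  by apply: fix_norm; apply: normV; exact: transition_norm.
pose cbm (o w : D) (h : (o <= w)%O) (y : Of) := onto_lift f (u o w (f y)).
have cbE o w (h : (o <= w)%O) y : f (cbm o w h y) = u o w (f y).
  by apply: (onto_liftK hf); apply: fix_u; exact: (onto_in hf).
pose q := tr_cocycle n_norm n_chain.
pose F := tr_gerbe n_norm n_chain.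
(* The defect of the gerbe lies in K and acts trivially on the fixed points, where the gerbe is
   therefore an honest bundle. *)
have u_comp o w x (h1 : (o <= w)%O) (h2 : (w <= x)%O) y : fixed_by K y ->
    u w x (u o w y) = u o x y.
  move=> hy; have h3 := le_trans h1 h2.
  rewrite -[LHS](@ge_comp _ _ _ _ _ F _ _ _ h1 h2 h3 y).
  have hg : sg_set K (\val (co_g q (nerve2 o w x))).
    exact (set_mem (svalP (co_g q (nerve2 o w x)))).
  exact: (fix_u _ _ _ hy _ hg).
have cb_iso' o w (h : (o <= w)%O) : star_iso (cbm o w h).
  apply: (lift_star_iso hf (b := (u o w)^-1%g)); [exact: fix_u|exact: fix_uV|].
  by move=> y; rewrite -[LHS]/((u o w * (u o w)^-1)%g y) mulgV.
have cb_comp' o w x (h1 : (o <= w)%O) (h2 : (w <= x)%O) (h3 : (o <= x)%O) v :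
    cbm w x h2 (cbm o w h1 v) = cbm o x h3 v.
  by apply: fi; rewrite !cbE u_comp //; exact: (onto_in hf).
have fixE : fixed_points alpha = fixed_by K.
  apply/seteqP; split=> y hy; first by move=> _ [g _ <-]; exact: hy.
  by move=> g; apply: hy; exists g.
pose O := @CStarBundle R _ D (fun=> Of) cbm cb_iso' cb_comp'.
have hfo o : star_iso_onto f (fixed_by (autset psi (refe refs o))).
  by have [_ ->] := refP refs o.
exists O, (fun o => dr_theta Od_cuntz (refe refs o) f); split.
  split.
  - by move=> o; apply: (dr_theta_algebra _ (refP refs o).1 (hfo o) fnorm).
  - move=> o w h l m t; apply: fi; rewrite cbE.
    have th o' := dr_thetaE Od_cuntz (refP refs o').1 (hfo o').
    rewrite !th -(transport_Theta Od_cuntz); set X := Theta _ _ t.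
    have hX : fixed_by K X.
      by rewrite -(refP refs w).2; exact: Theta_fixed (refP refs w).1 _ _ t.
    (* n o w cancels the transport; what remains is the inverse of n w w, an element of K, which
       fixes the image of an arrow. *)
    have -> : u o w (transport Od_cuntz refs h X) = (n w w)^-1%g X.
      rewrite -[LHS]/(((n w w)^-1 * n o w * transport Od_cuntz refs h)%g X) (nE _ _ h).
      by rewrite mulgVK.
    exact: (hX _ (sgV (n_refl w))).
  - by move=> o; exists f; rewrite fixE.
exists q, F, (fun o => idfun); split.
  split.
  - by move=> o; exact: aut1_subproof.
  - by [].
  - exists (fun=> f); split; last by move=> o w h v; exact: cbE.
    move=> o; suff -> : fixed_points (ge_act F o) = fixed_by K by [].
    apply/seteqP; split=> y hy.
      by move=> b Kb; exact: (hy (exist _ b (mem_set Kb))).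
    by move=> b; exact: (hy _ (set_mem (svalP b))).
move=> s hs s1; pose nu l := holonomy n (trace (s l)).
have nuM l m : sg_set K (nu l * nu m * (nu (l * m)%g)^-1)%g.
  exact: (holonomy_loops n_norm n_chain hs).
exists nu; split; first by move=> l v; rewrite tr_gerbe_hol.
split.
  (* K is the range of alpha, so each defect of multiplicativity lifts to the group; the lifts are
     chosen on pairs. *)
  have h (p : pi1 a * pi1 a) : exists g, alpha g = (nu p.1 * nu p.2 * (nu (p.1 * p.2)%g)^-1)%g.
    by have [g _ gE] := nuM p.1 p.2; exists g.
  have [g gE] := choice h; exists (fun l m => g (l, m)) => l m; exact: (gE (l, m)).
move=> g gE; split.
- exact: pi1_locally_compact.
- by move=> l; exact: (holonomy_norm n_norm).
- exact: pi1_borel.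
- exact: pi1_borel2.
- rewrite /nu s1 /holonomy /= mulg1; exact: mulVg.
- by move=> l m; rewrite gE mulgVK.
Qed.
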